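(* Let $\alpha>-1$, let $n$ be a positive integer, $\lambda=e^{2\pi i/n}$, $\phi(z)=\lambda z$, and $\psi(z)=g(z^n)$ for some $g\in H^\infty$. Then the weighted composition operator $C_{\psi,\phi}$ on $L^2_a(dA_\alpha)$ satisfies $W(C_{\psi,\phi})=\big(\psi(\mathbb{D})\cup\lambda\psi(\mathbb{D})\cup\cdots\cup\lambda^{n-1}\psi(\mathbb{D})\big)^{\wedge}$.
   Context: $\mathbb{D}$ is the open unit disc, $H^\infty$ the bounded analytic functions on $\mathbb{D}$. $L^2_a(dA_\alpha)$ is the weighted Bergman space of analytic $f$ on $\mathbb{D}$ with $\int_{\mathbb{D}}|f|^2dA_\alpha<\infty$, $dA_{\alpha}(z)=(\alpha+1)(1-|z|^2)^{\alpha}dA(z)$, $dA$ normalized area measure. For an analytic self-map $\phi$ of $\mathbb{D}$ and analytic $\psi$, $C_{\psi,\phi}f=\psi\cdot(f\circ\phi)$. $W(T)=\{\langle Tf,f\rangle:\|f\|=1\}$; $X^\wedge$ is the convex hull. *)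

(* Defs.v *)
From mathcomp Require Import all_boot all_order all_algebra.
From mathcomp Require Import all_classical all_reals all_analysis.
From mathcomp Require Import complex.
Import Order.TTheory GRing.Theory Num.Theory.
Import numFieldNormedType.Exports.

Set Implicit Arguments.
Unset Strict Implicit.
Unset Printing Implicit Defensive.

Local Open Scope ring_scope.
Local Open Scope classical_set_scope.
Local Open Scope complex_scope.

Section Defs.
Variable R : realType.

Definition sqmod (z : R[i]) : R := @complex.Re R z ^+ 2 + @complex.Im R z ^+ 2.

Definition disc : set R[i] := [set z | sqmod z < 1].

Definition discR2 : set (R * R) := [set p | p.1 ^+ 2 + p.2 ^+ 2 < 1].

Definition toC (p : R * R) : R[i] := p.1 +i* p.2.

Definition area := (@lebesgue_measure R \x @lebesgue_measure R)%E.

(* density of dA_alpha w.r.t. Lebesgue area measure: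
   dA = dx dy / pi (normalized),  dA_alpha = (alpha+1)(1-|z|^2)^alpha dA *)
Definition weight (alpha : R) (p : R * R) : R :=
  (alpha + 1) / pi * powR (1 - (p.1 ^+ 2 + p.2 ^+ 2)) alpha.

Definition analytic_on_disc (f : R[i] -> R[i]) : Prop :=
  forall z, z \in disc -> @derivable R[i] R[i]^o R[i]^o f z 1.

Definition Hinfty (g : R[i] -> R[i]) : Prop :=
  analytic_on_disc g /\ exists M : R, forall z, z \in disc -> sqmod (g z) <= M ^+ 2.

Definition bergman (alpha : R) (f : R[i] -> R[i]) : Prop :=
  analytic_on_disc f /\
  area.-integrable discR2
    (fun p => (sqmod (f (toC p)) * weight alpha p)%:E).

Definition inner (alpha : R) (F G : R[i] -> R[i]) : R[i] :=
  let h := fun p => F (toC p) * (G (toC p))^* in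
  (Rintegral area discR2 (fun p => @complex.Re R (h p) * weight alpha p))%:C
  + 'i * (Rintegral area discR2 (fun p => @complex.Im R (h p) * weight alpha p))%:C.

Definition normsq (alpha : R) (f : R[i] -> R[i]) : R :=
  Rintegral area discR2 (fun p => sqmod (f (toC p)) * weight alpha p).

Definition wcomp (psi phi : R[i] -> R[i]) (f : R[i] -> R[i]) : R[i] -> R[i] :=
  fun z => psi z * f (phi z).

Definition numrange (alpha : R) (T : (R[i] -> R[i]) -> (R[i] -> R[i]))
  : set R[i] :=
  [set inner alpha (T f) f | f in [set f | bergman alpha f /\ normsq alpha f = 1]].

Definition convex_hull (S : set R[i]) : set R[i] :=
  [set z | exists (m : nat) (w : 'I_m -> R[i]) (t : 'I_m -> R),
     [/\ forall k, 0 <= t k, \sum_(k < m) t k = 1, forall k, S (w k)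
       & z = \sum_(k < m) (t k)%:C * w k]].

Definition root_unity (n : nat) : R[i] :=
  (cos (2 * pi / n%:R)) +i* (sin (2 * pi / n%:R)).

End Defs.

(* Main.v *)
(** For f in the Bergman space let f_k(z) = n^-1 sum_j lambda^(-jk) f(lambda^j z)
    be its component in the eigenspace of f |-> f o phi for lambda^k. Since psi
    is invariant under rotation by lambda, averaging over rotations gives
      <T f, f> = sum_k int lambda^k psi |f_k|^2 dA_alpha,
    with sum_k int |f_k|^2 dA_alpha = ||f||^2 = 1. So <T f, f> is the mean of the
    functions lambda^k psi against a probability measure, and such a mean lies in
    the convex hull of their values, closed or not.

    Conversely W(T) is convex by Toeplitz-Hausdorff, so it suffices to reach the
    points lambda^k psi(w). Let v = w^n and f(z) = sum_j conj(v)^j z^(nj+k) / c_j,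
    where c_j is the squared norm of z^(nj+k). Then f o phi = lambda^k f and f
    represents evaluation at v, in the sense that <p(z^n) f, f> = p(v) ||f||^2
    for polynomials p. This extends to bounded analytic g by
    dilating g and approximating the dilates by polynomials, uniformly on the
    disc. *)

Require Import Defs.
From mathcomp Require Import all_boot all_order all_algebra.
From mathcomp Require Import all_classical all_reals all_analysis.
From mathcomp Require Import complex.
From HB Require Import structures.
From mathcomp Require Import measurable_realfun ring lra.
Import Order.TTheory GRing.Theory Num.Theory.
Import numFieldNormedType.Exports.
Local Open Scope ring_scope.
Local Open Scope classical_set_scope.
Local Open Scope complex_scope.

Set Implicit Arguments.
Unset Strict Implicit.
Unset Printing Implicit Defensive.

Local Notation Re := (@complex.Re _).
Local Notation Im := (@complex.Im _).

(** * Invariance of the area *)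

Section AreaInvariance.
Context {R : realType}.
Notation mu := (@lebesgue_measure R).
Implicit Types (A : set R) (S : set (R * R)) (c t : R).

(** Analyticity is bare complex differentiability at each point of the disc, with no continuity of
    the derivative, so approximation by polynomials has to start from Cauchy's formula. It is
    reached through Goursat's bisection for closed 1-forms on rectangles: the coordinates z = w +
    e^s (zeta(t) - w) unroll the punctured region around w into a half-strip, where g(z) dz / (z -
    w) has no singularity left. Up to the factor conj(w)^k, the function f of the converse is the
    component in one eigenspace of the Bergman kernel at w, for k < n; dropping this factor keeps f
    nonzero when w = 0. Its series converges because the norms of the monomials are bounded below by
    every geometric sequence of ratio less than 1, up to a constant. For the direct inclusion the
    obstacle is that the hull may fail to be closed: a point outside it can lie on a supporting line
    that the hull touches. Strict separation is then replaced by a pair of functionals ordered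
    lexicographically. *)

Lemma lebesgue_measure_shift c A : measurable A ->
  mu [set x | A (x + c)] = mu A.
Proof.
move=> mA.
rewrite -[LHS]/(pushforward mu (fun x : measurableTypeR R => x + c : measurableTypeR R) A).
apply/esym/lebesgue_measure_unique => //=.
  exact: measurable_funD.
move=> mc _ [[a b]] _ <-; rewrite /pushforward /=.
have -> : (fun x => x + c) @^-1` `]a, b] = `]a - c, b - c]%classic.
  by apply/seteqP; split => x /=; rewrite !in_itv /= ltrBlDr lerBrDr.
by rewrite !lebesgue_measure_itv /= !lte_fin ltrD2 !EFinB /=; case: ifP => // _; rewrite -!EFinB; congr (_%:E); ring.
Qed.

Definition vshear c (p : R * R) : R * R := (p.1, p.2 + c * p.1).
Definition hshear c (p : R * R) : R * R := (p.1 + c * p.2, p.2).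

Lemma measurable_vshear c : measurable_fun setT (vshear c).
Proof.
apply: measurable_fun_pair => //=.
by apply: measurable_funD => //; apply: measurable_funM.
Qed.

Lemma measurable_hshear c : measurable_fun setT (hshear c).
Proof.
apply: measurable_fun_pair => //=.
by apply: measurable_funD => //; apply: measurable_funM.
Qed.

(** Each vertical section is translated by [c * x], so Fubini reduces the claim to translation
    invariance on the line. *)
Lemma area_vshear c S : measurable S -> area (vshear c @^-1` S) = area S.
Proof.
move=> mS; rewrite /area /product_measure1; apply: eq_integral => x _ /=.
rewrite -(lebesgue_measure_shift (c * x) (measurable_xsection x mS)).
by congr (mu _); apply/seteqP; split => y; rewrite /xsection /= !inE.
Qed.

Lemma area_hshear c S : measurable S -> area (hshear c @^-1` S) = area S.
Proof.
move=> mS.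
have mS' : measurable (hshear c @^-1` S).
  by rewrite -[X in measurable X]setTI; exact: measurable_hshear.
(* Uniqueness of the product measure exchanges the order of integration, which makes the horizontal
   sections available. *)
rewrite /area !(@product_measure_unique _ _ _ _ _ mu mu (mu \x^ mu)%E) //; last 2 first.
- by move=> A B mA mB; exact: product_measure2E.
- by move=> A B mA mB; exact: product_measure2E.
rewrite /= /product_measure2; apply: eq_integral => y _ /=.
rewrite -(lebesgue_measure_shift (c * y) (measurable_ysection y mS)).
by congr (mu _); apply/seteqP; split => x; rewrite /ysection /= !inE.
Qed.

Definition rot (a b : R) (p : R * R) : R * R := (a * p.1 - b * p.2, b * p.1 + a * p.2).

Lemma measurable_rot a b : measurable_fun setT (rot a b).
Proof.
apply: measurable_fun_pair => //=.
  by apply: measurable_funB => //; apply: measurable_funM.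
by apply: measurable_funD => //; apply: measurable_funM.
Qed.

(** A rotation by theta is a product of three shears: horizontal with parameter -tan(theta/2),
    vertical with parameter sin theta, horizontal again. The half-angle tangent b / (1 + a) breaks
    down only for the half turn a = -1, which is the square of the quarter turn. *)
Lemma area_rot a b S : a ^+ 2 + b ^+ 2 = 1 -> measurable S ->
  area (rot a b @^-1` S) = area S.
Proof.
move=> ab1 mS.
have gen a' b' T : a' ^+ 2 + b' ^+ 2 = 1 -> a' != -1 -> measurable T ->
    area (rot a' b' @^-1` T) = area T.
  move=> ab' a'N1 mT; pose t := b' / (1 + a').
  have nz : 1 + a' != 0 by apply: contra a'N1 => /eqP h; apply/eqP; lra.
  have -> : rot a' b' = hshear (- t) \o vshear b' \o hshear (- t).
    apply/funext => -[x y]; rewrite /rot /hshear /vshear /=.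
    have tE : t * (1 + a') = b' by rewrite /t divfK.
    have tb : t * b' = 1 - a'.
      apply: (mulIf nz); rewrite mulrAC tE; lra.
    congr pair.
      transitivity (x - (t * b') * x - t * (2 - t * b') * y); last by ring.
      rewrite tb; have -> : 2 - (1 - a') = 1 + a' by ring.
      by rewrite tE; ring.
    have -> : y + b' * (x + - t * y) = b' * x + (1 - t * b') * y by ring.
    by rewrite tb; ring.
  have mh U : measurable U -> measurable (hshear (- t) @^-1` U).
    by move=> mU; rewrite -[X in measurable X]setTI; exact: measurable_hshear.
  have mv U : measurable U -> measurable (vshear b' @^-1` U).
    by move=> mU; rewrite -[X in measurable X]setTI; exact: measurable_vshear.
  rewrite !comp_preimage area_hshear; last by apply: mv; apply: mh.
  by rewrite area_vshear ?area_hshear //; exact: mh.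
have [aN1|] := eqVneq a (-1); last by move=> h; exact: gen.
have b0 : b = 0.
  by apply/eqP; rewrite -sqrf_eq0; apply/eqP; move: ab1; rewrite aN1; lra.
have -> : rot a b = rot 0 1 \o rot 0 1.
  by apply/funext => -[x y]; rewrite /rot aN1 b0 /=; congr pair; ring.
have n01 : (0 : R) != -1 by rewrite eq_sym oppr_eq0 oner_eq0.
have e01 : (0 : R) ^+ 2 + 1 ^+ 2 = 1 by rewrite expr0n expr1n add0r.
have mr : measurable (rot 0 1 @^-1` S).
  by rewrite -[X in measurable X]setTI; exact: measurable_rot.
by rewrite comp_preimage !gen.
Qed.

End AreaInvariance.

(** * Goursat's theorem on rectangles *)

Section Goursat.
Context {R : realType}.
Notation mu := (@lebesgue_measure R).
Implicit Types (a b c d x y : R) (f g : R -> R) (P Q : R -> R -> R).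

Lemma continuous_itv_integrable a b f :
  (forall x, a <= x <= b -> {for x, continuous f}) ->
  mu.-integrable `[a, b] (EFin \o f).
Proof.
move=> cf; apply: continuous_compact_integrable; first exact: segment_compact.
apply: continuous_in_subspaceT => x; rewrite inE /= in_itv /=; exact: cf.
Qed.

Lemma Rintegral_itv_split a m b f : a <= m <= b ->
  (forall x, a <= x <= b -> {for x, continuous f}) ->
  \int[mu]_(x in `[a, b]) f x =
  \int[mu]_(x in `[a, m]) f x + \int[mu]_(x in `[m, b]) f x.
Proof.
move=> /andP[am mb] cf.
rewrite -(@Rintegral_itv_obnd_cbnd _ m); last first.
  apply: integrableS (continuous_itv_integrable cf) => //.
  by move=> x /=; rewrite !in_itv /= => /andP[h ->]; rewrite andbT (le_trans am) ?ltW.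
rewrite -(@Rintegral_itvB _ f (BLeft a) (BRight b) m) ?bnd_simp //.
  by rewrite addrC subrK.
exact: continuous_itv_integrable.
Qed.

Lemma Rintegral_itv_cst a b k : a <= b -> \int[mu]_(x in `[a, b]) k = k * (b - a).
Proof.
move=> ab; rewrite Rintegral_cst //= lebesgue_measure_itv /= lte_fin.
case: ltP => // ba; have -> : b = a by apply/le_anti/andP.
by rewrite subrr.
Qed.

Lemma Rintegral_itv_sub_cst a b f k : a <= b ->
  (forall x, a <= x <= b -> {for x, continuous f}) ->
  \int[mu]_(x in `[a, b]) (f x - k) = \int[mu]_(x in `[a, b]) f x - k * (b - a).
Proof.
move=> ab cf; rewrite RintegralB //; last 2 first.
- exact: continuous_itv_integrable.
- by apply: continuous_itv_integrable => x _; exact: cvg_cst.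
by rewrite Rintegral_itv_cst.
Qed.

Lemma le_norm_Rintegral_itv a b f (M : R) : a <= b ->
  (forall x, a <= x <= b -> {for x, continuous f}) ->
  (forall x, a <= x <= b -> `|f x| <= M) ->
  `|\int[mu]_(x in `[a, b]) f x| <= M * (b - a).
Proof.
move=> ab cf fM; rewrite -Rintegral_itv_cst //.
have fi := continuous_itv_integrable cf.
apply: (le_trans (le_normr_Rintegral _ fi)) => //.
apply: le_Rintegral => //.
- by have := integrable_abse fi.
- by apply: continuous_itv_integrable => x _; exact: cvg_cst.
Qed.

(* The 1-form P dx + Q dy is differentiable and closed at (x, y). *)
Definition closed_at P Q x y := exists P1 K Q2 : R, forall e, 0 < e ->
  exists2 r, 0 < r & forall x' y', `|x' - x| <= r -> `|y' - y| <= r ->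
    `|P x' y' - P x y - (P1 * (x' - x) + K * (y' - y))| <= e * (`|x' - x| + `|y' - y|) /\
    `|Q x' y' - Q x y - (K * (x' - x) + Q2 * (y' - y))| <= e * (`|x' - x| + `|y' - y|).

Lemma approx_continuous f x (A : R) :
  (exists2 r, 0 < r & forall t, `|t - x| <= r -> `|f t - f x - A * (t - x)| <= `|t - x|) ->
  {for x, continuous f}.
Proof.
move=> [r r0 h]; apply/cvgrPdist_le => e e0.
have k0 : 0 < 1 + `|A| by rewrite ltr_pwDl.
near=> t.
have tx : `|t - x| <= r by rewrite distrC; near: t; exact: cvgr_dist_le.
have te : `|t - x| <= e / (1 + `|A|).
  by rewrite distrC; near: t; apply: cvgr_dist_le => //; rewrite divr_gt0.
rewrite distrC; have -> : f t - f x = (f t - f x - A * (t - x)) + A * (t - x) by ring.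
apply: (le_trans (ler_normD _ _)); rewrite normrM.
apply: (le_trans (lerD (h _ tx) (lexx _))).
by rewrite -{1}(mul1r `|t - x|) -mulrDl mulrC -ler_pdivlMr.
Unshelve. all: by end_near. Qed.

Lemma closed_at_continuous P Q x y : closed_at P Q x y ->
  [/\ {for x, continuous (P ^~ y)}, {for y, continuous (P x)},
      {for x, continuous (Q ^~ y)} & {for y, continuous (Q x)}].
Proof.
move=> [P1 [K [Q2 /(_ 1 ltr01)[r r0 h]]]].
have xr t : `|t - x| <= r -> `|y - y| <= r by move=> _; rewrite subrr normr0 ltW.
have yr t : `|t - y| <= r -> `|x - x| <= r by move=> _; rewrite subrr normr0 ltW.
split; [apply: (@approx_continuous _ _ P1)|apply: (@approx_continuous _ _ K)
  |apply: (@approx_continuous _ _ K)|apply: (@approx_continuous _ _ Q2)];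
  exists r => // t tr.
- have [+ _] := h t y tr (xr _ tr); rewrite subrr normr0 mulr0 !addr0 mul1r. by [].
- by have [+ _] := h x t (yr _ tr) tr; rewrite subrr normr0 mulr0 !add0r mul1r.
- by have [_] := h t y tr (xr _ tr); rewrite subrr normr0 mulr0 !addr0 mul1r.
- by have [_] := h x t (yr _ tr) tr; rewrite subrr normr0 mulr0 !add0r mul1r.
Qed.

(** The integral of P dx + Q dy counterclockwise around the boundary of [a, b] x [c, d]. *)
Definition bint P Q a b c d :=
  \int[mu]_(x in `[a, b]) (P x c - P x d) + \int[mu]_(y in `[c, d]) (Q b y - Q a y).

Definition closed_on P Q a b c d :=
  forall x y, a <= x <= b -> c <= y <= d -> closed_at P Q x y.

Lemma closed_onS P Q a b c d a' b' c' d' : a <= a' -> b' <= b -> c <= c' -> d' <= d ->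
  closed_on P Q a b c d -> closed_on P Q a' b' c' d'.
Proof.
move=> aa bb cc dd h x y /andP[x1 x2] /andP[y1 y2]; apply: h.
- by rewrite (le_trans aa) ?(le_trans x2).
- by rewrite (le_trans cc) ?(le_trans y2).
Qed.

Lemma bint_splitx P Q a m b c d : a <= m <= b -> c <= d -> closed_on P Q a b c d ->
  bint P Q a b c d = bint P Q a m c d + bint P Q m b c d.
Proof.
move=> amb cd PQ; rewrite /bint (@Rintegral_itv_split a m b) //; last first.
  move=> x axb; apply: continuousB.
  - by have [] := closed_at_continuous (PQ x c axb ltac:(by rewrite lexx cd)).
  - by have [] := closed_at_continuous (PQ x d axb ltac:(by rewrite lexx cd)).
have [am mb] := andP amb; have ab := le_trans am mb.
have i u v : a <= u <= b -> a <= v <= b ->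
    mu.-integrable `[c, d] (EFin \o (fun y => Q u y - Q v y)).
  move=> hu hv; apply: continuous_itv_integrable => y hy; apply: continuousB.
  - by have [] := closed_at_continuous (PQ u y hu hy).
  - by have [] := closed_at_continuous (PQ v y hv hy).
have ha : a <= a <= b by rewrite lexx.
have hb : a <= b <= b by rewrite lexx andbT.
rewrite [in LHS](_ : \int[mu]_(y in `[c, d]) (Q b y - Q a y) =
  \int[mu]_(y in `[c, d]) (Q m y - Q a y) + \int[mu]_(y in `[c, d]) (Q b y - Q m y)).
  by ring.
rewrite -RintegralD //; [|exact: i..].
by apply: eq_Rintegral => y _; ring.
Qed.

Lemma bint_splity P Q a b c m d : c <= m <= d -> a <= b -> closed_on P Q a b c d ->
  bint P Q a b c d = bint P Q a b c m + bint P Q a b m d.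
Proof.
move=> cmd ab PQ; rewrite /bint (@Rintegral_itv_split c m d) //; last first.
  move=> x axb; apply: continuousB.
  - by have [] := closed_at_continuous (PQ b x ltac:(by rewrite lexx ab) axb).
  - by have [] := closed_at_continuous (PQ a x ltac:(by rewrite lexx ab) axb).
have [am mb] := andP cmd; have cd := le_trans am mb.
have i u v : c <= u <= d -> c <= v <= d ->
    mu.-integrable `[a, b] (EFin \o (fun x => P x u - P x v)).
  move=> hu hv; apply: continuous_itv_integrable => y hy; apply: continuousB.
  - by have [] := closed_at_continuous (PQ y u hy hu).
  - by have [] := closed_at_continuous (PQ y v hy hv).
have hc : c <= c <= d by rewrite lexx.
have hd : c <= d <= d by rewrite lexx andbT.
rewrite [in LHS](_ : \int[mu]_(y in `[a, b]) (P y c - P y d) =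
  \int[mu]_(y in `[a, b]) (P y c - P y m) + \int[mu]_(y in `[a, b]) (P y m - P y d)).
  by ring.
rewrite -RintegralD //; [|exact: i..].
by apply: eq_Rintegral => y _; ring.
Qed.

(** The first-order part of the form at (x, y) is closed, so its boundary integral vanishes: the two
    terms in K cancel. What remains is an error of size e times the half-perimeter, integrated over
    lengths that add up to the half-perimeter. *)
Lemma bint_small P Q x y (e : R) : closed_at P Q x y -> 0 < e ->
  exists2 r, 0 < r & forall a b c d, a <= x <= b -> c <= y <= d ->
    b - a <= r -> d - c <= r -> closed_on P Q a b c d ->
    `|bint P Q a b c d| <= e * (b - a + (d - c)) ^+ 2.
Proof.
move=> [P1 [K [Q2 h]]] e0; have e20 : 0 < e / 2 by rewrite divr_gt0.
have [r r0 {}h] := h (e / 2) e20.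
exists r => // a b c d /andP[ax xb] /andP[cy yd] bar dcr PQ.
have ab := le_trans ax xb; have cd := le_trans cy yd.
set L := b - a + (d - c).
have near u v : a <= u <= b -> c <= v <= d ->
    [/\ `|u - x| <= b - a, `|v - y| <= d - c, `|u - x| <= r & `|v - y| <= r].
  move=> /andP[h1 h2] /andP[h3 h4].
  have A : `|u - x| <= b - a by rewrite ler_norml; lra.
  have B : `|v - y| <= d - c by rewrite ler_norml; lra.
  by split=> //; [exact: le_trans A bar|exact: le_trans B dcr].
have hP u v : a <= u <= b -> c <= v <= d ->
    `|P u v - P x y - (P1 * (u - x) + K * (v - y))| <= e / 2 * L.
  move=> hu hv; have [h1 h2 h3 h4] := near u v hu hv.
  have [+ _] := h u v h3 h4; move/le_trans; apply.
  by rewrite ler_pM2l // lerD.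
have hQ u v : a <= u <= b -> c <= v <= d ->
    `|Q u v - Q x y - (K * (u - x) + Q2 * (v - y))| <= e / 2 * L.
  move=> hu hv; have [h1 h2 h3 h4] := near u v hu hv.
  have [_] := h u v h3 h4; move/le_trans; apply.
  by rewrite ler_pM2l // lerD.
have L0 : 0 <= L by rewrite /L; lra.
have Ha : a <= a <= b by rewrite lexx.
have Hb : a <= b <= b by rewrite lexx andbT.
have Hc : c <= c <= d by rewrite lexx.
have Hd : c <= d <= d by rewrite lexx andbT.
have cP u : a <= u <= b -> {for u, continuous (fun x => P x c - P x d)}.
  move=> hu; apply: continuousB.
  - by have [] := closed_at_continuous (PQ u c hu Hc).
  - by have [] := closed_at_continuous (PQ u d hu Hd).
have cQ v : c <= v <= d -> {for v, continuous (fun y => Q b y - Q a y)}.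
  move=> hv; apply: continuousB.
  - by have [] := closed_at_continuous (PQ b v Hb hv).
  - by have [] := closed_at_continuous (PQ a v Ha hv).
have cc (k u : R) : {for u, continuous (fun=> k : R)} by exact: cvg_cst.
have -> : bint P Q a b c d =
    \int[mu]_(u in `[a, b]) (P u c - P u d - K * (c - d)) +
    \int[mu]_(v in `[c, d]) (Q b v - Q a v - K * (b - a)).
  by rewrite /bint !Rintegral_itv_sub_cst //; ring.
apply: (le_trans (ler_normD _ _)).
have -> : e * L ^+ 2 = e * L * (b - a) + e * L * (d - c) by rewrite /L; ring.
apply: lerD; apply: le_norm_Rintegral_itv => //.
- by move=> u hu; apply: continuousB; [exact: cP|exact: cc].
- move=> u hu; have := hP u c hu Hc; have := hP u d hu Hd.
  by rewrite !ler_norml; lra.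
- by move=> u hu; apply: continuousB; [exact: cQ|exact: cc].
- move=> v hv; have := hQ a v Ha hv; have := hQ b v Hb hv.
  by rewrite !ler_norml; lra.
Qed.

(** Bisection: one of the four quarters carries at least a quarter of the integral. The nested
    rectangles shrink to a point, where such a lower bound, quadratic in the side, contradicts
    [bint_small]. *)
Theorem goursat P Q a b c d : a <= b -> c <= d -> closed_on P Q a b c d ->
  bint P Q a b c d = 0.
Proof.
move=> ab cd PQ; apply/eqP/contraT => B0.
set L1 := b - a; set L2 := d - c.
have L10 : 0 <= L1 by rewrite subr_ge0.
have L20 : 0 <= L2 by rewrite subr_ge0.
pose h k : R := 2^-1 ^+ k.
have h0 k : 0 < h k by rewrite exprn_gt0 // invr_gt0.
have hS k : h k.+1 = h k / 2 by rewrite /h exprS mulrC.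
(* Invariant of the bisection: [p] is the lower left corner of a rectangle of generation [k], which
   keeps a share 4^-k of the integral. *)
pose S k (p : R * R) := [/\ a <= p.1, p.1 + L1 * h k <= b, c <= p.2, p.2 + L2 * h k <= d
  & `|bint P Q a b c d| * h k ^+ 2 <=
    `|bint P Q p.1 (p.1 + L1 * h k) p.2 (p.2 + L2 * h k)|].
have S0 : S 0%N (a, c).
  by rewrite /S /h /= expr0 expr1n !mulr1 /L1 /L2 ![_ + (_ - _)]addrC !subrK !lexx.
have step k p : S k p -> exists q, [/\ S k.+1 q, p.1 <= q.1 <= p.1 + L1 * h k.+1
    & p.2 <= q.2 <= p.2 + L2 * h k.+1].
  move=> [/= p1 p2 p3 p4 p5]; have hk := h0 k.+1.
  have hkk : h k = h k.+1 + h k.+1 by rewrite hS; field.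
  have l1 : 0 <= L1 * h k.+1 by rewrite mulr_ge0 // ltW.
  have l2 : 0 <= L2 * h k.+1 by rewrite mulr_ge0 // ltW.
  move: p5 p2 p4; rewrite hkk !mulrDr !addrA.
  move: (p.1) (p.2) p1 p3 => x y p1 p3.
  set l := L1 * h k.+1; set l' := L2 * h k.+1 => p5 p2 p4.
  have cl0 : closed_on P Q x (x + l + l) y (y + l' + l') by apply: closed_onS PQ.
  have cl1 : closed_on P Q x (x + l) y (y + l' + l').
    by apply: closed_onS cl0 => //; rewrite lerDl.
  have cl2 : closed_on P Q (x + l) (x + l + l) y (y + l' + l').
    by apply: closed_onS cl0 => //; rewrite lerDl.
  have E : bint P Q x (x + l + l) y (y + l' + l') =
      bint P Q x (x + l) y (y + l') + bint P Q x (x + l) (y + l') (y + l' + l') +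
      (bint P Q (x + l) (x + l + l) y (y + l') +
       bint P Q (x + l) (x + l + l) (y + l') (y + l' + l')).
    have mx : x <= x + l <= x + l + l by rewrite !lerDl l1.
    have my : y <= y + l' <= y + l' + l' by rewrite !lerDl l2.
    have [mx1 mx2] := andP mx; have [my1 my2] := andP my.
    rewrite (bint_splitx mx (le_trans my1 my2) cl0).
    by rewrite (bint_splity my mx1 cl1) (bint_splity my mx2 cl2).
  move: p5; rewrite E; set B1 := bint P Q x _ y _; set B2 := bint P Q x _ (y + l') _.
  set B3 := bint P Q (x + l) _ y _; set B4 := bint P Q (x + l) _ (y + l') _ => p5.
  set e := `|bint P Q a b c d| * h k.+1 ^+ 2.
  have e4 : 4 * e <= `|B1| + `|B2| + (`|B3| + `|B4|).
    apply: le_trans (lerD (ler_normD _ _) (ler_normD _ _)).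
    apply: le_trans (ler_normD _ _); apply: le_trans p5.
    by rewrite /e le_eqVlt; apply/orP; left; apply/eqP; ring.
  have mk u v : x <= u <= x + l -> y <= v <= y + l' ->
      e <= `|bint P Q u (u + l) v (v + l')| ->
      exists q, [/\ S k.+1 q, x <= q.1 <= x + l & y <= q.2 <= y + l'].
    move=> hu hv he; exists (u, v); split=> //; split=> //.
    - by case/andP: hu => + _; exact: le_trans.
    - by case/andP: hu => _ hu; rewrite (le_trans _ p2) // lerD2r.
    - by case/andP: hv => + _; exact: le_trans.
    - by case/andP: hv => _ hv; rewrite (le_trans _ p4) // lerD2r.
  have hx0 : x <= x <= x + l by rewrite lexx lerDl.
  have hx1 : x <= x + l <= x + l by rewrite lexx lerDl l1.
  have hy0 : y <= y <= y + l' by rewrite lexx lerDl.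
  have hy1 : y <= y + l' <= y + l' by rewrite lexx lerDl l2.
  have [n1|n1] := leP e `|B1|; first exact: mk n1.
  have [n2|n2] := leP e `|B2|; first exact: mk n2.
  have [n3|n3] := leP e `|B3|; first exact: mk n3.
  have [n4|n4] := leP e `|B4|; first exact: mk n4.
  by move: e4 n1 n2 n3 n4; clear; lra.
have [s [s0 sS]] : exists s : nat -> R * R, s 0%N = (a, c) /\ forall k, S k (s k) /\
   (s k).1 <= (s k.+1).1 <= (s k).1 + L1 * h k.+1 /\
   (s k).2 <= (s k.+1).2 <= (s k).2 + L2 * h k.+1.
  (* Stating the step as an implication makes the choice total; off the invariant the successor is a
     dummy. *)
  have /choice[F hF] : forall kp : nat * (R * R), exists q, S kp.1 kp.2 ->
      [/\ S kp.1.+1 q, kp.2.1 <= q.1 <= kp.2.1 + L1 * h kp.1.+1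
        & kp.2.2 <= q.2 <= kp.2.2 + L2 * h kp.1.+1].
    move=> [k p] /=; have [/step[q hq]|n] := pselect (S k p); first by exists q.
    by exists p.
  pose s := fix s k := if k is k'.+1 then F (k', s k') else (a, c).
  exists s; split => // k.
  have Sk : S k (s k).
    by elim: k => [|k IH] //=; have [] := hF (k, s k) IH.
  by split => //; have [_ h1 h2] := hF (k, s k) Sk.
have nested (u : nat -> R) L : 0 <= L -> (forall k, u k <= u k.+1 <= u k + L * h k.+1) ->
    exists x, forall k, u k <= x <= u k + L * h k.
  move=> L0 hu.
  have nd : nondecreasing_seq u.
    by apply/nondecreasing_seqP => k; case/andP: (hu k).
  have ni : forall k m, u (k + m)%N + L * h (k + m)%N <= u k + L * h k.
    move=> k; elim=> [|m IH]; first by rewrite addn0.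
    apply: le_trans IH; rewrite addnS; have /andP[_] := hu (k + m)%N.
    by rewrite !hS; lra.
  have ub k m : u m <= u k + L * h k.
    have Lh j : 0 <= L * h j by rewrite mulr_ge0 // ltW.
    apply: (@le_trans _ _ (u (k + m)%N)); first by apply: nd; rewrite leq_addl.
    by apply: le_trans (ni k m); rewrite lerDl.
  have cu : cvgn u.
    apply: nondecreasing_is_cvgn => //; exists (u 0%N + L * h 0%N) => _ [m _ <-].
    exact: ub.
  exists (limn u) => k; apply/andP; split.
    by apply: nondecreasing_cvgn_le.
  by apply: limr_le => //; apply: nearW => m; exact: ub.
have [x hx] := nested (fun k => (s k).1) L1 L10 (fun k => (sS k).2.1).
have [y hy] := nested (fun k => (s k).2) L2 L20 (fun k => (sS k).2.2).
have B0' : 0 < `|bint P Q a b c d| by rewrite normr_gt0.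
(* A rectangle reduced to a point has integral zero, so the half-perimeter may be divided by. *)
have LL : 0 < L1 + L2.
  rewrite lt_neqAle addr_ge0 // andbT eq_sym; apply: contraNN B0 => /eqP e.
  have [e1 e2] : b = a /\ d = c by move: e L10 L20; rewrite /L1 /L2 => *; split; lra.
  have z u v : \int[mu]_(x in `[u, v]) (0 : R) = 0.
    by rewrite Rintegral_cst // mul0r.
  rewrite /bint e1 e2; under eq_Rintegral do rewrite subrr.
  by rewrite z add0r; under eq_Rintegral do rewrite subrr; rewrite z.
have xyPQ : closed_at P Q x y.
  apply: PQ; [have := hx 0%N|have := hy 0%N];
    by rewrite s0 /h /= expr0 mulr1 /L1 /L2 addrC subrK.
(* With this e the upper bound for generation k is exactly half of the lower bound in the
   invariant. *)
pose e := `|bint P Q a b c d| / (2 * (L1 + L2) ^+ 2).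
have e0 : 0 < e by rewrite divr_gt0 // mulr_gt0 // exprn_gt0.
have [r r0 hr] := bint_small xyPQ e0.
have [k kr] : exists k, (L1 + L2) * h k <= r.
  have hc : h @ \oo --> 0 by apply: cvg_expr; rewrite ger0_norm ?invr_ge0 // invf_lt1 // ltr1n.
  have : \forall k \near \oo, h k <= r / (L1 + L2).
    by apply: cvgr_le hc _ _; rewrite divr_gt0.
  by move=> [N _ /(_ N (leqnn N)) hN]; exists N; rewrite mulrC -ler_pdivlMr.
have [[k1 k2 k3 k4 k5] _] := sS k.
have := hr (s k).1 ((s k).1 + L1 * h k) (s k).2 ((s k).2 + L2 * h k) (hx k) (hy k).
have -> : (s k).1 + L1 * h k - (s k).1 = L1 * h k by ring.
have -> : (s k).2 + L2 * h k - (s k).2 = L2 * h k by ring.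
have l1 : 0 <= L1 * h k by rewrite mulr_ge0 // ltW.
have l2 : 0 <= L2 * h k by rewrite mulr_ge0 // ltW.
move=> H; have {}H := le_trans k5 (H ltac:(lra) ltac:(lra) (closed_onS k1 k2 k3 k4 PQ)).
have := H; have -> : e * (L1 * h k + L2 * h k) ^+ 2 = `|bint P Q a b c d| / 2 * h k ^+ 2.
  by rewrite /e; field; apply: lt0r_neq0.
by rewrite ler_pM2r ?exprn_gt0 //; lra.
Qed.

End Goursat.

(** * Complex differentiability *)

Section Modulus.
Context {R : realType}.
Implicit Types (z w : R[i]) (x y : R).

(** The norm of [R[i]] takes values in [R[i]]; estimates are made with this real-valued modulus
    instead. *)
Definition cmod z : R := Normc.normc z.

Lemma cmodE z : cmod z = Num.sqrt (Re z ^+ 2 + Im z ^+ 2).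
Proof. by case: z. Qed.

Lemma cmod_ge0 z : 0 <= cmod z.
Proof. by rewrite cmodE sqrtr_ge0. Qed.

Lemma sqr_cmod z : cmod z ^+ 2 = sqmod z.
Proof. by rewrite cmodE sqr_sqrtr // addr_ge0 // sqr_ge0. Qed.

Lemma cmod0 : cmod 0 = 0. Proof. exact: Normc.normc0. Qed.

Lemma cmod1 : cmod 1 = 1. Proof. exact: Normc.normc1. Qed.

Lemma cmodM z w : cmod (z * w) = cmod z * cmod w.
Proof. exact: Normc.normcM. Qed.

Lemma cmodX z n : cmod (z ^+ n) = cmod z ^+ n.
Proof. by elim: n => [|n IH]; rewrite ?cmod1 // !exprS cmodM IH. Qed.

Lemma cmodV z : cmod z^-1 = (cmod z)^-1.
Proof. exact: Normc.normcV. Qed.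

Lemma cmodN z : cmod (- z) = cmod z.
Proof. exact: normcN. Qed.

Lemma cmodD z w : cmod (z + w) <= cmod z + cmod w.
Proof. exact: le_normcD. Qed.

Lemma cmodBC z w : cmod (z - w) = cmod (w - z).
Proof. by rewrite -cmodN opprB. Qed.

Lemma cmodB z w : cmod (z - w) <= cmod z + cmod w.
Proof. by rewrite -(cmodN w); exact: cmodD. Qed.

Lemma cmod_dist z w : cmod z - cmod w <= cmod (z - w).
Proof. by rewrite lerBlDr -{1}(subrK w z); exact: cmodD. Qed.

Lemma cmod_eq0 z : (cmod z == 0) = (z == 0).
Proof.
by apply/eqP/eqP => [/Normc.eq0_normc//|->]; rewrite cmod0.
Qed.

Lemma cmod_gt0 z : (0 < cmod z) = (z != 0).
Proof. by rewrite lt_neqAle cmod_ge0 andbT eq_sym cmod_eq0. Qed.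

Lemma cmod_real x : cmod x%:C = `|x|.
Proof. by rewrite cmodE /= expr0n addr0 sqrtr_sqr. Qed.

Lemma cmodJ z : cmod z^*%C = cmod z.
Proof. by rewrite !cmodE; case: z => a b /=; rewrite sqrrN. Qed.

Lemma normr_Re_le z : `|Re z| <= cmod z.
Proof.
by rewrite cmodE -sqrtr_sqr ler_sqrt ?lerDl ?sqr_ge0 // addr_ge0 // sqr_ge0.
Qed.

Lemma normr_Im_le z : `|Im z| <= cmod z.
Proof.
by rewrite cmodE -sqrtr_sqr ler_sqrt ?lerDr ?sqr_ge0 // addr_ge0 // sqr_ge0.
Qed.

Lemma cmod_le_ReIm z : cmod z <= `|Re z| + `|Im z|.
Proof.
rewrite {1}(complexE z); apply: (le_trans (cmodD _ _)); rewrite cmodM !cmod_real.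
have -> : cmod 'i%C = 1 by rewrite cmodE /= expr0n expr1n add0r sqrtr1.
by rewrite mul1r.
Qed.

Lemma cmod_sum I (r : seq I) (P : pred I) (F : I -> R[i]) :
  cmod (\sum_(i <- r | P i) F i) <= \sum_(i <- r | P i) cmod (F i).
Proof.
elim/big_rec2: _ => [|i y x _ h]; first by rewrite cmod0.
by apply: (le_trans (cmodD _ _)); rewrite lerD2l.
Qed.

Lemma mem_disc z : (z \in @disc R) = (cmod z < 1).
Proof.
by apply/idP/idP; rewrite inE /disc /= -sqr_cmod expr_lt1 ?cmod_ge0.
Qed.

Lemma ReM z w : Re (z * w) = Re z * Re w - Im z * Im w.
Proof. by case: z; case: w. Qed.

Lemma ImM z w : Im (z * w) = Re z * Im w + Im z * Re w.
Proof. by case: z => a b; case: w. Qed.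

Lemma ReD z w : Re (z + w) = Re z + Re w. Proof. by case: z; case: w. Qed.
Lemma ImD z w : Im (z + w) = Im z + Im w. Proof. by case: z; case: w. Qed.
Lemma ReN z : Re (- z) = - Re z. Proof. by case: z. Qed.
Lemma ImN z : Im (- z) = - Im z. Proof. by case: z. Qed.
Lemma ReB z w : Re (z - w) = Re z - Re w. Proof. by rewrite ReD ReN. Qed.
Lemma ImB z w : Im (z - w) = Im z - Im w. Proof. by rewrite ImD ImN. Qed.

Lemma complex_inj z w : Re z = Re w -> Im z = Im w -> z = w.
Proof. by case: z => a b; case: w => c d /= -> ->. Qed.

Lemma conjcM z w : (z * w)^*%C = z^*%C * w^*%C.
Proof. exact: (rmorphM (@conjc R)). Qed.

Lemma conjcD z w : (z + w)^*%C = z^*%C + w^*%C.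
Proof. exact: (rmorphD (@conjc R)). Qed.

Lemma conjcX z n : (z ^+ n)^*%C = z^*%C ^+ n.
Proof. exact: (rmorphXn (@conjc R)). Qed.

Lemma mulcJ_cmod z : z * z^*%C = (cmod z ^+ 2)%:C.
Proof. by rewrite sqr_cmod /sqmod; case: z => a b; apply: complex_inj; rewrite /=; ring. Qed.

End Modulus.

Section ComplexDerivative.
Context {R : realType}.
Notation C := (R[i]^o).
Implicit Types (z w D : C) (f g q : C -> C).

Lemma normcE_cmod (z : R[i]) : `|z| = (cmod z)%:C.
Proof. by rewrite cmodE normc_def. Qed.

Lemma gtc0_real (e : R[i]) : 0 < e -> e = (Re e)%:C /\ 0 < Re e.
Proof.
by rewrite ltcE => /andP[/eqP h h']; split=> //; apply: complex_inj.
Qed.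

Lemma ccontinuousP f z : {for z, continuous f} <->
  forall e : R, 0 < e -> exists2 r : R, 0 < r &
    forall w, cmod (w - z) < r -> cmod (f w - f z) < e.
Proof.
split=> [/cvgrPdist_lt cf e e0|h].
  have /cf : 0 < e%:C by rewrite ltcR.
  move=> /nbhs_ballP[/= r r0 hr]; have [rE r0'] := gtc0_real r0.
  exists (Re r) => // w wz; have /= := hr w.
  rewrite /ball /= rE !normcE_cmod !ltcR cmodBC => /(_ wz).
  by rewrite cmodBC.
apply/(@cvgrPdist_lt _ C _ (nbhs z) (nbhs_filter z) f (f z)) => e /gtc0_real[-> e0].
have [r r0 hr] := h _ e0; apply/nbhs_ballP; exists r%:C; first by rewrite /= ltcR.
by move=> w; rewrite /ball /= !normcE_cmod !ltcR cmodBC => /hr; rewrite cmodBC.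
Qed.

Lemma ccontinuous_cst (k : C) z : {for z, continuous (fun=> k)}.
Proof. by apply/ccontinuousP => e e0; exists 1 => // w _; rewrite subrr cmod0. Qed.

Lemma ccontinuousD f g z : {for z, continuous f} -> {for z, continuous g} ->
  {for z, continuous (fun w => f w + g w)}.
Proof. by move=> cf cg; exact: (@cvgD _ C _ _ _ _ _ _ _ cf cg). Qed.

Lemma ccontinuousM f g z : {for z, continuous f} -> {for z, continuous g} ->
  {for z, continuous (fun w => f w * g w)}.
Proof. by move=> cf cg; exact: (@cvgM _ _ _ _ _ _ _ _ cf cg). Qed.

(* Caratheodory's form of differentiability: q is the difference quotient. *)
Definition cderiv f z D := exists q,
  [/\ {for z, continuous q}, q z = D & forall w, f w = f z + q w * (w - z)].

Lemma cderiv_of_derivable f z : @derivable R[i] R[i]^o R[i]^o f z 1 -> exists D, cderiv f z D.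
Proof.
move=> /cvg_ex[D df]; exists D.
exists (fun w => if w == z then D else (f w - f z) / (w - z)); split.
- apply/ccontinuousP => e e0; rewrite eqxx.
  have /cvgrPdist_lt /(_ e%:C) := df.
  rewrite ltcR => /(_ e0); rewrite near_withinE => /nbhs_ballP[/= r /gtc0_real[-> r0] hr].
  exists (Re r) => // w wr; case: eqVneq => [_|wz]; first by rewrite subrr cmod0.
  have := hr (w - z); rewrite /ball /= sub0r normrN !normcE_cmod !ltcR => /(_ wr).
  rewrite subr_eq0 => /(_ wz); rewrite /GRing.scale /= mulr1 subrK.
  by rewrite cmodBC mulrC.
- by rewrite eqxx.
- move=> w; case: eqVneq => [->|wz]; first by rewrite subrr mulr0 addr0.
  by rewrite divfK ?subr_eq0 // addrC subrK.
Qed.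

Lemma derivable_of_cderiv f z D : cderiv f z D -> @derivable R[i] R[i]^o R[i]^o f z 1.
Proof.
move=> [q [/ccontinuousP cq qz fE]]; apply/cvg_ex; exists D.
apply/(@cvgrPdist_lt _ C) => e /gtc0_real[-> e0].
have [r r0 hr] := cq _ e0; rewrite near_withinE; apply/nbhs_ballP.
exists r%:C; first by rewrite /= ltcR.
move=> h; rewrite /ball /= sub0r normrN !normcE_cmod !ltcR => hlt h0.
rewrite /GRing.scale /= mulr1 (fE (h + z)) addrK addrAC subrr add0r.
rewrite mulrCA mulVf // mulr1 -qz cmodBC; apply: hr; by rewrite addrK.
Qed.

Lemma cderiv_cst (k : C) z : cderiv (fun=> k) z 0.
Proof.
exists (fun=> 0); split => //; first exact: ccontinuous_cst.
by move=> w; rewrite mul0r addr0.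
Qed.

Lemma cderiv_id z : cderiv (fun w => w) z 1.
Proof.
exists (fun=> 1); split => //; first exact: ccontinuous_cst.
by move=> w; rewrite mul1r addrC subrK.
Qed.

Lemma cderiv_continuous f z D : cderiv f z D -> {for z, continuous f}.
Proof.
move=> [q [cq _ fE]].
rewrite (_ : f = fun w => f z + q w * (w - z)); last exact/funext.
have cid : {for z, continuous (fun w : C => w : C)} by exact: cvg_id.
have csub := @ccontinuousD (fun w => w) (fun=> - z) z cid (@ccontinuous_cst (- z) z).
have cmul := @ccontinuousM q (fun w => w - z) z cq csub.
exact: (@ccontinuousD (fun=> f z) _ z (@ccontinuous_cst (f z) z) cmul).
Qed.

Lemma cderivD f g z D E : cderiv f z D -> cderiv g z E ->
  cderiv (fun w => f w + g w) z (D + E).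
Proof.
move=> [p [cp pz fE]] [q [cq qz gE]]; exists (fun w => p w + q w); split.
- exact: (@ccontinuousD p q z cp cq).
- by rewrite pz qz.
- by move=> w; rewrite fE gE; ring.
Qed.

Lemma cderivM f g z D E : cderiv f z D -> cderiv g z E ->
  cderiv (fun w => f w * g w) z (D * g z + f z * E).
Proof.
move=> df dg; have cg := cderiv_continuous dg.
move: df dg => [p [cp pz fE]] [q [cq qz gE]].
exists (fun w => p w * g w + f z * q w); split.
- apply: (@ccontinuousD (fun w => p w * g w) (fun w => f z * q w)).
    exact: (@ccontinuousM p g z cp cg).
  exact: (@ccontinuousM (fun=> f z) q z (@ccontinuous_cst (f z) z) cq).
- by rewrite pz qz.
- by move=> w; rewrite [f w]fE [g w in LHS]gE [g w]gE; ring.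
Qed.

Lemma cderiv_comp f g z D E : cderiv g z D -> cderiv f (g z) E ->
  cderiv (fun w => f (g w)) z (E * D).
Proof.
move=> dg; have cg := cderiv_continuous dg.
move: dg => [p [cp pz gE]] [q [cq qz fE]].
exists (fun w => q (g w) * p w); split.
- exact: (@ccontinuousM (fun w => q (g w)) p z (@continuous_comp _ _ _ g q z cg cq) cp).
- by rewrite pz qz.
- by move=> w; rewrite [LHS]fE {2}(gE w); ring.
Qed.

Lemma analytic_on_discP f :
  analytic_on_disc f <-> forall z, cmod z < 1 -> exists D, cderiv f z D.
Proof.
split=> h z.
  by rewrite -mem_disc => /h /cderiv_of_derivable.
by rewrite mem_disc => /h[D /derivable_of_cderiv].
Qed.

End ComplexDerivative.

(** * Differentiability in two real variables *)

Section PlaneDifferentiability.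
Context {R : realType}.
Notation C := (R[i]^o).

Lemma tcontinuousP (T : topologicalType) (F : T -> C) (x : T) : {for x, continuous F} <->
  forall e : R, 0 < e -> \forall y \near x, cmod (F y - F x) < e.
Proof.
split=> [/cvgrPdist_lt cF e e0|h].
  have /cF : 0 < e%:C by rewrite ltcR.
  by apply: filterS => y; rewrite normcE_cmod ltcR cmodBC.
apply/(@cvgrPdist_lt _ C _ (nbhs x) (nbhs_filter x) F (F x)) => e /gtc0_real[-> e0].
by apply: filterS (h _ e0) => y; rewrite normcE_cmod ltcR cmodBC.
Qed.

Section TopologicalDomain.
Context {T : topologicalType}.
Implicit Types (F G : T -> C) (x : T).

Lemma tcontinuous_cst (k : C) x : {for x, continuous (fun=> k : C)}.
Proof. by apply/tcontinuousP => e e0; near=> y; rewrite subrr cmod0.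
Unshelve. all: by end_near. Qed.

Lemma tcontinuousD F G x : {for x, continuous F} -> {for x, continuous G} ->
  {for x, continuous (fun w => F w + G w)}.
Proof. by move=> cf cg; exact: (@cvgD _ C _ _ _ _ _ _ _ cf cg). Qed.

Lemma tcontinuousM F G x : {for x, continuous F} -> {for x, continuous G} ->
  {for x, continuous (fun w => F w * G w)}.
Proof. by move=> cf cg; exact: (@cvgM _ _ _ _ _ _ _ _ cf cg). Qed.

Lemma tcontinuousV F x : F x != 0 -> {for x, continuous F} ->
  {for x, continuous (fun w => (F w)^-1)}.
Proof. by move=> f0 cf; exact: (@cvgV _ _ _ _ _ _ f0 cf). Qed.

Lemma tcontinuous_real (u : T -> R) x : {for x, continuous u} ->
  {for x, continuous (fun w => (u w)%:C : C)}.
Proof.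
move=> /cvgrPdist_lt cu; apply/tcontinuousP => e e0.
apply: filterS (cu e e0) => y.
have -> : cmod ((u y)%:C - (u x)%:C : C) = `|u y - u x| by rewrite -cmod_real rmorphB.
by rewrite distrC.
Qed.

Lemma tcontinuous_Re F x : {for x, continuous F} -> {for x, continuous (fun w => Re (F w))}.
Proof.
move=> /tcontinuousP cF; apply/cvgrPdist_lt => e e0.
by apply: filterS (cF e e0) => y; rewrite distrC -ReB; exact: le_lt_trans (normr_Re_le _).
Qed.

Lemma tcontinuous_Im F x : {for x, continuous F} -> {for x, continuous (fun w => Im (F w))}.
Proof.
move=> /tcontinuousP cF; apply/cvgrPdist_lt => e e0.
by apply: filterS (cF e e0) => y; rewrite distrC -ImB; exact: le_lt_trans (normr_Im_le _).
Qed.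

End TopologicalDomain.

Implicit Types (F G : R * R -> C) (p : R * R) (a b c d : C).

(** Caratheodory's form in the plane: a and b are the partial derivatives at p. The rules of
    calculus become algebraic identities between the coefficient functions, which are continuous at
    p only. *)
Definition pderiv F p a b := exists A B : R * R -> C,
  [/\ {for p, continuous A}, {for p, continuous B}, A p = a, B p = b &
    forall q, F q = F p + (A q * (q.1 - p.1)%:C + B q * (q.2 - p.2)%:C)].

Lemma pderiv_continuous F p a b : pderiv F p a b -> {for p, continuous F}.
Proof.
move=> [A [B [cA cB _ _ FE]]]; rewrite (_ : F = fun q => F p +
  (A q * (q.1 - p.1)%:C + B q * (q.2 - p.2)%:C)); last exact/funext.
have c1 : {for p, continuous (fun q : R * R => (q.1 - p.1)%:C : C)}.
  by apply: tcontinuous_real; apply: (@cvgB _ R); [exact: cvg_fst|exact: cvg_cst].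
have c2 : {for p, continuous (fun q : R * R => (q.2 - p.2)%:C : C)}.
  by apply: tcontinuous_real; apply: (@cvgB _ R); [exact: cvg_snd|exact: cvg_cst].
exact: (tcontinuousD (@tcontinuous_cst _ (F p) p)
  (tcontinuousD (tcontinuousM cA c1) (tcontinuousM cB c2))).
Qed.

Lemma pderiv_cst (k : C) p : pderiv (fun=> k) p 0 0.
Proof.
exists (fun=> 0), (fun=> 0); split.
- exact: (@tcontinuous_cst _ (0 : C) p).
- exact: (@tcontinuous_cst _ (0 : C) p).
- by [].
- by [].
by move=> q; rewrite !mul0r !addr0.
Qed.

Lemma pderivD F G p a b c d : pderiv F p a b -> pderiv G p c d ->
  pderiv (fun q => F q + G q) p (a + c) (b + d).
Proof.
move=> [A [B [cA cB <- <- FE]]] [A' [B' [cA' cB' <- <- GE]]].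
exists (fun q => A q + A' q), (fun q => B q + B' q); split.
- exact: (tcontinuousD cA cA').
- exact: (tcontinuousD cB cB').
- by [].
- by [].
- by move=> q; rewrite FE GE; ring.
Qed.

Lemma pderivM F G p a b c d : pderiv F p a b -> pderiv G p c d ->
  pderiv (fun q => F q * G q) p (a * G p + F p * c) (b * G p + F p * d).
Proof.
move=> dF dG; have cG := pderiv_continuous dG; move: dF dG.
move=> [A [B [cA cB <- <- FE]]] [A' [B' [cA' cB' <- <- GE]]].
have ck := @tcontinuous_cst _ (F p) p.
exists (fun q => A q * G q + F p * A' q), (fun q => B q * G q + F p * B' q); split.
- exact: (tcontinuousD (tcontinuousM cA cG) (tcontinuousM ck cA')).
- exact: (tcontinuousD (tcontinuousM cB cG) (tcontinuousM ck cB')).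
- by [].
- by [].
- move=> q; rewrite [F q]FE mulrDl {1}[G q]GE; ring.
Qed.

Lemma pderivV F p a b : (forall q, F q != 0) -> pderiv F p a b ->
  pderiv (fun q => (F q)^-1) p (- a / F p ^+ 2) (- b / F p ^+ 2).
Proof.
move=> F0 dF; have cF := tcontinuousV (F0 p) (pderiv_continuous dF); move: dF.
move=> [A [B [cA cB <- <- FE]]].
have ck := @tcontinuous_cst _ (- (F p)^-1 : C) p.
exists (fun q => A q * (F q)^-1 * (- (F p)^-1)), (fun q => B q * (F q)^-1 * (- (F p)^-1)).
split.
- exact: (tcontinuousM (tcontinuousM cA cF) ck).
- exact: (tcontinuousM (tcontinuousM cB cF) ck).
- by field; exact: F0.
- by field; exact: F0.
- move=> q; have Fq : A q * (q.1 - p.1)%:C + B q * (q.2 - p.2)%:C = F q - F p.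
    by rewrite [F q]FE [RHS]addrAC subrr add0r.
  transitivity ((F p)^-1 + (A q * (q.1 - p.1)%:C + B q * (q.2 - p.2)%:C) *
    (- (F p)^-1 * (F q)^-1)); last by ring.
  rewrite Fq.
  by field; apply/andP.
Qed.

Lemma pderiv_comp (g : C -> C) F p a b D : pderiv F p a b -> cderiv g (F p) D ->
  pderiv (fun q => g (F q)) p (D * a) (D * b).
Proof.
move=> dF; have cF := pderiv_continuous dF; move: dF.
move=> [A [B [cA cB <- <- FE]]] [h [ch <- gE]].
have chF : {for p, continuous (fun q => h (F q))} := @continuous_comp _ _ _ F h p cF ch.
exists (fun q => h (F q) * A q), (fun q => h (F q) * B q); split.
- exact: (tcontinuousM chF cA).
- exact: (tcontinuousM chF cB).
- by [].
- by [].
- by move=> q; rewrite gE {2}(FE q); ring.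
Qed.

Lemma is_derive_caratheodory (u : R -> R) (x d : R) : is_derive x 1 u d ->
  exists q, [/\ {for x, continuous q}, q x = d & forall y, u y = u x + q y * (y - x)].
Proof.
move=> [du ud]; exists (fun y => if y == x then d else (u y - u x) / (y - x)); split.
- have {}du : h^-1 *: ((u \o shift x) (h *: 1) - u x) @[h --> 0^'] --> d.
    by rewrite -ud; exact: du.
  apply/cvgrPdist_lt => e e0; rewrite eqxx.
  have /cvgrPdist_lt /(_ e e0) := du.
  rewrite near_withinE => /nbhs_ballP[/= r r0 hr].
  apply/nbhs_ballP; exists r => // y /= yr; case: eqVneq => [_|yx]; first by rewrite subrr normr0.
  have := hr (y - x); rewrite /ball /= sub0r normrN distrC => /(_ yr).
  by rewrite subr_eq0 => /(_ yx); rewrite /GRing.scale /= mulr1 subrK mulrC.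
- by rewrite eqxx.
- move=> y; case: eqVneq => [->|yx]; first by rewrite subrr mulr0 addr0.
  by rewrite divfK ?subr_eq0 // addrC subrK.
Qed.

Lemma pderiv_fst (u : R -> R) p (d : R) : is_derive p.1 1 u d ->
  pderiv (fun q => (u q.1)%:C) p d%:C 0.
Proof.
move=> /is_derive_caratheodory[h [ch <- uE]].
exists (fun q => (h q.1)%:C), (fun=> 0); split.
- apply: tcontinuous_real; apply: (@continuous_comp _ _ _ fst h) ch.
  exact: cvg_fst.
- exact: (@tcontinuous_cst _ (0 : C) p).
- by [].
- by [].
- by move=> q; rewrite uE rmorphD rmorphM /= mul0r addr0.
Qed.

Lemma pderiv_snd (u : R -> R) p (d : R) : is_derive p.2 1 u d ->
  pderiv (fun q => (u q.2)%:C) p 0 d%:C.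
Proof.
move=> /is_derive_caratheodory[h [ch <- uE]].
exists (fun=> 0), (fun q => (h q.2)%:C); split.
- exact: (@tcontinuous_cst _ (0 : C) p).
- apply: tcontinuous_real; apply: (@continuous_comp _ _ _ snd h) ch.
  exact: cvg_snd.
- by [].
- by [].
- by move=> q; rewrite uE rmorphD rmorphM /= mul0r add0r.
Qed.

(** The functional f stands for the real or the imaginary part. Closedness is the coincidence of the
    second partial derivative of F with the first one of G, both called b. *)
Lemma pderiv_closed_at F G p a b d (f : C -> R) :
  (forall z w, f (z + w) = f z + f w) -> (forall z (r : R), f (z * r%:C) = f z * r) ->
  (forall z, `|f z| <= cmod z) ->
  pderiv F p a b -> pderiv G p b d ->
  closed_at (fun s t => f (F (s, t))) (fun s t => f (G (s, t))) p.1 p.2.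
Proof.
move=> fD fM fle [A [B [cA cB Ap Bp FE]]] [A' [B' [cA' cB' Ap' Bp' GE]]].
exists (f a), (f b), (f d) => e e0.
have fB z w : f (z - w) = f z - f w.
  have N1 : - w = w * (-1)%:C by rewrite rmorphN rmorph1 mulrN1.
  by rewrite fD N1 fM mulrN1.
have near H : {for p, continuous H} -> exists2 r : R, 0 < r &
    forall s t, `|s - p.1| <= r -> `|t - p.2| <= r -> `|f (H (s, t)) - f (H p)| <= e.
  move=> /tcontinuousP /(_ e e0) /nbhs_ballP[/= r r0 hr].
  exists (r / 2); first by rewrite divr_gt0.
  move=> s t hs ht; rewrite -fB; apply/ltW/(le_lt_trans (fle _)); apply: hr.
  have lr : r / 2 < r by rewrite ltr_pdivrMr // ltr_pMr // ltr1n.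
  by split; rewrite /ball /= distrC; exact: le_lt_trans lr.
have [r1 r10 h1] := near _ cA; have [r2 r20 h2] := near _ cB.
have [r3 r30 h3] := near _ cA'; have [r4 r40 h4] := near _ cB'.
exists (Num.min (Num.min r1 r2) (Num.min r3 r4)).
  by rewrite !lt_min r10 r20 r30 r40.
move=> s t; rewrite !le_min => /andP[/andP[s1 s2] /andP[s3 s4]].
move=> /andP[/andP[t1 t2] /andP[t3 t4]].
have est H H1 H2 (k1 k2 : C) : H1 p = k1 -> H2 p = k2 ->
    (forall q, H q = H p + (H1 q * (q.1 - p.1)%:C + H2 q * (q.2 - p.2)%:C)) ->
    `|f (H1 (s, t)) - f (H1 p)| <= e -> `|f (H2 (s, t)) - f (H2 p)| <= e ->
    `|f (H (s, t)) - f (H (p.1, p.2)) - (f k1 * (s - p.1) + f k2 * (t - p.2))|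
      <= e * (`|s - p.1| + `|t - p.2|).
  move=> <- <- HE e1 e2; rewrite -surjective_pairing HE !fD !fM /=.
  set x1 := f (H1 _); set x2 := f (H2 _); set y1 := f (H1 p); set y2 := f (H2 p).
  have -> : f (H p) + (x1 * (s - p.1) + x2 * (t - p.2)) - f (H p) -
    (y1 * (s - p.1) + y2 * (t - p.2)) = (x1 - y1) * (s - p.1) + (x2 - y2) * (t - p.2) by ring.
  apply: (le_trans (ler_normD _ _)); rewrite !normrM mulrDr.
  by apply: lerD; apply: ler_wpM2r.
split; first by apply: (est F A B) => //; [exact: h1|exact: h2].
by apply: (est G A' B') => //; [exact: h3|exact: h4].
Qed.

End PlaneDifferentiability.

(** * Cauchy's formula and polynomial approximation *)

Section Cauchy.
Context {R : realType}.
Notation C := (R[i]^o).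
Notation mu := (@lebesgue_measure R).

(** The exponential e^(it), written with ring operations so that the rules for continuity and
    derivatives apply to it. *)
Definition cis (t : R) : R[i] := (cos t)%:C + 'i%C * (sin t)%:C.

Lemma cisE t : cis t = cos t +i* sin t.
Proof. by rewrite /cis; apply: complex_inj; rewrite /=; ring. Qed.

Lemma cmod_cis t : cmod (cis t) = 1.
Proof. by rewrite cmodE cisE /= cos2Dsin2 sqrtr1. Qed.

Definition cint (F : R -> R[i]) : R[i] :=
  (\int[mu]_(t in `[- pi, pi]) Re (F t)) +i* (\int[mu]_(t in `[- pi, pi]) Im (F t)).

Definition ccont (F : R -> R[i]) := forall t, {for t, continuous (F : R -> C)}.

Lemma ccont_cst k : ccont (fun=> k).
Proof. by move=> t; exact: (@tcontinuous_cst R R k t). Qed.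

Lemma ccontD F G : ccont F -> ccont G -> ccont (fun t => F t + G t).
Proof. by move=> cF cG t; exact: (@tcontinuousD R R F G t (cF t) (cG t)). Qed.

Lemma ccontM F G : ccont F -> ccont G -> ccont (fun t => F t * G t).
Proof. by move=> cF cG t; exact: (@tcontinuousM R R F G t (cF t) (cG t)). Qed.

Lemma ccontV F : (forall t, F t != 0) -> ccont F -> ccont (fun t => (F t)^-1).
Proof. by move=> F0 cF t; exact: (@tcontinuousV R R F t (F0 t) (cF t)). Qed.

Lemma ccontX F n : ccont F -> ccont (fun t => F t ^+ n).
Proof.
move=> cF; elim: n => [|n IH]; first exact: ccont_cst.
rewrite (_ : (fun t => _) = fun t => F t * F t ^+ n); last by apply/funext => t; rewrite exprS.
exact: ccontM.
Qed.

Lemma ccont_cis : ccont cis.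
Proof.
apply: ccontD => [t|]; first exact/tcontinuous_real/continuous_cos.
apply: ccontM => [|t]; first exact: ccont_cst.
exact/tcontinuous_real/continuous_sin.
Qed.

Lemma ccont_comp (g : C -> C) F : ccont F -> (forall t, {for F t, continuous g}) ->
  ccont (fun t => g (F t)).
Proof. by move=> cF cg t; exact: (@continuous_comp _ _ _ (F : R -> C) g t (cF t) (cg t)). Qed.

Lemma ccont_Re F : ccont F -> forall t, {for t, continuous (fun t => Re (F t))}.
Proof. by move=> cF t; exact: (tcontinuous_Re (cF t)). Qed.

Lemma ccont_Im F : ccont F -> forall t, {for t, continuous (fun t => Im (F t))}.
Proof. by move=> cF t; exact: (tcontinuous_Im (cF t)). Qed.

Lemma pi_seg : - pi <= pi :> R.
Proof. by have := pi_ge0 R; lra. Qed.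

Lemma ccont_int_Re F : ccont F -> mu.-integrable `[- pi, pi] (EFin \o (fun t => Re (F t))).
Proof. by move=> cF; apply: continuous_itv_integrable => t _; exact: ccont_Re. Qed.

Lemma ccont_int_Im F : ccont F -> mu.-integrable `[- pi, pi] (EFin \o (fun t => Im (F t))).
Proof. by move=> cF; apply: continuous_itv_integrable => t _; exact: ccont_Im. Qed.

Lemma cintD F G : ccont F -> ccont G -> cint (fun t => F t + G t) = cint F + cint G.
Proof.
move=> cF cG; apply: complex_inj; rewrite ?ReD ?ImD /=.
  under eq_Rintegral do rewrite ReD.
  by rewrite RintegralD //; exact: ccont_int_Re.
under eq_Rintegral do rewrite ImD.
by rewrite RintegralD //; exact: ccont_int_Im.
Qed.

Lemma cintZ k F : ccont F -> cint (fun t => k * F t) = k * cint F.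
Proof.
move=> cF.
have RZ (r : R) (u : R -> R) : mu.-integrable `[- pi, pi] (EFin \o u) ->
    mu.-integrable `[- pi, pi] (EFin \o (fun t => r * u t)).
  by move=> iu; exact: (integrableZl _ _ iu).
have iR := ccont_int_Re cF; have iI := ccont_int_Im cF.
apply: complex_inj; rewrite ?ReM ?ImM /=.
  under eq_Rintegral do rewrite ReM.
  by rewrite RintegralB ?RintegralZl //; exact: RZ.
under eq_Rintegral do rewrite ImM.
by rewrite RintegralD ?RintegralZl //; exact: RZ.
Qed.

Lemma cint_sum n (F : 'I_n -> R -> R[i]) : (forall i, ccont (F i)) ->
  ccont (fun t => \sum_(i < n) F i t) /\
  cint (fun t => \sum_(i < n) F i t) = \sum_(i < n) cint (F i).
Proof.
elim: n F => [|n IH] F cF.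
  rewrite big_ord0; have -> : (fun t => \sum_(i < 0) F i t) = (fun=> 0 * 0).
    by apply/funext => t; rewrite big_ord0 mul0r.
  by split; [exact: ccont_cst|rewrite cintZ ?mul0r //; exact: ccont_cst].
have -> : (fun t => \sum_(i < n.+1) F i t) =
    (fun t => F ord0 t + \sum_(i < n) F (lift ord0 i) t).
  by apply/funext => t; rewrite big_ord_recl.
have [c1 c2] := IH (fun i => F (lift ord0 i)) (fun i => cF _).
split; first exact: (ccontD (cF ord0) c1).
by rewrite (cintD (cF ord0) c1) c2 big_ord_recl.
Qed.

(** The outer factor 2 comes from bounding the real and imaginary parts separately. It is harmless,
    since the bound is used only with an M that can be made small. *)
Lemma cint_bound F M : ccont F -> (forall t, - pi <= t <= pi -> cmod (F t) <= M) ->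
  cmod (cint F) <= 2 * (M * (2 * pi)).
Proof.
move=> cF FM; apply: (le_trans (cmod_le_ReIm _)) => /=.
have e : M * (2 * pi) = M * (pi - - pi) by congr (_ * _); ring.
rewrite [leRHS]mulr_natl mulr2n e.
apply: lerD; apply: le_norm_Rintegral_itv; rewrite ?pi_seg //.
- by move=> t _; exact: ccont_Re.
- by move=> t /FM; apply: le_trans; exact: normr_Re_le.
- by move=> t _; exact: ccont_Im.
- by move=> t /FM; apply: le_trans; exact: normr_Im_le.
Qed.

Lemma cint_cst k : cint (fun=> k) = k * (2 * pi)%:C.
Proof.
rewrite /cint !Rintegral_itv_cst ?pi_seg //.
by apply: complex_inj; rewrite ?ReM ?ImM /=; ring.
Qed.

Lemma cint_conj F : ccont F -> cint (fun t => (F t)^*%C) = (cint F)^*%C.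
Proof.
move=> cF; apply: complex_inj; rewrite /=.
  by apply: eq_Rintegral => t _; case: (F t).
rewrite -[RHS]mulN1r -RintegralZl //; last exact: ccont_int_Im.
by apply: eq_Rintegral => t _; rewrite mulN1r; case: (F t).
Qed.

Section CauchyFormula.
Variables (g : R[i] -> R[i]) (rho : R) (w : R[i]).
Hypothesis ag : forall z, cmod z < 1 -> exists D, cderiv g z D.
Hypotheses (rho1 : rho < 1) (wrho : cmod w < rho).

Let zeta t : R[i] := rho%:C * cis t.

Let rho0 : 0 < rho. Proof. exact: le_lt_trans (cmod_ge0 w) wrho. Qed.

Let cmod_zeta t : cmod (zeta t) = rho.
Proof. by rewrite cmodM cmod_cis mulr1 cmod_real gtr0_norm. Qed.

Let zetaw t : zeta t - w != 0.
Proof. by rewrite subr_eq0; apply: contraTneq wrho => <-; rewrite cmod_zeta ltxx. Qed.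

(** On the circle dz = i zeta dt, so this is the density of dz / (i (z - w)) in the angle t. *)
Definition cauchy_kernel t : R[i] := zeta t / (zeta t - w).

Lemma ccont_zeta : ccont zeta.
Proof. by apply: ccontM; [exact: ccont_cst|exact: ccont_cis]. Qed.

Lemma ccont_cauchy_kernel : ccont cauchy_kernel.
Proof.
apply: ccontM; first exact: ccont_zeta.
apply: ccontV => //; apply: ccontD; [exact: ccont_zeta|exact: ccont_cst].
Qed.

Lemma cauchy_kernel_bound t : cmod (cauchy_kernel t) <= rho / (rho - cmod w).
Proof.
rewrite cmodM cmodV cmod_zeta ler_pM2l // lef_pV2 ?posrE ?cmod_gt0 ?subr_gt0 //.
by rewrite -{1}(cmod_zeta t); exact: cmod_dist.
Qed.

(** The contraction of the circle onto w: s = 0 gives the circle, and s tending to -oo gives the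
    centre w. *)
Let zst (p : R * R) : R[i] := w + (expR p.1)%:C * (zeta p.2 - w).

(** For s <= 0 the point is a convex combination of w and of a point of the circle. *)
Let zst1 s t : s <= 0 -> cmod (zst (s, t)) < 1.
Proof.
move=> s0; have e1 : expR s <= 1 by rewrite -expR0 ler_expR.
have e0 := expR_gt0 s.
have -> : zst (s, t) = (1 - expR s)%:C * w + (expR s)%:C * zeta t.
  by rewrite /zst /= rmorphB rmorph1; ring.
apply: (le_lt_trans (cmodD _ _)); rewrite (cmodM _ w) (cmodM _ (zeta t)) cmod_zeta !cmod_real.
rewrite (ger0_norm (ltW e0)) ger0_norm ?subr_ge0 //.
apply: le_lt_trans rho1; rewrite -[leRHS](subrK (expR s * rho)) lerD2r.
have -> : rho - expR s * rho = (1 - expR s) * rho by ring.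
by rewrite ler_wpM2l ?subr_ge0 // ltW.
Qed.

Let zst_pderiv p : pderiv zst p ((expR p.1)%:C * (zeta p.2 - w))
  ((expR p.1)%:C * ('i%C * zeta p.2)).
Proof.
have dE : pderiv (fun q => (expR q.1)%:C) p (expR p.1)%:C 0 by apply: pderiv_fst; exact: is_derive_expR.
have dc : pderiv (fun q => (cos q.2)%:C) p 0 (- sin p.2)%:C by apply: pderiv_snd; exact: is_derive_cos.
have ds : pderiv (fun q => (sin q.2)%:C) p 0 (cos p.2)%:C by apply: pderiv_snd; exact: is_derive_sin.
have dk k := @pderiv_cst R k p.
have dz := pderivD (pderivM (dk rho%:C) (pderivD dc (pderivM (dk 'i%C) ds))) (dk (- w)).
have := pderivD (dk w) (pderivM dE dz).
congr (pderiv _ _ _ _).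
  rewrite /zeta /cis; cbv beta. ring.
rewrite /zeta /cis rmorphN; cbv beta; have ii : 'i%C * 'i%C = -1 :> R[i] by rewrite -expr2 sqr_i.
set e := (expR _)%:C; set c := (cos _)%:C; set s := (sin _)%:C; set r := rho%:C.
transitivity (e * r * ('i%C * c + ('i%C * 'i%C) * s)); last by ring.
by rewrite ii; ring.
Qed.

(* The form P ds + Q dt below is -i g(z) dz / (z - w) in the coordinates
   z = w + e^s (zeta(t) - w): no point of the (s, t)-plane is singular. *)
Let P (p : R * R) : R[i] := - 'i%C * g (zst p).
Let Q (p : R * R) : R[i] := g (zst p) * cauchy_kernel p.2.

(** Both mixed derivatives equal g'(z) e^s zeta(t). In the t-derivative of P the factor -i meets the
    i of the derivative of zeta; in the s-derivative of Q the factor zeta - w cancels the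
    denominator of the kernel. *)
Let PQ_closed (f : R[i] -> R) s t :
  (forall z w, f (z + w) = f z + f w) -> (forall z (r : R), f (z * r%:C) = f z * r) ->
  (forall z, `|f z| <= cmod z) -> s <= 0 ->
  closed_at (fun s t => f (P (s, t))) (fun s t => f (Q (s, t))) s t.
Proof.
move=> fD fM fle s0; have [D dg] := ag (zst1 t s0).
have dgz := pderiv_comp (zst_pderiv (s, t)) dg.
have dk k := @pderiv_cst R k (s, t).
have dP := pderivM (dk (- 'i%C)) dgz.
have [K1 dK] : exists K1, pderiv (fun q => cauchy_kernel q.2) (s, t) 0 K1.
  have dc : pderiv (fun q => (cos q.2)%:C) (s, t) 0 (- sin t)%:C by apply: pderiv_snd; exact: is_derive_cos.
  have ds : pderiv (fun q => (sin q.2)%:C) (s, t) 0 (cos t)%:C by apply: pderiv_snd; exact: is_derive_sin.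
  have dz := pderivM (dk rho%:C) (pderivD dc (pderivM (dk 'i%C) ds)).
  have dzV := pderivV (fun q => zetaw q.2) (pderivD dz (dk (- w))).
  have := pderivM dz dzV; rewrite [X in pderiv _ _ X _](_ : _ = 0); last by cbv beta; ring.
  by move=> H; eexists; exact: H.
have dQ := pderivM dgz dK.
apply: (pderiv_closed_at fD fM fle dP).
move: dQ; congr (pderiv _ _ _ _) => /=.
have ii : 'i%C * 'i%C = -1 :> R[i] by rewrite -expr2 sqr_i.
rewrite /cauchy_kernel; set k := zeta t - w; have k0 : k != 0 by exact: zetaw.
transitivity (D * (expR s)%:C * zeta t * (k / k)); first by ring.
rewrite divff //; transitivity (- ('i%C * 'i%C) * (D * (expR s)%:C * zeta t)); last by ring.
by rewrite ii; ring.
Qed.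

Let zeta_per : zeta (- pi) = zeta pi.
Proof. by rewrite /zeta !cisE cosN sinN sinpi oppr0. Qed.

Let zst_small (e : R) : 0 < e -> exists2 s : R, s <= 0 & forall t, cmod (zst (s, t) - w) < e.
Proof.
move=> e0; exists (Num.min 0 (ln (e / 2))); first by rewrite ge_min lexx.
move=> t; rewrite /zst addrAC subrr add0r cmodM cmod_real gtr0_norm ?expR_gt0 //.
have e2 : expR (Num.min 0 (ln (e / 2))) <= e / 2.
  by rewrite -[leRHS]lnK ?posrE ?divr_gt0 // ler_expR ge_min lexx orbT.
have z2 : cmod (zeta t - w) < 2.
  apply: (le_lt_trans (cmodB _ _)); rewrite cmod_zeta.
  by have := ltW wrho; have := rho1; lra.
apply: (@lt_le_trans _ _ (e / 2 * 2)); last by rewrite divfK.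
apply: (@le_lt_trans _ _ (e / 2 * cmod (zeta t - w))).
  by apply: ler_wpM2r; [exact: cmod_ge0|exact: e2].
by rewrite ltr_pM2l // divr_gt0.
Qed.

Let ccontQ s : s <= 0 -> ccont (fun t => Q (s, t)).
Proof.
move=> s0; apply: (ccontM _ ccont_cauchy_kernel).
have c1 := ccontM (@ccont_cst (expR s)%:C) (ccontD ccont_zeta (@ccont_cst (- w))).
apply: (@ccont_comp g (fun t => zst (s, t)) (ccontD (@ccont_cst w) c1)) => t.
by have [D /cderiv_continuous] := ag (zst1 t s0).
Qed.

(** Goursat on [s, 0] x [-pi, pi]: the sides t = -pi and t = pi cancel by periodicity, so the
    integrals over the two remaining sides agree. *)
Let cint_Q s : s <= 0 -> cint (fun t => Q (0, t)) = cint (fun t => Q (s, t)).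
Proof.
move=> s0; have hz : zst (s, - pi) = zst (s, pi) by rewrite /zst /= zeta_per.
have key (f : R[i] -> R) :
    (forall z w, f (z + w) = f z + f w) -> (forall z (r : R), f (z * r%:C) = f z * r) ->
    (forall z, `|f z| <= cmod z) ->
    \int[mu]_(t in `[- pi, pi]) (f (Q (0, t)) - f (Q (s, t))) = 0.
  move=> fD fM fle.
  have := @goursat R (fun s t => f (P (s, t))) (fun s t => f (Q (s, t))) s 0 (- pi) pi s0 pi_seg.
  have -> : bint (fun s t => f (P (s, t))) (fun s t => f (Q (s, t))) s 0 (- pi) pi =
      \int[mu]_(t in `[- pi, pi]) (f (Q (0, t)) - f (Q (s, t))).
    rewrite /bint -[RHS]add0r; congr (_ + _).
    transitivity (\int[mu]_(x in `[s, 0]) (0 : R)); last by rewrite Rintegral_cst // mul0r.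
    by apply: eq_Rintegral => x _; rewrite /P /zst /= zeta_per subrr.
  by apply => x y /andP[_ x0] _; exact: PQ_closed.
have c0 := ccontQ (lexx 0); have cs := ccontQ s0.
have hR := @RintegralB _ _ _ mu _ (fun t => Re (Q (0, t))) (fun t => Re (Q (s, t)))
  (measurable_itv _) (ccont_int_Re c0) (ccont_int_Re cs).
have hI := @RintegralB _ _ _ mu _ (fun t => Im (Q (0, t))) (fun t => Im (Q (s, t)))
  (measurable_itv _) (ccont_int_Im c0) (ccont_int_Im cs).
apply: complex_inj; apply/eqP; rewrite -subr_eq0; apply/eqP.
  apply: etrans (esym hR) _; apply: key => [z v|z r|z]; [exact: ReD| |exact: normr_Re_le].
  by rewrite ReM /= mulr0 subr0.
apply: etrans (esym hI) _; apply: key => [z v|z r|z]; [exact: ImD| |exact: normr_Im_le].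
by rewrite ImM /= mulr0 add0r.
Qed.

(** The integral over the contracted circle does not depend on s, and as s tends to -oo its
    integrand tends uniformly to g(w) times the kernel. The integral of the kernel itself stays
    unevaluated here. *)
Theorem cauchy_formula :
  cint (fun t => g (zeta t) * cauchy_kernel t) = g w * cint cauchy_kernel.
Proof.
have -> : (fun t => g (zeta t) * cauchy_kernel t) = (fun t => Q (0, t)).
  by apply/funext => t; rewrite /Q /zst /= expR0 mul1r addrC subrK.
have cK := ccont_cauchy_kernel.
apply/eqP; rewrite -subr_eq0 -cmod_eq0 eq_le cmod_ge0 andbT.
apply/ler_addgt0Pl => e e0; rewrite addr0.
pose K := rho / (rho - cmod w).
have K0 : 0 < K by rewrite divr_gt0 // subr_gt0.
(* The divisors anticipate the factor 2 (2 pi) of [cint_bound] and the bound K of the kernel. *)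
have e'0 : 0 < e / (2 * (2 * pi)) / K by rewrite !divr_gt0 ?mulr_gt0 ?pi_gt0 ?subr_gt0.
have w1 : cmod w < 1 by exact: lt_trans rho1.
have [D /cderiv_continuous /ccontinuousP /(_ _ e'0)[r r0 hr]] := ag w1.
have [s s0 hs] := zst_small r0.
have cgK := ccontM (@ccont_cst (- g w)) cK.
rewrite (cint_Q s0) -mulNr -(cintZ _ cK) -(cintD (ccontQ s0) cgK).
have -> : e = 2 * ((e / (2 * (2 * pi)) / K * K) * (2 * pi)).
  have p0 : 2 * (2 * pi) != 0 :> R by rewrite lt0r_neq0 // !mulr_gt0 ?pi_gt0.
  by rewrite divfK ?(lt0r_neq0 K0) // mulrCA divfK.
apply: cint_bound.
  exact: (ccontD (ccontQ s0) cgK).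
move=> t _; have -> : Q (s, t) + - g w * cauchy_kernel t = (g (zst (s, t)) - g w) * cauchy_kernel t.
  by rewrite /Q mulrBl mulNr.
rewrite cmodM; apply: ler_pM; rewrite ?cmod_ge0 //; last exact: cauchy_kernel_bound.
by apply/ltW/hr.
Qed.

End CauchyFormula.

End Cauchy.

(** * Uniform polynomial approximation on smaller discs *)

Section PolynomialApproximation.
Context {R : realType}.
Notation C := (R[i]^o).

Lemma cderivX n (z : C) : exists D, cderiv (fun w => w ^+ n : C) z D.
Proof.
elim: n => [|n [D IH]]; first by exists 0; exact: cderiv_cst.
exists (1 * z ^+ n + z * D).
rewrite (_ : (fun w => w ^+ n.+1) = (fun w => w * w ^+ n)); last first.
  by apply/funext => w; rewrite exprS.
exact: cderivM (cderiv_id z) IH.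
Qed.

Lemma expr_small (q k e : R) : 0 <= q < 1 -> 0 <= k -> 0 < e ->
  exists N, forall n, (N <= n)%N -> k * q ^+ n <= e.
Proof.
move=> /andP[q0 q1] k0 e0; have k1 : 0 < k + 1 by rewrite ltr_wpDl.
have hc : GRing.exp q @ \oo --> 0 by apply: cvg_expr; rewrite ger0_norm.
have : \forall n \near \oo, q ^+ n <= e / (k + 1) by apply: (cvgr_le 0 hc); rewrite divr_gt0.
move=> [N _ hN]; exists N => n /hN /=; rewrite ler_pdivlMr // mulrC => h.
by apply: le_trans h; rewrite ler_wpM2r ?exprn_ge0 // lerDl.
Qed.

Section Circle.
Variable rho : R.
Hypotheses (rho0 : 0 < rho) (rho1 : rho < 1).
Notation zeta := (fun t : R => rho%:C * cis t : R[i]).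

(** Cauchy's formula at w = 0, where the kernel is constantly 1 and the value of z^j is 0. *)
Lemma cint_circleX j : (0 < j)%N -> cint (fun t => (rho%:C * cis t) ^+ j : R[i]) = 0.
Proof.
move=> j0; have w0 : cmod (0 : R[i]) < rho by rewrite cmod0.
have := @cauchy_formula R (fun z => z ^+ j) rho 0 (fun z _ => cderivX j z) rho1 w0.
rewrite expr0n eqn0Ngt j0 /= mul0r => <-; congr cint; apply/funext => t.
rewrite /cauchy_kernel subr0 divff ?mulr1 //.
by rewrite -cmod_eq0 cmodM cmod_cis cmod_real mulr1 gt_eqF // normr_gt0 gt_eqF.
Qed.

Lemma circle_neq0 t : rho%:C * cis t != 0 :> R[i].
Proof. by rewrite -cmod_eq0 cmodM cmod_cis cmod_real mulr1 normr_eq0 gt_eqF. Qed.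

Lemma cmod_circle t : cmod (rho%:C * cis t) = rho.
Proof. by rewrite cmodM cmod_cis cmod_real mulr1 gtr0_norm. Qed.

(** On the circle 1/zeta = rho^-2 conj(zeta), so this is the conjugate of the case of positive
    powers. *)
Lemma cint_circleVX j : (0 < j)%N -> cint (fun t => (rho%:C * cis t)^-1 ^+ j : R[i]) = 0.
Proof.
move=> j0; have := cint_circleX j0.
have cX : ccont (fun t => (rho%:C * cis t) ^+ j).
  exact/ccontX/(ccontM (@ccont_cst _ rho%:C) (@ccont_cis R)).
move=> /(congr1 conjc); rewrite -(cint_conj cX) conjc0.
have cXJ : ccont (fun t => ((rho%:C * cis t) ^+ j)^*%C).
  move=> t; apply/tcontinuousP => e e0; have /tcontinuousP/(_ e e0) := cX t.
  by apply: filterS => s; rewrite -rmorphB cmodJ.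
move=> /(congr1 (fun x => (rho ^- 2)%:C ^+ j * x)); rewrite mulr0 -(cintZ _ cXJ) => <-.
congr cint; apply/funext => t; rewrite rmorphXn /= -exprMn; congr (_ ^+ _).
apply: (mulfI (circle_neq0 t)); rewrite divff ?circle_neq0 //.
rewrite mulrCA mulcJ_cmod cmod_circle -rmorphM /= mulVf ?rmorph1 //.
by rewrite expf_neq0 ?gt_eqF.
Qed.

End Circle.

(** The kernel is expanded as a finite geometric series in w / zeta with an exact remainder, on a
    circle strictly between radius r and 1. The polynomial is the Taylor polynomial, with its
    coefficients given as circle integrals. *)
Theorem polynomial_approximation (g : R[i] -> R[i]) (M r e : R) :
  (forall z, cmod z < 1 -> exists D, cderiv g z D) ->
  (forall z, cmod z < 1 -> cmod (g z) <= M) ->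
  0 <= r < 1 -> 0 < e ->
  exists p : {poly R[i]}, forall z, cmod z <= r -> cmod (g z - p.[z]) <= e.
Proof.
move=> ag gM /andP[r0 r1] e0.
pose rho := (r + 1) / 2.
have rho1 : rho < 1 by rewrite /rho; lra.
have rrho : r < rho by rewrite /rho; lra.
have rho0 : 0 < rho by exact: le_lt_trans rrho.
have M0 : 0 <= M by apply: le_trans (gM 0 _); rewrite ?cmod_ge0 ?cmod0.
pose K0 := rho / (rho - r).
have K00 : 0 <= K0 by rewrite divr_ge0 ?subr_ge0 // ltW.
pose q := r / rho.
have q01 : 0 <= q < 1 by rewrite divr_ge0 ?(ltW rho0) // ltr_pdivrMr // mul1r.
(* Two remainders occur, one for g and one for the constant 1 multiplied by g(w); each costs 2 M K0
   q^N once 2 pi is divided out. *)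
have [N0 hN] := @expr_small q (4 * (M * K0)) e q01 (mulr_ge0 (ler0n _ 4) (mulr_ge0 M0 K00)) e0.
(* N is positive so that the term j = 0, the one that carries 2 pi, can be split off. *)
pose N := N0.+1; have {}hN := hN N (leqnSn N0).
pose zeta t : R[i] := rho%:C * cis t.
have z0 t : zeta t != 0 := circle_neq0 rho0 t.
have cz : ccont zeta := ccontM (@ccont_cst _ rho%:C) (@ccont_cis R).
have czV : ccont (fun t => (zeta t)^-1) := ccontV z0 cz.
have mz t : cmod (zeta t) = rho := cmod_circle rho0 t.
have cg : ccont (fun t => g (zeta t)).
  apply: (ccont_comp cz) => t.
  by have [D /cderiv_continuous] := ag (zeta t) ltac:(by rewrite mz).
pose c j : R[i] := cint (fun t => g (zeta t) * (zeta t)^-1 ^+ j).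
exists (\poly_(j < N) (c j / (2 * pi)%:C)) => w wr.
have wrho : cmod w < rho by exact: le_lt_trans rrho.
have cK := ccont_cauchy_kernel wrho.
pose K := cauchy_kernel rho w.
have zw t : zeta t - w != 0.
  by rewrite subr_eq0; apply: contraTneq wrho => <-; rewrite mz ltxx.
pose u t := w * (zeta t)^-1.
have cu : ccont u := ccontM (@ccont_cst _ w) czV.
have KE n t : K t = \sum_(j < n) u t ^+ j + u t ^+ n * K t.
  have K1 : K t = 1 + u t * K t.
    by rewrite /u /K /cauchy_kernel -/(zeta t); field; rewrite zw z0.
  elim: n => [|n IH]; first by rewrite big_ord0 expr0 mul1r add0r.
  by rewrite {1}IH {1}K1 big_ord_recr /= exprSr; ring.
have cuX j : ccont (fun t => u t ^+ j) := @ccontX _ u j cu.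
have cS (f : R -> R[i]) : ccont f ->
    cint (fun t => f t * K t) = \sum_(j < N) cint (fun t => f t * u t ^+ j) +
      cint (fun t => f t * (u t ^+ N * K t)).
  move=> cf; have [s1 s2] := cint_sum (fun j : 'I_N => ccontM cf (cuX j)).
  rewrite -s2 -(cintD s1 (ccontM cf (ccontM (cuX N) cK))).
  by congr cint; apply/funext => t; rewrite {1}(KE N) mulrDr mulr_sumr.
have c1 : ccont (fun=> 1 : R[i]) := @ccont_cst _ 1.
have E1 : cint K = (2 * pi)%:C + cint (fun t => u t ^+ N * K t).
  have := cS _ c1.
  have -> : (fun t => 1 * K t) = K by apply/funext => t; rewrite mul1r.
  have -> : (fun t => 1 * (u t ^+ N * K t)) = (fun t => u t ^+ N * K t).
    by apply/funext => t; rewrite mul1r.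
  move=> ->; congr (_ + _); rewrite big_ord_recl big1 ?addr0.
    rewrite (_ : (fun t => _) = (fun=> 1)); first by rewrite cint_cst mul1r.
    by apply/funext => t; rewrite expr0 mulr1.
  move=> j _; have := @cint_circleVX rho rho0 rho1 (lift ord0 j) isT.
  move=> /(congr1 (fun x => w ^+ lift ord0 j * x)); rewrite mulr0.
  rewrite -(cintZ _ (@ccontX _ _ (lift ord0 j) czV)).
  by move=> <-; congr cint; apply/funext => t; rewrite mul1r /u exprMn.
have E2 : cint (fun t => g (zeta t) * K t) =
    \sum_(j < N) c j * w ^+ j + cint (fun t => g (zeta t) * (u t ^+ N * K t)).
  rewrite (cS _ cg); congr (_ + _); apply: eq_bigr => j _.
  rewrite /c mulrC -(cintZ _ (ccontM cg (@ccontX _ _ j czV))).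
  by congr cint; apply/funext => t; rewrite /u exprMn; ring.
(* With both expansions inserted, Cauchy's formula reads S + d1 = g(w) (2 pi + d2): the value 2 pi
   of the leading term and the Taylor polynomial come out together. *)
have E3 := cauchy_formula ag rho1 wrho; rewrite -/zeta -/K E1 E2 in E3.
have p0 : 0 < 2 * pi :> R by rewrite mulr_gt0 // pi_gt0.
have p0' : (2 * pi)%:C != 0 :> R[i] by rewrite -cmod_eq0 cmod_real normr_eq0 gt_eqF.
rewrite horner_poly.
have -> : \sum_(i < N) c i / (2 * pi)%:C * w ^+ i = (\sum_(j < N) c j * w ^+ j) / (2 * pi)%:C.
  by rewrite mulr_suml; apply: eq_bigr => j _; rewrite mulrAC.
set S := \sum_(j < N) _ in E3 *; set d1 := cint _ in E3; set d2 := cint _ in E3.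
have -> : g w - S / (2 * pi)%:C = (d1 - g w * d2) / (2 * pi)%:C.
  apply: (mulIf p0'); rewrite mulrBl !divfK //.
  by move: E3; rewrite mulrDr => E3; apply/eqP; rewrite subr_eq addrAC eq_sym subr_eq addrC E3.
have ub t : cmod (u t ^+ N * K t) <= q ^+ N * K0.
  rewrite cmodM cmodX; apply: ler_pM; rewrite ?exprn_ge0 ?cmod_ge0 //.
    rewrite ler_pXn2r ?nnegrE ?cmod_ge0 //; last by case/andP: q01.
    by rewrite cmodM cmodV mz ler_wpM2r ?invr_ge0 ?(ltW rho0).
  apply: (le_trans (cauchy_kernel_bound wrho t)).
  by rewrite ler_pM2l // lef_pV2 ?posrE ?subr_gt0 // lerB.
have d1b : cmod d1 <= 2 * (M * (q ^+ N * K0) * (2 * pi)).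
  apply: cint_bound => [|t _]; first exact: (ccontM cg (ccontM (cuX N) cK)).
  by rewrite cmodM; apply: ler_pM; rewrite ?cmod_ge0 ?ub // gM // mz.
have d2b : cmod d2 <= 2 * (q ^+ N * K0 * (2 * pi)).
  by apply: cint_bound => [|t _]; [exact: (ccontM (cuX N) cK)|exact: ub].
rewrite cmodM cmodV cmod_real gtr0_norm // ler_pdivrMr //.
apply: (le_trans (cmodB _ _)); rewrite cmodM.
have gwM : cmod (g w) <= M by apply: gM; exact: lt_trans rho1.
have : cmod (g w) * cmod d2 <= M * (2 * (q ^+ N * K0 * (2 * pi))).
  by apply: ler_pM; rewrite ?cmod_ge0.
move=> d2b'; apply: (le_trans (lerD d1b d2b')).
have -> : 2 * (M * (q ^+ N * K0) * (2 * pi)) + M * (2 * (q ^+ N * K0 * (2 * pi))) =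
  4 * (M * K0) * q ^+ N * (2 * pi) by ring.
by rewrite ler_pM2r.
Qed.

End PolynomialApproximation.

(** * The weighted area measure *)

Lemma pushforward_measureP d1 d2 (T1 : measurableType d1) (T2 : measurableType d2)
    (R : realType) (m : {measure set T1 -> \bar R}) (f : T1 -> T2) :
  measurable_fun setT f ->
  exists m' : {measure set T2 -> \bar R}, forall A, m' A = m (f @^-1` A).
Proof. by move=> mf; unshelve eexists (pushforward m f : {measure set T2 -> \bar R}). Qed.

HB.instance Definition _ (R : realType) := Measure.on (@area R).

Section PlaneMeasure.
Context {R : realType}.
Notation mu := (@lebesgue_measure R).
Implicit Types (S : set (R * R)).

(** The sigma-algebra of the plane is the product one, so an open set is written as the countable
    union of the rational boxes it contains. *)
Lemma open_plane_measurable S : open S -> measurable S.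
Proof.
move=> oS.
pose I := (rat * rat * (rat * rat))%type.
pose B (q : I) : set (R * R) :=
  `]ratr q.1.1, ratr q.1.2[%classic `*` `]ratr q.2.1, ratr q.2.2[%classic.
have mB q : measurable (B q) by apply: measurableX; exact: measurable_itv.
pose F (q : I) := if `[< B q `<=` S >] then B q else set0.
have -> : S = \bigcup_q F q.
  apply/seteqP; split => [p Sp|p [q _]]; last by rewrite /F; case: asboolP => // h /h.
  have /nbhs_ballP[e /= e0 he] : nbhs p S by exact: open_nbhs_nbhs.
  have between (x : R) : exists q : rat * rat, x \in `]ratr q.1, ratr q.2[%R /\
      forall y, y \in `]ratr q.1, ratr q.2[%R -> `|x - y| < e.
    have [q1] := @rat_in_itvoo R (x - e) x ltac:(lra).
    have [q2] := @rat_in_itvoo R x (x + e) ltac:(lra).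
    rewrite !in_itv /= => /andP[h1 h2] /andP[h3 h4]; exists (q1, q2).
    rewrite in_itv /= h1 h4; split=> // y; rewrite in_itv /= => /andP[h5 h6].
    by rewrite ltr_norml; apply/andP; split; lra.
  have [q1 [q1p h1]] := between p.1; have [q2 [q2p h2]] := between p.2.
  exists (q1, q2) => //; rewrite /F; case: asboolP; first by move=> _; split.
  by case; move=> y [/= y1 y2]; apply: he; split; [exact: h1|exact: h2].
apply: countable_bigcupT_measurable => [|q]; first exact: countableP.
by rewrite /F; case: asboolP.
Qed.

Lemma continuous_on_open_measurable S (u : R * R -> R) : open S ->
  (forall p, S p -> {for p, continuous u}) -> measurable_fun S u.
Proof.
move=> oS cu; apply: (measurability _ (RGenOInfty.measurableE R)).
move=> _ [_ [a ->] <-]; apply: open_plane_measurable.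
rewrite openE => p [Sp /=]; rewrite in_itv /= andbT => au.
have := cu p Sp; move=> /(@cvgr_gt _ _ _ _ _ _) /(_ _ au) h.
have Sn : nbhs p S by exact: open_nbhs_nbhs.
by apply: filterS2 Sn h => q Sq uq; split => //=; rewrite in_itv /= uq.
Qed.

Lemma continuous_sqnorm : continuous (fun p : R * R => p.1 ^+ 2 + p.2 ^+ 2).
Proof.
move=> p; rewrite (_ : (fun _ => _) = fun p : R * R => p.1 * p.1 + p.2 * p.2); last first.
  by apply/funext => q; rewrite !expr2.
apply: (@cvgD _ R); apply: (@cvgM R); by [exact: cvg_fst|exact: cvg_snd].
Qed.

(** The parameter is the square of the radius, which compares directly with the 1 - |z|^2 of the
    weight and makes the area linear in [c]. *)
Definition ballR2 (c : R) : set (R * R) := [set p | p.1 ^+ 2 + p.2 ^+ 2 < c].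

Lemma open_ballR2 c : open (ballR2 c).
Proof.
rewrite (_ : ballR2 c = (fun p : R * R => p.1 ^+ 2 + p.2 ^+ 2) @^-1` [set x | x < c]) //.
by apply: open_comp; [move=> p _; exact: continuous_sqnorm|exact: open_lt].
Qed.

Lemma measurable_ballR2 c : measurable (ballR2 c).
Proof. by apply: open_plane_measurable; exact: open_ballR2. Qed.

Lemma measurable_discR2 : measurable (@discR2 R).
Proof. exact: measurable_ballR2. Qed.

Lemma lebesgue_measure_dilate (r : R) (A : set R) : 0 < r -> measurable A ->
  (r%:E * mu ((fun x => x * r)%R @^-1` A))%E = mu A.
Proof.
move=> r0 mA.
have [m mE] := @pushforward_measureP _ _ (measurableTypeR R) (measurableTypeR R) R mu
  (fun x => x * r) ltac:(exact: measurable_funM).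
rewrite -mE -[LHS]/(mscale (NngNum (ltW r0)) m A).
apply/esym/lebesgue_measure_unique => //= _ [[a b]] _ <-; rewrite /mscale /= mE.
have -> : (fun x => x * r) @^-1` `]a, b] = `]a / r, b / r]%classic.
  by apply/seteqP; split => x /=; rewrite !in_itv /= ltr_pdivrMr // ler_pdivlMr.
have e : mu (`](a / r)%R, (b / r)%R]%classic) = (if (a / r < b / r)%R then (b / r - a / r)%R%:E else 0)%E.
  by rewrite lebesgue_measure_itv /= lte_fin.
apply: etrans (congr1 (fun z => r%:E * z)%E (esym e)).
rewrite lebesgue_measure_itv /= lte_fin ltr_pM2r ?invr_gt0 //.
case: ifP => // _; last by rewrite mule0.
by rewrite -EFinB -EFinM; congr (_%:E); rewrite -mulrBl mulrC divfK ?gt_eqF.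
Qed.

Lemma area_rect (A B : set R) : measurable A -> measurable B ->
  area (A `*` B) = (mu A * mu B)%E.
Proof. by move=> mA mB; exact: product_measure1E. Qed.

(** The scaled pushforward is a measure that agrees with the area on rectangles, one factor r for
    each coordinate; uniqueness of the product measure does the rest. *)
Lemma area_dilate (r : R) S : 0 < r -> measurable S ->
  ((r ^+ 2)%:E * area ((fun p : R * R => (p.1 * r, p.2 * r)%R) @^-1` S))%E = area S.
Proof.
move=> r0 mS; pose h (p : R * R) := (p.1 * r, p.2 * r).
have mh : measurable_fun setT h.
  by apply: measurable_fun_pair; apply: measurable_funM.
have r20 : 0 <= r ^+ 2 by exact: sqr_ge0.
pose T : measurableType _ := (measurableTypeR R * measurableTypeR R)%type.
have [m mE] := @pushforward_measureP _ _ T T R (@area R) h mh.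
rewrite -(mE S) -[LHS]/(mscale (NngNum r20) m S).
apply/esym; apply: (@product_measure_unique _ _ _ _ _ mu mu (mscale (NngNum r20) m)) => //= A B mA mB; rewrite /mscale /= mE.
have -> : h @^-1` (A `*` B) = ((fun x => x * r) @^-1` A) `*` ((fun x => x * r) @^-1` B) by [].
have mr U : measurable U -> measurable ((fun x : R => x * r) @^-1` U).
  move=> mU; have : measurable_fun setT (fun x : R => x * r) by exact: measurable_funM.
  by move=> /(_ measurableT U mU); rewrite setTI.
rewrite (_ : (_ * _)%E = ((r ^+ 2)%:E * (mu ((fun x => x * r)%R @^-1` A) * mu ((fun x => x * r)%R @^-1` B)))%E); last first.
  by congr (_ * _)%E; apply: area_rect; exact: mr.
rewrite -(lebesgue_measure_dilate r0 mA) -(lebesgue_measure_dilate r0 mB).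
by rewrite expr2 EFinM -!muleA; congr (_ * _)%E; rewrite muleCA.
Qed.

Lemma area_ballR2 (c : R) : 0 < c -> area (ballR2 c) = (c%:E * area (ballR2 1))%E.
Proof.
move=> c0; have s0 : 0 < Num.sqrt c by rewrite sqrtr_gt0.
rewrite -(area_dilate s0 (measurable_ballR2 c)) sqr_sqrtr ?ltW //.
congr (_ * area _)%E; apply/seteqP; split => p /=; rewrite /ballR2 /= !exprMn -mulrDl sqr_sqrtr ?ltW //;
  by rewrite -ltr_pdivlMr // divff ?gt_eqF.
Qed.

Lemma area_disc_lty : (area (ballR2 1) < +oo)%E.
Proof.
pose J : set R := `[-1, 1]%classic.
have mJ : measurable J by exact: measurable_itv.
have le : ballR2 1 `<=` J `*` J.
  move=> [x y]; rewrite /ballR2 /J /= => h; have := sqr_ge0 x; have := sqr_ge0 y => hy hx.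
  by rewrite !in_itv /=; split; rewrite -ler_norml -(@ler_pXn2r _ 2) ?nnegrE ?normr_ge0 // real_normK ?num_real // expr1n; lra.
apply: (@le_lt_trans _ _ (area (J `*` J))).
  by apply: le_measure => //; rewrite inE; [exact: measurable_ballR2|exact: measurableX].
rewrite area_rect // lebesgue_measure_itv /= lte_fin.
by case: ifP => _; rewrite ?mul0e // -EFinB -EFinM ltry.
Qed.

End PlaneMeasure.

(** * Integrability of the weight up to the boundary *)

Section WeightIntegrability.
Context {R : realType}.
Variable alpha : R.
Hypothesis alphaN1 : -1 < alpha.

Let u (p : R * R) : R := (1 - (p.1 ^+ 2 + p.2 ^+ 2)) `^ alpha.

Lemma measurable_boundary_power : measurable_fun setT u.
Proof.
apply: (measurableT_comp (measurable_powR alpha)); apply: measurable_funB => //.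
by apply: measurable_funD; apply: measurable_funX.
Qed.

Lemma measurable_weight : measurable_fun setT (weight alpha).
Proof. by apply: measurable_funM => //; exact: measurable_boundary_power. Qed.

Let mu_ (S : set (R * R)) : measurable_fun S (EFin \o u).
Proof. by apply/measurable_EFinP; apply: measurable_funTS; exact: measurable_boundary_power. Qed.

Lemma weight_cst_gt0 : 0 < (alpha + 1) / pi.
Proof. by rewrite divr_gt0 ?pi_gt0 // -ltrBlDr sub0r. Qed.

Lemma weight_ge0 p : 0 <= weight alpha p.
Proof. by rewrite mulr_ge0 ?powR_ge0 // ltW // weight_cst_gt0. Qed.

Lemma weight_gt0 p : discR2 p -> 0 < weight alpha p.
Proof. by move=> h; rewrite mulr_gt0 ?weight_cst_gt0 // powR_gt0 // subr_gt0. Qed.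

Let d : R := fine (area (@ballR2 R 1)).
Let dE : area (@ballR2 R 1) = d%:E.
Proof. by rewrite fineK // ge0_fin_numE ?measure_ge0 //; exact: area_disc_lty. Qed.
Let d0 : 0 <= d. Proof. by rewrite fine_ge0 // measure_ge0. Qed.

Let h k : R := 2^-1 ^+ k.
Let h0 k : 0 < h k. Proof. by rewrite exprn_gt0. Qed.
Let hS k : h k = h k.+1 + h k.+1. Proof. by rewrite /h exprS; field. Qed.
(** A dyadic exhaustion of the disc in the variable |z|^2: on the k-th shell 1 - |z|^2 lies between
    2^-(k+1) and 2^-k. *)
Let B k : set (R * R) := ballR2 (1 - h k).

Let area_B k : area (B k) = ((1 - h k) * d)%:E.
Proof.
have [k0|k0] := leqP k 0.
  move: k0; rewrite leqn0 => /eqP ->; rewrite /h expr0 subrr mul0r.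
  rewrite (_ : B 0 = set0) ?measure0 //; apply/seteqP; split => // p.
  by rewrite /B /ballR2 /h expr0 subrr /= ltNge addr_ge0 // sqr_ge0.
have h1 : h k < 1 by rewrite exprn_ilt1 // ?invf_lt1 ?ltr1n // -lt0n.
by rewrite area_ballR2 ?subr_gt0 // dE -EFinM.
Qed.

Let subB i j : (i <= j)%N -> B i `<=` B j.
Proof.
move=> ij p; rewrite /B /ballR2 /= => hp; apply: (lt_le_trans hp).
by rewrite lerB // /h ler_wiXn2l ?invr_ge0 // invf_le1 // ler1n.
Qed.

Let area_shell k : (area (B k.+1 `\` B k) <= (h k.+1 * d)%:E)%E.
Proof.
rewrite measureD; [|exact: measurable_ballR2|exact: measurable_ballR2|]; last first.
  by rewrite [X in (X < _)%E](area_B k.+1) ltry.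
rewrite setIidr; last exact: subB.
rewrite [X in (X - _)%E](area_B k.+1) [X in (_ - X)%E](area_B k) -EFinB lee_fin.
by rewrite (hS k); lra.
Qed.

Let bigcupB : \bigcup_k B k = ballR2 1.
Proof.
apply/seteqP; split => [p [k _]|p]; rewrite /B /ballR2 /= => hp.
  by apply: (lt_trans hp); rewrite ltrBlDr ltrDl.
have e0 : 0 < (1 - (p.1 ^+ 2 + p.2 ^+ 2)) / 2 by rewrite divr_gt0 // subr_gt0.
have q01 : 0 <= (2^-1 : R) < 1 by rewrite invr_ge0 ler0n invf_lt1 // ltr1n.
have [N hN] := @expr_small R _ 1 _ q01 ler01 e0.
by exists N => //=; have := hN N (leqnn N); rewrite mul1r -/(h N); lra.
Qed.

(* Only -1 < alpha < 0 needs care: on the k-th dyadic shell u is at most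
   2^(-(k+1) alpha) and the area is O(2^-(k+1)), so the shells sum geometrically. *)
Let shell_le k : alpha < 0 ->
  (\int[@area R]_(p in B k.+1 `\` B k) (u p)%:E <= (d * (2^-1 `^ (alpha + 1)) ^+ k.+1)%:E)%E.
Proof.
move=> a0.
have mS : measurable (B k.+1 `\` B k) by apply: measurableD; exact: measurable_ballR2.
have v0 : 0 <= h k.+1 `^ alpha by exact: powR_ge0.
apply: (@le_trans _ _ (\int[@area R]_(p in B k.+1 `\` B k) (h k.+1 `^ alpha)%:E)%E).
  apply: ge0_le_integral => //.
  - by move=> p _; rewrite lee_fin powR_ge0.
  - exact: mu_.
  - move=> p [hp _]; rewrite lee_fin /u -[alpha]opprK !(powRN _ (- alpha)).
    have hh : h k.+1 <= 1 - (p.1 ^+ 2 + p.2 ^+ 2) by move: hp; rewrite /B /ballR2 /=; lra.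
    have p0 := lt_le_trans (h0 k.+1) hh.
    rewrite lef_pV2 ?posrE ?powR_gt0 //.
    apply: ge0_ler_powR => //; [by rewrite oppr_ge0 ltW| |];
      by rewrite nnegrE ltW.
rewrite integral_cst //; apply: (le_trans (lee_wpmul2l _ (area_shell k))); first by rewrite lee_fin.
have -> : (2^-1 `^ (alpha + 1)) ^+ k.+1 = h k.+1 `^ alpha * h k.+1.
  have nz : (alpha + 1 == 0) ==> (h k.+1 != 0) by rewrite (gt_eqF (h0 _)) implybT.
  rewrite -[X in _ * X](powRr1 (ltW (h0 k.+1))) -(powRD nz).
  have i0 : 0 <= 2^-1 :> R by rewrite invr_ge0.
  rewrite -(powR_mulrn k.+1 (powR_ge0 _ _)) /h -(powR_mulrn k.+1 i0).
  by rewrite -!powRrM mulrC.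
by rewrite lee_fin; rewrite le_eqVlt; apply/orP; left; apply/eqP; ring.
Qed.

Let int_u_lty : (\int[@area R]_(p in ballR2 1) (u p)%:E < +oo)%E.
Proof.
have [a0|a0] := leP 0 alpha.
  apply: (@le_lt_trans _ _ (\int[@area R]_(p in ballR2 1) (1 : R)%:E)%E).
    apply: ge0_le_integral => //; first exact: measurable_ballR2.
    - by move=> p _; rewrite lee_fin powR_ge0.
    - exact: mu_.
    - move=> p; rewrite /ballR2 /= => hp; rewrite lee_fin /u.
      apply: (@le_trans _ _ (1 `^ alpha)); last by rewrite powR1.
      have s0 : 0 <= p.1 ^+ 2 + p.2 ^+ 2 by rewrite addr_ge0 // sqr_ge0.
      by apply: ge0_ler_powR; rewrite ?nnegrE //; lra.
  by rewrite integral_cst ?mul1e; [exact: area_disc_lty|exact: measurable_ballR2].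
have ndB : nondecreasing_seq B by move=> i j ij; apply/subsetPset; exact: subB.
have mB k : measurable (seqD B k).
  by case: k => [|k] /=; [|apply: measurableD]; exact: measurable_ballR2.
rewrite -bigcupB -eq_bigcup_seqD ge0_integral_bigcup //.
(* The common ratio of the shell estimates; q < 1 is exactly the condition alpha > -1. *)
- pose q := 2^-1 `^ (alpha + 1) : R.
  have q0 : 0 < q by rewrite powR_gt0 // invr_gt0.
  have q1 : q < 1.
    apply: (@lt_le_trans _ _ (1 `^ (alpha + 1))); last by rewrite powR1.
    by apply: gt0_ltr_powR; rewrite ?nnegrE ?invr_ge0 ?invf_lt1 ?ltr1n // -ltrBlDr sub0r.
  apply: (@le_lt_trans _ _ (d / (1 - q))%:E); last exact: ltry.
  apply: lime_le.
    apply: is_cvg_nneseries => k _ _; apply: integral_ge0 => p _.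
    by rewrite lee_fin powR_ge0.
  apply: nearW => n.
  apply: (@le_trans _ _ (\sum_(0 <= i < n) (d * q ^+ i)%:E)%E).
    apply: lee_sum => -[|k] _; last exact: shell_le.
    rewrite expr0 mulr1 /= (_ : B 0 = set0) ?integral_set0 ?lee_fin //.
    apply/seteqP; split => // p.
    by rewrite /B /ballR2 /h expr0 subrr /= ltNge addr_ge0 // sqr_ge0.
  have qn : `|q| < 1 by rewrite gtr0_norm.
  have := geometric_le_lim n d0 q0 qn.
  by rewrite sumEFin lee_fin.
- exact: mu_.
- by move=> p _; rewrite lee_fin powR_ge0.
- exact: trivIset_seqD.
Qed.

Theorem weight_integrable : (@area R).-integrable (@discR2 R) (EFin \o weight alpha).
Proof.
have -> : EFin \o weight alpha = (fun p => ((alpha + 1) / pi)%:E * (u p)%:E)%E.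
  by apply/funext => p; rewrite /= -EFinM.
apply: integrableZl; first exact: measurable_discR2.
apply/integrableP; split; first exact: mu_.
under eq_integral do rewrite gee0_abs ?lee_fin ?powR_ge0 //.
exact: int_u_lty.
Qed.

End WeightIntegrability.

(** * Real integrals against the weighted area *)

Section WeightedIntegral.
Context {R : realType}.
Notation C := (R[i]^o).
Variable alpha : R.
Hypothesis alphaN1 : -1 < alpha.
Implicit Types (u v : R[i] -> R) (h k : R[i] -> R[i]) (z w : R[i]).

Definition wint u : R := Rintegral (@area R) (@discR2 R) (fun p => u (toC p) * weight alpha p).
Definition wintegrable u :=
  (@area R).-integrable (@discR2 R) (fun p => (u (toC p) * weight alpha p)%:E).

Let T : measurableType _ := (measurableTypeR R * measurableTypeR R)%type.
Let mD : measurable (@discR2 R : set T) := @measurable_discR2 R.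

Lemma cmod_toC (p : R * R) : (cmod (toC p) < 1) = (p.1 ^+ 2 + p.2 ^+ 2 < 1).
Proof. by rewrite -mem_disc; apply/idP/idP; rewrite inE. Qed.

Lemma discR2P (p : R * R) : discR2 p <-> cmod (toC p) < 1.
Proof. by rewrite cmod_toC. Qed.

Lemma eq_wint u v : (forall z, cmod z < 1 -> u z = v z) -> wint u = wint v.
Proof. by move=> uv; apply: eq_Rintegral => p; rewrite inE => /discR2P/uv ->. Qed.

Lemma eq_wintegrable u v : (forall z, cmod z < 1 -> u z = v z) -> wintegrable u -> wintegrable v.
Proof.
move=> uv; apply: eq_integrable => // p; rewrite inE => /discR2P/uv -> //.
Qed.

Lemma wintegrableD u v : wintegrable u -> wintegrable v -> wintegrable (fun z => u z + v z).
Proof.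
move=> iu iv; have := integrableD mD iu iv; apply: eq_integrable => // p _.
by rewrite /= mulrDl EFinD.
Qed.

Lemma wintegrableZ a u : wintegrable u -> wintegrable (fun z => a * u z).
Proof.
move=> iu; have := integrableZl mD a iu; apply: eq_integrable => // p _.
by rewrite /= -mulrA EFinM.
Qed.

Lemma wintD u v : wintegrable u -> wintegrable v -> wint (fun z => u z + v z) = wint u + wint v.
Proof.
move=> iu iv; rewrite -[RHS](RintegralD mD iu iv).
by apply: eq_Rintegral => p _; rewrite mulrDl.
Qed.

Lemma wintZ a u : wintegrable u -> wint (fun z => a * u z) = a * wint u.
Proof.
move=> iu; rewrite -[RHS](@RintegralZl _ _ _ _ _ _ a mD iu).
by apply: eq_Rintegral => p _; rewrite mulrA.
Qed.

Lemma le_wint u v : wintegrable u -> wintegrable v ->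
  (forall z, cmod z < 1 -> u z <= v z) -> wint u <= wint v.
Proof.
move=> iu iv uv; apply: (le_Rintegral mD iu iv) => p /discR2P hp.
by apply: ler_wpM2r; [exact: weight_ge0|exact: uv].
Qed.

Lemma wint_ge0 u : (forall z, cmod z < 1 -> 0 <= u z) -> 0 <= wint u.
Proof.
move=> u0; apply: Rintegral_ge0 => p /discR2P hp.
by apply: mulr_ge0; [exact: u0|exact: weight_ge0].
Qed.

Lemma le_norm_wint u v : wintegrable u -> wintegrable v ->
  (forall z, cmod z < 1 -> `|u z| <= v z) -> `|wint u| <= wint v.
Proof.
move=> iu iv uv; rewrite ler_norml; apply/andP; split; last first.
  by apply: le_wint => // z z1; apply: le_trans (uv z z1); exact: ler_norm.
have -> : - wint v = wint (fun z => -1 * v z) by rewrite wintZ // mulN1r.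
apply: le_wint => //; first exact: wintegrableZ.
by move=> z /uv; rewrite ler_norml mulN1r => /andP[].
Qed.

Definition disc_continuous h := forall z, cmod z < 1 -> {for z, continuous (h : C -> C)}.

Definition disc_measurable u := measurable_fun (@discR2 R) (fun p : R * R => u (toC p)).

Lemma continuous_toC (p : R * R) : {for p, continuous (@toC R : R * R -> C)}.
Proof.
have E : (@toC R : R * R -> C) = fun q => (q.1)%:C + 'i%C * (q.2)%:C.
  by apply/funext => q; apply: complex_inj; rewrite /=; ring.
have c1 : {for p, continuous (fun q : R * R => (q.1)%:C : C)}.
  by apply: tcontinuous_real; exact: cvg_fst.
have c2 : {for p, continuous (fun q : R * R => (q.2)%:C : C)}.
  by apply: tcontinuous_real; exact: cvg_snd.
rewrite E; exact: (tcontinuousD c1 (tcontinuousM (@tcontinuous_cst R _ 'i%C p) c2)).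
Qed.

Lemma disc_measurable_Re h : disc_continuous h -> disc_measurable (fun z => Re (h z)).
Proof.
move=> ch; apply: continuous_on_open_measurable; first exact: open_ballR2.
move=> p /discR2P hp; apply: (@tcontinuous_Re R _ (fun q : R * R => h (toC q) : C) p).
exact: (@continuous_comp _ _ _ (@toC R : R * R -> C) (h : C -> C) p (@continuous_toC p) (ch _ hp)).
Qed.

Lemma disc_measurable_Im h : disc_continuous h -> disc_measurable (fun z => Im (h z)).
Proof.
move=> ch; apply: continuous_on_open_measurable; first exact: open_ballR2.
move=> p /discR2P hp; apply: (@tcontinuous_Im R _ (fun q : R * R => h (toC q) : C) p).
exact: (@continuous_comp _ _ _ (@toC R : R * R -> C) (h : C -> C) p (@continuous_toC p) (ch _ hp)).
Qed.

Lemma le_wintegrable u v : disc_measurable u -> wintegrable v ->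
  (forall z, cmod z < 1 -> `|u z| <= v z) -> wintegrable u.
Proof.
move=> mu iv uv; apply: le_integrable iv => //.
  apply/measurable_EFinP; apply: measurable_funM; first exact: mu.
  by apply: measurable_funTS; exact: measurable_weight.
move=> p /discR2P hp; rewrite lee_fin !normrM ler_wpM2r ?normr_ge0 //.
by apply: (le_trans (uv _ hp)); exact: ler_norm.
Qed.

Lemma wintegrable_cst a : wintegrable (fun=> a).
Proof.
have := integrableZl mD a (weight_integrable alphaN1); apply: eq_integrable => // p _.
Qed.

Lemma wintegrable_bounded u M : disc_measurable u ->
  (forall z, cmod z < 1 -> `|u z| <= M) -> wintegrable u.
Proof. by move=> mu; apply: le_wintegrable (wintegrable_cst M). Qed.

Lemma wintegrable_sum n (F : 'I_n -> R[i] -> R) : (forall i, wintegrable (F i)) ->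
  wintegrable (fun z => \sum_(i < n) F i z) /\
  wint (fun z => \sum_(i < n) F i z) = \sum_(i < n) wint (F i).
Proof.
elim: n F => [|n IH] F iF.
  have e : (fun z : R[i] => \sum_(i < 0) F i z) = (fun=> 0 * 0).
    by apply/funext => z; rewrite big_ord0 mul0r.
  rewrite e big_ord0; split; first exact: wintegrable_cst.
  by rewrite wintZ ?mul0r //; exact: wintegrable_cst.
have e : (fun z => \sum_(i < n.+1) F i z) =
    (fun z => F ord0 z + \sum_(i < n) F (lift ord0 i) z).
  by apply/funext => z; rewrite big_ord_recl.
have [c1 c2] := IH (fun i => F (lift ord0 i)) (fun i => iF _).
rewrite e; split; first exact: (wintegrableD (iF ord0) c1).
by rewrite (wintD (iF ord0) c1) c2 big_ord_recl.
Qed.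

Lemma rotC (l : R[i]) (p : R * R) : toC (rot (Re l) (Im l) p) = l * toC p.
Proof. by apply: complex_inj; rewrite /= ?ReM ?ImM /=; case: l => a b /=; ring. Qed.

Lemma cmod_rot (l : R[i]) z : cmod l = 1 -> cmod (l * z) = cmod z.
Proof. by move=> l1; rewrite cmodM l1 mul1r. Qed.

(** Disc, weight and area are all invariant under rotation. The integrand is extended by zero to the
    plane, so that the change of variables is a pushforward on the whole space. *)
Lemma wint_rot l u : cmod l = 1 -> wintegrable u ->
  wintegrable (fun z => u (l * z)) /\ wint (fun z => u (l * z)) = wint u.
Proof.
move=> l1 iu.
have ab1 : Re l ^+ 2 + Im l ^+ 2 = 1 by rewrite -[LHS](sqr_cmod l) l1 expr1n.
pose rt : T -> T := rot (Re l) (Im l).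
have mr : measurable_fun [set: T] rt := measurable_rot _ _.
pose F : T -> \bar R := (fun p : R * R => (u (toC p) * weight alpha p)%:E) \_ (@discR2 R).
have mF : measurable_fun [set: T] F.
  by apply/(measurable_restrictT _ mD); exact: measurable_int iu.
have rD p : discR2 (rt p) <-> discR2 p.
  by rewrite !discR2P rotC cmod_rot.
have FE : F \o rt = (fun p : R * R => (u (l * toC p) * weight alpha p)%:E) \_ (@discR2 R).
  apply/funext => p; rewrite /F /= /patch.
  have -> : (rt p \in @discR2 R) = (p \in @discR2 R).
    by apply/idP/idP; rewrite !inE => /rD.
  case: ifP => // _; rewrite rotC; congr (_ * _)%:E; rewrite /weight; congr (_ * _ `^ _).
  have e (q : R * R) : q.1 ^+ 2 + q.2 ^+ 2 = cmod (toC q) ^+ 2 by rewrite sqr_cmod.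
  by rewrite !e rotC cmod_rot.
have iF : (@area R).-integrable setT F by exact: ((integrable_mkcond _ mD).1 iu).
pose m : {measure set T -> \bar R} := @area R.
have mE (A : set T) : measurable A -> A `<=` [set: T] -> pushforward m rt A = m A.
  by move=> mA _; exact: area_rot.
have iFr : m.-integrable [set: T] (F \o rt).
  apply/integrableP; split; first exact: measurableT_comp.
  have /integrableP[_] := iF; apply: le_lt_trans.
  have maF : measurable_fun [set: T] (abse \o F) by exact: measurableT_comp.
  have := @ge0_integral_pushforward _ _ T T R rt mr m setT (abse \o F) measurableT maF
    (fun _ _ => abse_ge0 _).
  rewrite preimage_setT => <-; rewrite le_eqVlt; apply/orP; left; apply/eqP.
  exact: eq_measure_integral.
split.
  by apply: ((integrable_mkcond _ mD).2); rewrite -FE.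
rewrite /wint /Rintegral; congr fine.
rewrite integral_mkcond [RHS]integral_mkcond -/F -FE.
have := @integral_pushforward _ _ T T R rt mr m setT F mF iFr measurableT.
rewrite preimage_setT => <-; exact: eq_measure_integral.
Qed.

(** The weight is strictly positive on the disc, so the vanishing of [u] times the weight passes to
    [u]. *)
Lemma wint_eq0_ae u : wintegrable u -> (forall z, cmod z < 1 -> 0 <= u z) -> wint u = 0 ->
  (@area R).-negligible [set p | discR2 p /\ u (toC p) != 0].
Proof.
move=> iu u0 wu.
have : (\int[@area R]_(p in @discR2 R) `|(u (toC p) * weight alpha p)%:E| = 0)%E.
  apply: (@etrans _ _ (\int[@area R]_(p in @discR2 R) (u (toC p) * weight alpha p)%:E)%E).
    apply: eq_integral.
    move=> p; rewrite inE => /discR2P hp; rewrite gee0_abs // lee_fin.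
    by apply: mulr_ge0; [exact: u0|exact: weight_ge0].
  move: wu; rewrite /wint /Rintegral => /eqP; rewrite fine_eq0; first by move/eqP.
  exact: integrable_fin_num.
move/(ae_eq_integral_abs (@area R) mD (measurable_int _ iu)).
apply: negligibleS => p [/= hp up] H; move: up; have [/=] := H hp.
move/eqP; rewrite mulf_eq0 (gt_eqF (weight_gt0 alphaN1 hp)) orbF => /eqP ->.
by rewrite eqxx.
Qed.

End WeightedIntegral.

(** * Complex integrals, orthogonality and moments of monomials *)

Section ComplexWeightedIntegral.
Context {R : realType}.
Notation C := (R[i]^o).
Variable alpha : R.
Hypothesis alphaN1 : -1 < alpha.
Implicit Types (u v : R[i] -> R) (h k : R[i] -> R[i]) (z w l : R[i]).

Notation wint := (wint alpha).
Notation wintegrable := (wintegrable alpha).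

Definition cwint h : R[i] := wint (fun z => Re (h z)) +i* wint (fun z => Im (h z)).
Definition cwintegrable h := wintegrable (fun z => Re (h z)) /\ wintegrable (fun z => Im (h z)).

Lemma innerE (F G : R[i] -> R[i]) : inner alpha F G = cwint (fun z => F z * (G z)^*%C).
Proof.
by rewrite /inner -complexiE; apply: complex_inj; rewrite /cwint /wint /=; ring.
Qed.

Lemma eq_cwint h k : (forall z, cmod z < 1 -> h z = k z) -> cwint h = cwint k.
Proof. by move=> hk; congr Complex; apply: eq_wint => z /hk ->. Qed.

Lemma eq_cwintegrable h k : (forall z, cmod z < 1 -> h z = k z) ->
  cwintegrable h -> cwintegrable k.
Proof.
move=> hk [i1 i2]; split.
  by apply: eq_wintegrable i1 => z /hk ->.
by apply: eq_wintegrable i2 => z /hk ->.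
Qed.

Lemma cwintegrableD h k : cwintegrable h -> cwintegrable k ->
  cwintegrable (fun z => h z + k z).
Proof.
move=> [h1 h2] [k1 k2]; split.
  by apply: eq_wintegrable (wintegrableD h1 k1) => z _; rewrite ReD.
by apply: eq_wintegrable (wintegrableD h2 k2) => z _; rewrite ImD.
Qed.

Lemma cwintD h k : cwintegrable h -> cwintegrable k ->
  cwint (fun z => h z + k z) = cwint h + cwint k.
Proof.
move=> [h1 h2] [k1 k2]; apply: complex_inj; rewrite ?ReD ?ImD /=.
  by rewrite -(wintD h1 k1); apply: eq_wint => z _; rewrite ReD.
by rewrite -(wintD h2 k2); apply: eq_wint => z _; rewrite ImD.
Qed.

Lemma cwintegrableZ (a : R[i]) h : cwintegrable h -> cwintegrable (fun z => a * h z).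
Proof.
move=> [h1 h2]; split.
  apply: eq_wintegrable (wintegrableD (wintegrableZ (Re a) h1) (wintegrableZ (- Im a) h2)) => z _.
  by rewrite ReM mulNr.
apply: eq_wintegrable (wintegrableD (wintegrableZ (Re a) h2) (wintegrableZ (Im a) h1)) => z _.
by rewrite ImM.
Qed.

Lemma cwintZ (a : R[i]) h : cwintegrable h -> cwint (fun z => a * h z) = a * cwint h.
Proof.
move=> [h1 h2]; apply: complex_inj; rewrite ?ReM ?ImM /=.
  transitivity (wint (fun z => Re a * Re (h z) + - Im a * Im (h z))).
    by apply: eq_wint => z _; rewrite ReM mulNr.
  by rewrite (wintD (wintegrableZ _ h1) (wintegrableZ _ h2)) !wintZ // mulNr.
transitivity (wint (fun z => Re a * Im (h z) + Im a * Re (h z))).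
  by apply: eq_wint => z _; rewrite ImM.
by rewrite (wintD (wintegrableZ _ h2) (wintegrableZ _ h1)) !wintZ.
Qed.

Lemma cwintegrable_sum n (F : 'I_n -> R[i] -> R[i]) : (forall i, cwintegrable (F i)) ->
  cwintegrable (fun z => \sum_(i < n) F i z) /\
  cwint (fun z => \sum_(i < n) F i z) = \sum_(i < n) cwint (F i).
Proof.
elim: n F => [|n IH] F iF.
  have i0 : cwintegrable (fun=> 0) by split; exact: wintegrable_cst.
  have e : (fun z : R[i] => \sum_(i < 0) F i z) = (fun=> 0 * 0).
    by apply/funext => z; rewrite big_ord0 mul0r.
  rewrite e big_ord0; split; first exact: (cwintegrableZ 0 i0).
  by rewrite (cwintZ 0 i0) mul0r.
have e : (fun z => \sum_(i < n.+1) F i z) =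
    (fun z => F ord0 z + \sum_(i < n) F (lift ord0 i) z).
  by apply/funext => z; rewrite big_ord_recl.
have [c1 c2] := IH (fun i => F (lift ord0 i)) (fun i => iF _).
rewrite e; split; first exact: (cwintegrableD (iF ord0) c1).
by rewrite (cwintD (iF ord0) c1) c2 big_ord_recl.
Qed.

Lemma cwint_real u : cwint (fun z => (u z)%:C) = (wint u)%:C.
Proof.
apply: complex_inj => //=.
have -> : (fun _ : R[i] => 0 : R) = (fun z => 0 * 0) by apply/funext => z; rewrite mul0r.
by rewrite wintZ ?mul0r //; exact: wintegrable_cst.
Qed.

Lemma cwint_rot l h : cmod l = 1 -> cwintegrable h ->
  cwintegrable (fun z => h (l * z)) /\ cwint (fun z => h (l * z)) = cwint h.
Proof.
move=> l1 [h1 h2]; have [i1 e1] := wint_rot l1 h1; have [i2 e2] := wint_rot l1 h2.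
by split; [split|apply: complex_inj].
Qed.

Lemma le_cwintegrable h v : disc_continuous h -> wintegrable v ->
  (forall z, cmod z < 1 -> cmod (h z) <= v z) -> cwintegrable h.
Proof.
move=> ch iv hv; split.
  apply: (le_wintegrable (disc_measurable_Re ch) iv) => z /hv.
  by apply: le_trans; exact: normr_Re_le.
apply: (le_wintegrable (disc_measurable_Im ch) iv) => z /hv.
by apply: le_trans; exact: normr_Im_le.
Qed.

Lemma cwintegrable_bounded h M : disc_continuous h ->
  (forall z, cmod z < 1 -> cmod (h z) <= M) -> cwintegrable h.
Proof. by move=> ch; apply: le_cwintegrable => //; exact: wintegrable_cst. Qed.

Lemma cmod_cwint_le h v : cwintegrable h -> wintegrable v ->
  (forall z, cmod z < 1 -> cmod (h z) <= v z) -> cmod (cwint h) <= 2 * wint v.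
Proof.
move=> [h1 h2] iv hv; apply: (le_trans (cmod_le_ReIm _)) => /=.
rewrite mulr_natl mulr2n; apply: lerD; apply: le_norm_wint => // z /hv; apply: le_trans.
  exact: normr_Re_le.
exact: normr_Im_le.
Qed.

Lemma disc_continuous_cst (a : R[i]) : disc_continuous (fun=> a).
Proof. by move=> z _; exact: (@ccontinuous_cst R a z). Qed.

Lemma disc_continuousD h k : disc_continuous h -> disc_continuous k ->
  disc_continuous (fun z => h z + k z).
Proof. by move=> ch ck z z1; exact: (@ccontinuousD R h k z (ch z z1) (ck z z1)). Qed.

Lemma disc_continuousM h k : disc_continuous h -> disc_continuous k ->
  disc_continuous (fun z => h z * k z).
Proof. by move=> ch ck z z1; exact: (@ccontinuousM R h k z (ch z z1) (ck z z1)). Qed.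

Lemma disc_continuousJ h : disc_continuous h -> disc_continuous (fun z => (h z)^*%C).
Proof.
move=> ch z z1; apply/ccontinuousP => e e0; have /ccontinuousP/(_ e e0)[r r0 hr] := ch z z1.
by exists r => // w /hr; rewrite -rmorphB cmodJ.
Qed.

Lemma disc_continuousX n : disc_continuous (fun z => z ^+ n).
Proof. by move=> z _; have [D /cderiv_continuous] := cderivX n z. Qed.

Lemma analytic_disc_continuous h : (forall z, cmod z < 1 -> exists D, cderiv h z D) ->
  disc_continuous h.
Proof. by move=> ah z /ah[D /cderiv_continuous]. Qed.

Lemma cisX t n : cis t ^+ n = cis (t *+ n) :> R[i].
Proof.
elim: n => [|n IH]; first by rewrite expr0 mulr0n cisE cos0 sin0.
rewrite exprS IH mulrS !cisE cosD sinD; apply: complex_inj; rewrite ?ReM ?ImM /=; ring.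
Qed.

Lemma cis_pi : cis pi = -1 :> R[i].
Proof. by rewrite cisE cospi sinpi; apply: complex_inj; rewrite /= ?oppr0. Qed.

(** With l = e^(i pi / (b - a)) one has l^(b - a) = -1, and the product equals -1. *)
Lemma unimodular_powers_neq (a b : nat) : (a < b)%N ->
  exists l : R[i], cmod l = 1 /\ l ^+ a * (l ^+ b)^*%C != 1.
Proof.
move=> ab; have ba0 : (0 < b - a)%N by rewrite subn_gt0.
exists (cis (pi / (b - a)%:R)); rewrite cmod_cis; split => //.
set l := cis _; have la : l ^+ (b - a) = -1.
  by rewrite cisX -(mulr_natr (pi / _)) divfK ?cis_pi // pnatr_eq0 -lt0n.
rewrite -(subnK (ltnW ab)) exprD la mulN1r (rmorphN (@conjc R)) mulrN mulcJ_cmod.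
rewrite cmodX cmod_cis !expr1n rmorph1 eq_sym -subr_eq0 opprK.
by rewrite -[1 + 1](natrD _ 1 1) pnatr_eq0.
Qed.

Lemma cmodX_le1 z n : cmod z < 1 -> cmod (z ^+ n) <= 1.
Proof. by move=> z1; rewrite cmodX exprn_ile1 ?cmod_ge0 // ltW. Qed.

Lemma cwintegrable_monomials (a b : nat) : cwintegrable (fun z => z ^+ a * (z ^+ b)^*%C).
Proof.
apply: (@cwintegrable_bounded _ 1).
  by apply: disc_continuousM (disc_continuousJ _); exact: disc_continuousX.
by move=> z z1; rewrite cmodM cmodJ mulr_ile1 ?cmod_ge0 ?cmodX_le1.
Qed.

(** A rotation by l leaves the integral unchanged and also multiplies it by l^a conj(l^b), which can
    be made different from 1. *)
Lemma cwint_monomials_neq (a b : nat) : a != b -> cwint (fun z => z ^+ a * (z ^+ b)^*%C) = 0.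
Proof.
have lt_case (c d : nat) l : cmod l = 1 -> l ^+ c * (l ^+ d)^*%C != 1 ->
    cwint (fun z => z ^+ c * (z ^+ d)^*%C) = 0.
  move=> l1 ln; have ih := cwintegrable_monomials c d.
  have [_ e] := cwint_rot l1 ih.
  have : (l ^+ c * (l ^+ d)^*%C - 1) * cwint (fun z => z ^+ c * (z ^+ d)^*%C) = 0.
    rewrite mulrBl mul1r -{2}e -(cwintZ _ ih); apply/eqP; rewrite subr_eq0; apply/eqP.
    by apply: eq_cwint => z _; rewrite !exprMn rmorphM /=; ring.
  by move/eqP; rewrite mulf_eq0 subr_eq0 (negbTE ln) => /eqP.
rewrite neq_ltn => /orP[] ab; have [l [l1 ln]] := unimodular_powers_neq ab.
  exact: lt_case ln.
apply: (lt_case _ _ l l1); apply: contraNneq ln => /(congr1 conjc).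
by rewrite (rmorph1 (@conjc R)) (rmorphM (@conjc R)) /= conjcK mulrC => ->.
Qed.

(** The squared norm of z^m. *)
Definition moment (m : nat) : R := wint (fun z => cmod z ^+ (2 * m)).

Lemma cwint_monomial_sqr m : cwint (fun z => z ^+ m * (z ^+ m)^*%C) = (moment m)%:C.
Proof.
rewrite -cwint_real; apply: eq_cwint => z _.
by rewrite mulcJ_cmod cmodX -exprM mulnC.
Qed.

Lemma wintegrable_cmodX m : wintegrable (fun z => cmod z ^+ (2 * m)).
Proof.
apply: eq_wintegrable (cwintegrable_monomials m m).1 => z _.
by rewrite mulcJ_cmod cmodX -exprM mulnC.
Qed.

Lemma area_disc_gt0 : (0 < area (@ballR2 R 1))%E.
Proof.
pose J : set R := `[0, 2^-1]%classic.
have mJ : measurable J by exact: measurable_itv.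
have i2 : 2^-1 < 1 :> R by rewrite invf_lt1 // ltr1n.
have le : J `*` J `<=` ballR2 1.
  move=> [x y]; rewrite /ballR2 /J /= !in_itv /= => -[/andP[x0 x1] /andP[y0 y1]].
  have := @ler_pM R x 2^-1 x 2^-1 x0 x0 x1 x1; have := @ler_pM R y 2^-1 y 2^-1 y0 y0 y1 y1.
  have : 2^-1 * 2^-1 = 4^-1 :> R by rewrite -invfM -natrM.
  by rewrite -!expr2 => ->; lra.
apply: (@lt_le_trans _ _ (area (J `*` J))); last first.
  by apply: le_measure => //; rewrite inE; [exact: measurableX|exact: measurable_ballR2].
have -> : area (J `*` J) = (2^-1 * 2^-1 : R)%:E.
  have lJ : lebesgue_measure J = (2^-1)%:E.
    by rewrite /J lebesgue_measure_itv /= lte_fin invr_gt0 ltr0n sube0.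
  by rewrite area_rect // lJ EFinM.
by rewrite lte_fin mulr_gt0 ?invr_gt0.
Qed.

Lemma area_shell_gt0 (s : R) : 0 < s < 1 -> (0 < area (ballR2 1 `\` ballR2 s))%E.
Proof.
move=> /andP[s0 s1]; rewrite measureD; [|exact: measurable_ballR2|exact: measurable_ballR2|exact: area_disc_lty].
rewrite setIidr; last by move=> p; rewrite /ballR2 /= => h; exact: lt_trans s1.
rewrite (_ : (_ - _)%E = (area (ballR2 1%R) - s%:E * area (ballR2 1%R))%E); last first.
  by congr (_ - _)%E; exact: area_ballR2.
have dE : area (@ballR2 R 1) = (fine (area (@ballR2 R 1)))%:E.
  by rewrite fineK // ge0_fin_numE ?measure_ge0 //; exact: area_disc_lty.
have := area_disc_gt0; rewrite dE lte_fin => d0.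
rewrite -EFinM -EFinB lte_fin; set d := fine _ in d0 *.
have -> : d - s * d = (1 - s) * d by ring.
by rewrite mulr_gt0 // subr_gt0.
Qed.

(** Stands in for the exact value, a Beta function. The cut-off u = max(0, |z|^2 - r^2) is at most 1
    and vanishes unless |z| > r, so |z|^(2m) >= u(z) r^(2m) everywhere; kappa is the integral of u,
    positive because u is positive on an annulus of positive area. *)
Lemma moment_lower_bound (r : R) : 0 < r < 1 ->
  exists2 kappa, 0 < kappa & forall m, kappa * r ^+ (2 * m) <= moment m.
Proof.
move=> /andP[r0 r1]; have s01 : 0 < r ^+ 2 < 1 by rewrite exprn_gt0 // expr_lt1 // ltW.
have [s0 s1] := andP s01.
pose u (z : R[i]) : R := Num.max 0 (cmod z ^+ 2 - r ^+ 2).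
have mu : disc_measurable u.
  apply: measurable_maxr => //; apply: measurable_funB => //; apply: measurable_funTS.
  rewrite (_ : (fun x : R * R => _) = (fun p => p.1 ^+ 2 + p.2 ^+ 2)); last first.
    by apply/funext => p; rewrite sqr_cmod.
  by apply: measurable_funD; apply: measurable_funX.
have u0 z : 0 <= u z by rewrite le_max lexx.
have u1 z : cmod z < 1 -> u z <= 1.
  move=> z1; have : cmod z ^+ 2 < 1 by rewrite expr_lt1 // cmod_ge0.
  by rewrite ge_max ler01 /=; lra.
have iu : wintegrable u.
  by apply: (wintegrable_bounded alphaN1 (M := 1) mu) => z z1; rewrite ger0_norm // u1.
exists (wint u).
  rewrite lt_neqAle wint_ge0 // andbT; apply/eqP => /esym wu0.
  have [N [mN N0 sN]] := wint_eq0_ae alphaN1 iu (fun z _ => u0 z) wu0.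
  pose s' := (1 + r ^+ 2) / 2.
  have s'01 : 0 < s' < 1 by rewrite /s'; apply/andP; split; lra.
  have := area_shell_gt0 s'01; rewrite ltNge => /negP; apply.
  rewrite -N0; apply: le_measure; rewrite ?inE //.
    by apply: measurableD; exact: measurable_ballR2.
  move=> p [p1 p2]; apply: sN; split; first exact: p1.
  have h : r ^+ 2 < cmod (toC p) ^+ 2.
    have {}p2 : s' <= p.1 ^+ 2 + p.2 ^+ 2 by rewrite leNgt; apply/negP.
    by rewrite sqr_cmod; apply: lt_le_trans p2; rewrite /s'; lra.
  rewrite gt_eqF // /u lt_max; apply/orP; right; lra.
move=> m; rewrite mulrC -wintZ //; apply: le_wint => //; [exact: wintegrableZ|exact: wintegrable_cmodX|].
move=> z z1; rewrite !exprM; case: (leP (cmod z ^+ 2) (r ^+ 2)) => h.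
  have -> : u z = 0 by apply/max_idPl; rewrite subr_le0.
  by rewrite mulr0 !exprn_ge0 // cmod_ge0.
apply: (@le_trans _ _ ((r ^+ 2) ^+ m)).
  by rewrite ler_piMr ?u1 // exprn_ge0 // ltW.
by rewrite lerXn2r ?nnegrE ?sqr_ge0 // ltW.
Qed.

Lemma moment_gt0 m : 0 < moment m.
Proof.
have r01 : 0 < (2^-1 : R) < 1 by rewrite invr_gt0 ltr0n invf_lt1 // ltr1n.
have [k k0 hk] := moment_lower_bound r01; apply: lt_le_trans (hk m).
by rewrite mulr_gt0 // exprn_gt0 // invr_gt0.
Qed.

End ComplexWeightedIntegral.

(** * Eigenfunctions of the rotation *)

Section GeometricSeries.
Context {R : realType}.
Notation C := (R[i]^o).
Variables (A theta : R).
Hypotheses (A0 : 0 <= A) (theta01 : 0 <= theta < 1).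

Let t0 : 0 <= theta. Proof. by case/andP: theta01. Qed.
Let t1 : 0 < 1 - theta. Proof. by rewrite subr_gt0; case/andP: theta01. Qed.

(** The sum of A theta^j over j >= N. *)
Definition geometric_tail N : R := A * theta ^+ N / (1 - theta).

Lemma geometric_tail_ge0 N : 0 <= geometric_tail N.
Proof. by rewrite divr_ge0 ?(ltW t1) // mulr_ge0 // exprn_ge0. Qed.

Lemma geometric_tailS N : geometric_tail N - geometric_tail N.+1 = A * theta ^+ N.
Proof.
rewrite /geometric_tail -mulrBl exprS.
have -> : A * theta ^+ N - A * (theta * theta ^+ N) = A * theta ^+ N * (1 - theta) by ring.
by rewrite mulfK // gt_eqF.
Qed.

(** Partial sums minus tails increase and partial sums plus tails decrease, so the limit is
    bracketed together with the rate of convergence. *)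
Lemma geometric_limit (r : nat -> R) : (forall j, `|r j| <= A * theta ^+ j) ->
  exists L, forall N, `|L - \sum_(j < N) r j| <= geometric_tail N.
Proof.
move=> rA; pose S N := \sum_(j < N) r j; pose T := geometric_tail.
have SS N : S N.+1 = S N + r N by rewrite /S big_ord_recr.
have ndl : nondecreasing_seq (fun N => S N - T N).
  apply/nondecreasing_seqP => N; have := rA N; rewrite -geometric_tailS SS ler_norml -/T.
  by move=> /andP[h _]; lra.
have niu : nonincreasing_seq (fun N => S N + T N).
  apply/nonincreasing_seqP => N; have := rA N; rewrite -geometric_tailS SS ler_norml -/T.
  by move=> /andP[_ h]; lra.
have lu M N : S M - T M <= S N + T N.
  apply: (@le_trans _ _ (S (maxn M N) - T (maxn M N))); first by apply: ndl; exact: leq_maxl.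
  apply: (@le_trans _ _ (S (maxn M N) + T (maxn M N))); last by apply: niu; exact: leq_maxr.
  by have := geometric_tail_ge0 (maxn M N); rewrite -/T; lra.
have cl : cvgn (fun N => S N - T N).
  by apply: nondecreasing_is_cvgn => //; exists (S 0%N + T 0%N) => _ [m _ <-]; exact: lu.
exists (limn (fun N => S N - T N)) => N.
have h1 : S N - T N <= limn (fun N => S N - T N) by exact: (nondecreasing_cvgn_le ndl cl N).
have h2 : limn (fun N => S N - T N) <= S N + T N.
  by apply: limr_le => //; apply: nearW => m; exact: lu.
by rewrite ler_norml -/(S N) -/(T N); apply/andP; split; lra.
Qed.

Lemma geometric_climit (b : nat -> R[i]) : (forall j, cmod (b j) <= A * theta ^+ j) ->
  exists L, forall N, cmod (L - \sum_(j < N) b j) <= 2 * geometric_tail N.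
Proof.
move=> bA.
have [x hx] := @geometric_limit (fun j => Re (b j)) (fun j => le_trans (normr_Re_le _) (bA j)).
have [y hy] := @geometric_limit (fun j => Im (b j)) (fun j => le_trans (normr_Im_le _) (bA j)).
have Re_sum N : Re (\sum_(j < N) b j) = \sum_(j < N) Re (b j).
  by elim: N => [|N IH]; rewrite ?big_ord0 // !big_ord_recr /= ReD IH.
have Im_sum N : Im (\sum_(j < N) b j) = \sum_(j < N) Im (b j).
  by elim: N => [|N IH]; rewrite ?big_ord0 // !big_ord_recr /= ImD IH.
exists (x +i* y) => N; apply: (le_trans (cmod_le_ReIm _)).
rewrite ReB ImB Re_sum Im_sum mulr_natl mulr2n.
by apply: lerD; [exact: hx|exact: hy].
Qed.

Lemma geometric_tail_small (k e : R) : 0 <= k -> 0 < e ->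
  exists N, forall n, (N <= n)%N -> k * geometric_tail n <= e.
Proof.
move=> k0 e0; have kA : 0 <= k * A / (1 - theta) by rewrite divr_ge0 ?(ltW t1) // mulr_ge0.
have [N hN] := expr_small theta01 kA e0; exists N => n /hN.
by congr (_ <= _); rewrite /geometric_tail; ring.
Qed.

End GeometricSeries.

(** * Power series and their derivatives *)

Section PowerSeries.
Context {R : realType}.
Notation C := (R[i]^o).

(** Each of the j terms of 1 + x + ... + x^(j-1) is at least x^j. *)
Lemma natmul_expr_le (x : R) j : 0 <= x < 1 -> j%:R * x ^+ j <= (1 - x)^-1.
Proof.
move=> /andP[x0 x1]; have x1' : 0 < 1 - x by rewrite subr_gt0.
have le : j%:R * x ^+ j <= \sum_(i < j) x ^+ i.
  rewrite mulr_natl -[j in _ *+ j]card_ord -sumr_const; apply: ler_sum => i _.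
  by apply: ler_wiXn2l; [exact: x0|exact: ltW|exact: ltnW].
apply: (le_trans le); rewrite -[leRHS]mul1r ler_pdivlMr //.
have := subrX1 x j; have := exprn_ge0 j x0; set s := \sum_(i < j) _ => ge0 e.
have -> : s * (1 - x) = 1 - x ^+ j by rewrite -[x ^+ j](subrK 1) e; ring.
lra.
Qed.

(** The difference quotient of z^j is a polynomial Q_j(w) of modulus at most j on the closed disc.
    The series of the a_j Q_j therefore converges uniformly, and its sum G is the quotient that
    Caratheodory's form asks for. *)
Theorem power_series (A theta : R) (a : nat -> R[i]) : 0 <= A -> 0 <= theta < 1 ->
  (forall j, cmod (a j) <= A * theta ^+ j) ->
  exists F : R[i] -> R[i],
    (forall z, cmod z <= 1 -> forall N,
       cmod (F z - \sum_(j < N) a j * z ^+ j) <= 2 * geometric_tail A theta N) /\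
    (forall z, cmod z < 1 -> exists D, cderiv F z D).
Proof.
move=> A0 t01 aA; have [t0 t1] := andP t01.
have /choice[F hF] : forall z : R[i], exists L, cmod z <= 1 -> forall N,
    cmod (L - \sum_(j < N) a j * z ^+ j) <= 2 * geometric_tail A theta N.
  move=> z; have [z1|z1] := boolP (cmod z <= 1); last by exists 0.
  have [j|L hL] := @geometric_climit R A theta A0 t01 (fun j => a j * z ^+ j); last by exists L.
  rewrite cmodM cmodX -[leRHS]mulr1; apply: ler_pM => //; rewrite ?exprn_ge0 ?cmod_ge0 //.
  by rewrite exprn_ile1 ?cmod_ge0.
exists F; split => // z z1.
(* A ratio strictly between theta and 1: the factor j lost to Q_j is absorbed, since j (theta / s)^j
   stays bounded. *)
pose s := (1 + theta) / 2.
have s01 : 0 <= s < 1 by rewrite /s; apply/andP; split; lra.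
have s0 : 0 < s by rewrite /s; lra.
pose x := theta / s.
have x01 : 0 <= x < 1 by rewrite /x divr_ge0 ?(ltW s0) //= ltr_pdivrMr // mul1r /s; lra.
pose A' := A / (1 - x).
have A'0 : 0 <= A' by rewrite divr_ge0 // subr_ge0 ltW //; case/andP: x01.
pose Q (w : R[i]) j := \sum_(i < j) w ^+ (j.-1 - i) * z ^+ i.
have Qb w j : cmod w <= 1 -> cmod (a j * Q w j) <= A' * s ^+ j.
  move=> w1; rewrite cmodM.
  have Qj : cmod (Q w j) <= j%:R.
    apply: (le_trans (cmod_sum _ _ _)); rewrite -[j in j%:R]card_ord -sumr_const.
    apply: ler_sum => i _; rewrite cmodM !cmodX mulr_ile1 ?exprn_ge0 ?cmod_ge0 //.
      by rewrite exprn_ile1 ?cmod_ge0.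
    by rewrite exprn_ile1 ?cmod_ge0 // ltW.
  apply: (@le_trans _ _ (A * theta ^+ j * j%:R)); first by apply: ler_pM => //; rewrite ?cmod_ge0.
  have -> : A * theta ^+ j * j%:R = A * s ^+ j * (j%:R * x ^+ j).
    have -> : theta ^+ j = s ^+ j * x ^+ j by rewrite -exprMn /x mulrC divfK ?gt_eqF.
    by ring.
  rewrite /A' [leRHS]mulrAC; apply: ler_wpM2l; last exact: natmul_expr_le.
  by rewrite mulr_ge0 // exprn_ge0 // ltW.
have /choice[G hG] : forall w : R[i], exists L, cmod w <= 1 -> forall N,
    cmod (L - \sum_(j < N) a j * Q w j) <= 2 * geometric_tail A' s N.
  move=> w; have [w1|w1] := boolP (cmod w <= 1); last by exists 0.
  by have [j|L hL] := @geometric_climit R A' s A'0 s01 (fun j => a j * Q w j); [exact: Qb|exists L].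
have FG w : cmod w <= 1 -> F w = F z + G w * (w - z).
  move=> w1; apply/eqP; rewrite -subr_eq0 -cmod_eq0 eq_le cmod_ge0 andbT.
  apply/ler_addgt0Pl => e e0; rewrite addr0.
  have e3 : 0 < e / 3 by rewrite divr_gt0.
  have [N1 h1] := geometric_tail_small A0 t01 (ler0n R 2) e3.
  have [N2 h2] := geometric_tail_small A'0 s01 (ler0n R 4) e3.
  pose N := maxn N1 N2.
  have {}h1 := h1 N (leq_maxl _ _); have {}h2 := h2 N (leq_maxr _ _).
  have E : \sum_(j < N) a j * w ^+ j - \sum_(j < N) a j * z ^+ j =
      (\sum_(j < N) a j * Q w j) * (w - z).
    rewrite -sumrB mulr_suml; apply: eq_bigr => j _.
    by rewrite -mulrBr subrXX -mulrA [_ * (w - z)]mulrC.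
  have -> : F w - (F z + G w * (w - z)) =
     (F w - \sum_(j < N) a j * w ^+ j) - (F z - \sum_(j < N) a j * z ^+ j) -
     (G w - \sum_(j < N) a j * Q w j) * (w - z) by rewrite mulrBl -E; ring.
  apply: (le_trans (cmodB _ _)).
  have c1 := le_trans (hF w w1 N) h1; have c2 := le_trans (hF z (ltW z1) N) h1.
  have c3 : cmod ((G w - \sum_(j < N) a j * Q w j) * (w - z)) <= e / 3.
    rewrite cmodM; apply: le_trans h2.
    have -> : 4 * geometric_tail A' s N = 2 * geometric_tail A' s N * 2 by ring.
    apply: ler_pM; rewrite ?cmod_ge0 //; first exact: hG.
    by apply: (le_trans (cmodB _ _)); lra.
  have := cmodB (F w - \sum_(j < N) a j * w ^+ j) (F z - \sum_(j < N) a j * z ^+ j).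
  by lra.
(* G is controlled only on the closed disc. Outside it the plain difference quotient serves, which
   does not affect continuity at z since |z| < 1. *)
exists (G z), (fun w => if cmod w <= 1 then G w else (F w - F z) / (w - z)); split.
- apply/ccontinuousP => e e0; rewrite ltW //.
  have e3 : 0 < e / 4 by rewrite divr_gt0.
  have [N /(_ N (leqnn N)) h] := geometric_tail_small A'0 s01 (ler0n R 2) e3.
  have cX j : {for z, continuous (fun w : C => w ^+ j : C)}.
    by have [D /cderiv_continuous] := cderivX j z.
  have csum n (H : nat -> C -> C) : (forall i, {for z, continuous (H i)}) ->
      {for z, continuous (fun w => \sum_(i < n) H i w)}.
    move=> cH; elim: n => [|n IH].
      rewrite (_ : (fun w => _) = fun=> 0); first exact: (@ccontinuous_cst R 0 z).
      by apply/funext => w; rewrite big_ord0.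
    rewrite (_ : (fun w => _) = fun w => \sum_(i < n) H i w + H n w); last first.
      by apply/funext => w; rewrite big_ord_recr.
    exact: (ccontinuousD IH (cH n)).
  have cQ j : {for z, continuous (fun w : C => Q w j : C)}.
    apply: (csum j (fun i w => w ^+ (j.-1 - i) * z ^+ i)) => i.
    exact: (@ccontinuousM R _ (fun=> z ^+ i) z (cX _) (@ccontinuous_cst R (z ^+ i) z)).
  have cS : {for z, continuous (fun w : C => \sum_(j < N) a j * Q w j : C)}.
    apply: (csum N (fun j w => a j * Q w j)) => j.
    exact: (@ccontinuousM R (fun=> a j) _ z (@ccontinuous_cst R (a j) z) (cQ j)).
  have /ccontinuousP/(_ _ e3)[r r0 hr] := cS.
  exists (Num.min r (1 - cmod z)); first by rewrite lt_min r0 subr_gt0.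
  move=> w; rewrite lt_min => /andP[/hr wr wz].
  have w1 : cmod w <= 1 by have := cmod_dist w z; lra.
  rewrite w1.
  have -> : G w - G z = (G w - \sum_(j < N) a j * Q w j) - (G z - \sum_(j < N) a j * Q z j) +
     (\sum_(j < N) a j * Q w j - \sum_(j < N) a j * Q z j) by ring.
  apply: (le_lt_trans (cmodD _ _)).
  have c1 := le_trans (hG w w1 N) h; have c2 := le_trans (hG z (ltW z1) N) h.
  have := cmodB (G w - \sum_(j < N) a j * Q w j) (G z - \sum_(j < N) a j * Q z j).
  by lra.
- by rewrite ltW.
- move=> w; case: ifPn => [/FG//|w1].
  have wz : w - z != 0 by rewrite subr_eq0; apply: contraNneq w1 => ->; rewrite ltW.
  by rewrite divfK // addrC subrK.
Qed.

End PowerSeries.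

Lemma conjc_sum (R : realType) n (F : 'I_n -> R[i]) :
  (\sum_(i < n) F i)^*%C = \sum_(i < n) (F i)^*%C.
Proof. exact: (rmorph_sum (@conjc R)). Qed.

(** * The reproducing eigenfunctions *)

Section EigenKernel.
Context {R : realType}.
Notation C := (R[i]^o).
Variables (alpha : R) (n k : nat) (v : R[i]).
Hypotheses (alphaN1 : -1 < alpha) (n0 : (0 < n)%N) (v1 : cmod v < 1).

Notation wint := (wint alpha).
Notation cwint := (cwint alpha).
Notation cwintegrable := (cwintegrable alpha).

Let c j : R := moment alpha (n * j + k).
Let c0 j : 0 < c j. Proof. exact: moment_gt0. Qed.
Let a j : R[i] := v^*%C ^+ j / (c j)%:C.
Let f_ N (z : R[i]) : R[i] := \sum_(j < N) a j * z ^+ (n * j + k).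

Let cC j : (c j)%:C != 0 :> R[i].
Proof. by rewrite -cmod_eq0 cmod_real normr_eq0 gt_eqF. Qed.

Let aJ j : (a j)^*%C = v ^+ j / (c j)%:C.
Proof. by rewrite /a conjcM conjcX conjcK conjc_inv conjc_real. Qed.

(** Bernoulli's inequality. *)
Lemma one_sub_expr_le (x : R) m : 0 <= x <= 1 -> 1 - m%:R * x <= (1 - x) ^+ m.
Proof.
move=> /andP[x0 x1]; elim: m => [|m IH]; first by rewrite mul0r subr0 expr0.
rewrite exprS; apply: (@le_trans _ _ ((1 - x) * (1 - m%:R * x))); last first.
  by apply: ler_wpM2l IH; rewrite subr_ge0.
rewrite -natr1; have : 0 <= m%:R * x * x by rewrite !mulr_ge0.
by lra.
Qed.

(** With |v| < s < 1 and rho chosen so that rho^(2n) >= s, the moment of order nj + k is at least a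
    constant times s^j, and the coefficients decay like (|v| / s)^j. *)
Let coef_bound : exists A theta : R, [/\ 0 <= A, 0 <= theta < 1 &
  forall j, cmod (a j) <= A * theta ^+ j].
Proof.
pose s := (1 + cmod v) / 2.
have v0 := cmod_ge0 v; have v1_ := v1.
have s01 : 0 < s < 1 by rewrite /s; apply/andP; split; lra.
have [s0 s1] := andP s01.
have p0 : 0 < (2 * n)%:R :> R by rewrite ltr0n muln_gt0.
(* Chosen so that Bernoulli's inequality gives (1 - x)^(2n) >= s. *)
pose x := (1 - s) / (2 * n)%:R.
have x0 : 0 < x by rewrite divr_gt0 // subr_gt0.
have x1 : x < 1.
  rewrite ltr_pdivrMr // mul1r; apply: (@lt_le_trans _ _ 1); first by lra.
  by rewrite ler1n muln_gt0.
pose rho := 1 - x.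
have rho0 : 0 < rho by rewrite subr_gt0.
have rho01 : 0 < rho < 1 by rewrite rho0 /rho; lra.
have srho : s <= rho ^+ (2 * n).
  apply: le_trans (one_sub_expr_le (2 * n) _); last by rewrite !ltW.
  by rewrite /x mulrC divfK ?gt_eqF //; lra.
have [kappa kappa0 hk] := moment_lower_bound alphaN1 rho01.
pose B := kappa * rho ^+ (2 * k).
have rk : 0 < rho ^+ (2 * k) by rewrite exprn_gt0.
have B0 : 0 < B by rewrite mulr_gt0.
exists B^-1, (cmod v / s); split; first by rewrite invr_ge0 ltW.
  by rewrite divr_ge0 ?(ltW s0) // ltr_pdivrMr // mul1r /s; lra.
move=> j; rewrite cmodM cmodV cmod_real (gtr0_norm (c0 j)) cmodX cmodJ expr_div_n mulrCA.
apply: ler_wpM2l; first by rewrite exprn_ge0.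
have sj : 0 < s ^+ j by rewrite exprn_gt0.
rewrite -invfM lef_pV2 ?posrE ?mulr_gt0 //.
apply: (le_trans _ (hk (n * j + k)%N)).
rewrite mulnDr exprD /B -mulrA [_ ^+ (2 * k) * _]mulrC.
rewrite ler_pM2l // (ler_pM2r rk) mulnA exprM.
by rewrite lerXn2r ?nnegrE ?exprn_ge0 ?(ltW s0) ?(ltW rho0).
Qed.

(** Orthogonality leaves only the pairs j = m + i, for which conj(a_j) c_j = v^(m+i), and v^m
    factors out exactly. Truncating the conjugated factor at N + m instead of N keeps a partner for
    every i < N. *)
Let cwint_partial N m :
  cwint (fun z => z ^+ (n * m) * (f_ N z * (f_ (N + m) z)^*%C)) =
  v ^+ m * (\sum_(i < N) (cmod v ^+ (2 * i) / c i)%:C).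
Proof.
pose T i j (z : R[i]) := a i * (a j)^*%C * (z ^+ (n * (m + i) + k) * (z ^+ (n * j + k))^*%C).
have iT i j : cwintegrable (T i j).
  by apply: cwintegrableZ; exact: cwintegrable_monomials.
have inner_ (i : 'I_N) := cwintegrable_sum alphaN1 (fun j : 'I_(N + m) => iT i j).
have [_ outer] := cwintegrable_sum alphaN1 (fun i => (inner_ i).1).
transitivity (\sum_(i < N) cwint (fun z => \sum_(j < N + m) T i j z)).
  rewrite -outer; apply: eq_cwint => z _.
  rewrite /f_ conjc_sum mulr_suml mulr_sumr; apply: eq_bigr => i _.
  rewrite mulr_sumr mulr_sumr; apply: eq_bigr => j _.
  by rewrite conjcM /T mulnDr -addnA (exprD z (n * m)%N); ring.
rewrite mulr_sumr; apply: eq_bigr => i _; rewrite (inner_ i).2.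
have im : (m + i < N + m)%N by rewrite addnC ltn_add2r.
rewrite (bigD1 (Ordinal im)) //= big1 ?addr0; last first.
  move=> j jim; rewrite cwintZ; last exact: cwintegrable_monomials.
  rewrite cwint_monomials_neq ?mulr0 // eqn_add2r eqn_pmul2l //.
  by apply: contraNneq jim => e; apply/eqP/val_inj.
rewrite cwintZ; last exact: cwintegrable_monomials.
rewrite cwint_monomial_sqr // -/(c (m + i)) aJ -mulrA divfK // /a.
have -> : (cmod v ^+ (2 * i) / c i)%:C = v ^+ i * v^*%C ^+ i / (c i)%:C :> R[i].
  by rewrite rmorphM /= fmorphV /= -exprMn mulcJ_cmod exprM rmorphXn.
by rewrite exprD; ring.
Qed.

(** The function is z^k F(z^n), where F is the power series with coefficients a_j; this shape gives
    the eigenvalue l^k at once. The moment identity passes to the limit from [cwint_partial], which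
    is an equality for every truncation. *)
Lemma eigen_kernel : exists f : R[i] -> R[i],
  [/\ forall z, cmod z < 1 -> exists D, cderiv f z D,
      exists K, forall z, cmod z < 1 -> cmod (f z) <= K,
      forall l z, l ^+ n = 1 -> f (l * z) = l ^+ k * f z,
      exists2 nu : R, 0 < nu & cwint (fun z => f z * (f z)^*%C) = nu%:C
    & forall m, cwint (fun z => z ^+ (n * m) * (f z * (f z)^*%C)) =
        v ^+ m * cwint (fun z => f z * (f z)^*%C)].
Proof.
have [A [theta [A0 t01 aA]]] := coef_bound.
have [F [FN dF]] := power_series A0 t01 aA.
pose f (z : R[i]) := z ^+ k * F (z ^+ n).
have Xn1 (z : R[i]) m : cmod z < 1 -> cmod (z ^+ m) <= 1 by exact: cmodX_le1.
have fN z N : cmod z < 1 -> cmod (f z - f_ N z) <= 2 * geometric_tail A theta N.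
  move=> z1; have -> : f z - f_ N z = z ^+ k * (F (z ^+ n) - \sum_(j < N) a j * (z ^+ n) ^+ j).
    rewrite mulrBr; congr (_ - _); rewrite mulr_sumr; apply: eq_bigr => j _.
    by rewrite exprD exprM; ring.
  rewrite cmodM -[leRHS]mul1r; apply: ler_pM; rewrite ?cmod_ge0 ?Xn1 //.
  by apply: FN; exact: Xn1.
have af z : cmod z < 1 -> exists D, cderiv f z D.
  move=> z1; have zn1 : cmod (z ^+ n) < 1 by rewrite cmodX exprn_ilt1 ?cmod_ge0 // -lt0n.
  have [D1 d1] := cderivX k z; have [D2 d2] := cderivX n z; have [D3 d3] := dF _ zn1.
  by eexists; exact: (cderivM d1 (cderiv_comp d2 d3)).
(* One bound for f and for all its truncations: |f| is at most half of K, and |f - f_N| at most the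
   other half. *)
pose K := 4 * geometric_tail A theta 0.
have tail_le N : geometric_tail A theta N <= geometric_tail A theta 0.
  have [t0 t1] := andP t01.
  rewrite /geometric_tail expr0 mulr1 ler_pM2r ?invr_gt0 ?subr_gt0 //.
  by rewrite ler_piMr // exprn_ile1 // ltW.
have T0 N : 0 <= geometric_tail A theta N by exact: geometric_tail_ge0.
have fK z : cmod z < 1 -> cmod (f z) <= K.
  move=> z1; have := fN z 0%N z1; rewrite /f_ big_ord0 subr0 => h; apply: (le_trans h).
  by rewrite /K; have := T0 0%N; lra.
have fNK z N : cmod z < 1 -> cmod (f_ N z) <= K.
  move=> z1; have -> : f_ N z = f z - (f z - f_ N z) by ring.
  apply: (le_trans (cmodB _ _)); have := fN z 0%N z1.
  have -> : f_ 0 z = 0 by rewrite /f_ big_ord0.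
  by rewrite subr0 /K => h; have := fN z N z1; have := tail_le N; lra.
have cf : disc_continuous f by exact: analytic_disc_continuous.
have cfN N : disc_continuous (f_ N).
  elim: N => [|N IH].
    rewrite (_ : f_ 0 = fun=> 0); first exact: disc_continuous_cst.
    by apply/funext => z; rewrite /f_ big_ord0.
  rewrite (_ : f_ N.+1 = fun z => f_ N z + a N * z ^+ (n * N + k)); last first.
    by apply/funext => z; rewrite /f_ big_ord_recr.
  exact: (disc_continuousD IH (disc_continuousM (@disc_continuous_cst R (a N)) (@disc_continuousX R _))).
have intg (p q : R[i] -> R[i]) m : disc_continuous p -> disc_continuous q ->
    (forall z, cmod z < 1 -> cmod (p z) <= K) -> (forall z, cmod z < 1 -> cmod (q z) <= K) ->
    cwintegrable (fun z => z ^+ (n * m) * (p z * (q z)^*%C)).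
  move=> cp cq pK qK; apply: (cwintegrable_bounded alphaN1 (M := K * K)).
    exact: (disc_continuousM (@disc_continuousX R _) (disc_continuousM cp (disc_continuousJ cq))).
  move=> z z1; rewrite !cmodM cmodJ -[leRHS]mul1r; apply: ler_pM; rewrite ?mulr_ge0 ?cmod_ge0 ?Xn1 //.
  by apply: ler_pM; rewrite ?cmod_ge0 ?pK ?qK.
have K0 : 0 <= K by apply: le_trans (fK 0 _); rewrite ?cmod_ge0 ?cmod0.
pose W := wint (fun=> 1).
have W0 : 0 <= W by exact: wint_ge0.
(* The difference of the two products is split so that each summand contains one truncation error,
   the other factor being bounded by K. *)
have approx m N : cmod (cwint (fun z => z ^+ (n * m) * (f z * (f z)^*%C)) -
    cwint (fun z => z ^+ (n * m) * (f_ N z * (f_ (N + m) z)^*%C))) <=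
    4 * K * W * (geometric_tail A theta N + geometric_tail A theta (N + m)).
  set I1 := cwint _; set I2 := cwint _.
  have i1 := intg _ _ m cf cf fK fK.
  have i2 := intg _ _ m (cfN N) (cfN (N + m)%N) (fNK^~ N) (fNK^~ (N + m)%N).
  have -> : I1 - I2 = cwint (fun z => z ^+ (n * m) * (f z * (f z)^*%C) +
      (-1) * (z ^+ (n * m) * (f_ N z * (f_ (N + m) z)^*%C))).
    by rewrite (cwintD i1 (cwintegrableZ (-1) i2)) (cwintZ _ i2) mulN1r.
  set t := geometric_tail _ _ N; set t' := geometric_tail _ _ (N + m).
  apply: (@le_trans _ _ (2 * wint (fun=> K * (2 * (t + t')) * 1))); first apply: (cmod_cwint_le alphaN1).
  - exact: (cwintegrableD i1 (cwintegrableZ (-1) i2)).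
  - by apply: wintegrableZ; exact: wintegrable_cst.
  - move=> z z1; have -> : z ^+ (n * m) * (f z * (f z)^*%C) +
        (-1) * (z ^+ (n * m) * (f_ N z * (f_ (N + m) z)^*%C)) =
        z ^+ (n * m) * ((f z - f_ N z) * (f z)^*%C + f_ N z * ((f z)^*%C - (f_ (N + m) z)^*%C)).
      by ring.
    rewrite mulr1 cmodM -[leRHS]mul1r; apply: ler_pM; rewrite ?cmod_ge0 ?Xn1 //.
    apply: (le_trans (cmodD _ _)); rewrite !cmodM -(rmorphB (@conjc R)) !cmodJ.
    have -> : K * (2 * (t + t')) = 2 * t * K + K * (2 * t') by ring.
    by apply: lerD; apply: ler_pM; rewrite ?cmod_ge0 ?fK ?fNK ?fN.
  - rewrite wintZ; last exact: wintegrable_cst.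
    by rewrite -/W le_eqVlt; apply/orP; left; apply/eqP; ring.
have small (e : R) m : 0 < e -> exists N, forall M, (N <= M)%N ->
    4 * K * W * (geometric_tail A theta M + geometric_tail A theta (M + m)) <= e.
  move=> e0; have KW : 0 <= 4 * K * W by exact: (mulr_ge0 (mulr_ge0 (ler0n R 4) K0) W0).
  have [N hN] := geometric_tail_small A0 t01 KW (divr_gt0 e0 (ltr0Sn R 1)).
  exists N => M NM; rewrite mulrDr; have := hN M NM; have := hN (M + m)%N (leq_trans NM (leq_addr _ _)).
  by lra.
pose S N : R := \sum_(i < N) cmod v ^+ (2 * i) / c i.
have SE N : \sum_(i < N) (cmod v ^+ (2 * i) / c i)%:C = (S N)%:C :> R[i].
  by rewrite /S rmorph_sum.
pose I := cwint (fun z => f z * (f z)^*%C).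
have IE : I = cwint (fun z => z ^+ (n * 0) * (f z * (f z)^*%C)).
  by apply: eq_cwint => z _; rewrite muln0 expr0 mul1r.
have IS N : cmod (I - (S N)%:C) <= 4 * K * W * (geometric_tail A theta N + geometric_tail A theta (N + 0)).
  by have := approx 0%N N; rewrite -IE cwint_partial expr0 mul1r SE.
exists f; split => //.
- by exists K.
- by move=> l z ln; rewrite /f !exprMn ln mul1r mulrA.
- exists (wint (fun z => cmod (f z) ^+ 2)); last first.
    by rewrite -cwint_real //; apply: eq_cwint => z _; rewrite mulcJ_cmod.
  have ReI : wint (fun z => cmod (f z) ^+ 2) = Re I.
    by rewrite /I /=; apply: eq_wint => z _; rewrite mulcJ_cmod.
  have c00 : 0 < (c 0)^-1 by rewrite invr_gt0.
  (* Every nonempty partial sum is at least its first term 1 / c_0, and the integral comes within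
     half of that of some partial sum. *)
  rewrite ReI; apply: (@lt_le_trans _ _ (2^-1 * (c 0)^-1)); first by rewrite mulr_gt0.
  have c02 : 0 < 2^-1 * (c 0)^-1 by rewrite mulr_gt0.
  have [N hN] := small (2^-1 * (c 0)^-1) 0%N c02.
  have := le_trans (normr_Re_le _) (le_trans (IS N.+1) (hN _ (leqnSn N))).
  rewrite ReB /= ler_norml => /andP[h _].
  have : (c 0)^-1 <= S N.+1.
    rewrite /S big_ord_recl muln0 expr0 mul1r lerDl; apply: sumr_ge0 => i _.
    by rewrite divr_ge0 ?exprn_ge0 ?cmod_ge0 // ltW.
  by move: h; lra.
- move=> m; rewrite -/I; apply/eqP; rewrite -subr_eq0 -cmod_eq0 eq_le cmod_ge0 andbT.
  apply/ler_addgt0Pl => e e0; rewrite addr0.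
  have e2 : 0 < e / 2 by rewrite divr_gt0.
  have [N1 h1] := small _ m e2; have [N2 h2] := small _ 0%N e2.
  pose N := maxn N1 N2.
  have {}h1 := le_trans (approx m N) (h1 N (leq_maxl _ _)).
  have {}h2 := le_trans (IS N) (h2 N (leq_maxr _ _)).
  move: h1; rewrite cwint_partial SE; set J := cwint _ => h1.
  have -> : J - v ^+ m * I = (J - v ^+ m * (S N)%:C) - v ^+ m * (I - (S N)%:C) by ring.
  apply: (le_trans (cmodB _ _)); rewrite cmodM.
  have : cmod (v ^+ m) * cmod (I - (S N)%:C) <= e / 2.
    by apply: le_trans h2; rewrite ler_piMl ?cmod_ge0 ?Xn1.
  by lra.
Qed.

End EigenKernel.

(** * The reproducing property for bounded analytic functions *)

Section Reproducing.
Context {R : realType}.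
Notation C := (R[i]^o).
Variable alpha : R.
Hypothesis alphaN1 : -1 < alpha.

Notation wint := (wint alpha).
Notation cwint := (cwint alpha).
Notation cwintegrable := (cwintegrable alpha).

Lemma wint_dominated_cvg (u_ : nat -> R[i] -> R) (u v : R[i] -> R) :
  (forall i, disc_measurable (u_ i)) -> disc_measurable u -> wintegrable alpha v ->
  (forall i z, cmod z < 1 -> `|u_ i z| <= v z) ->
  (forall z, cmod z < 1 -> u_ i z @[i --> \oo] --> u z) ->
  wint (u_ i) @[i --> \oo] --> wint u.
Proof.
move=> mu_ mu iv uv uu.
have mD : measurable (@discR2 R : set (measurableTypeR R * measurableTypeR R)) := @measurable_discR2 R.
have uv' z : cmod z < 1 -> `|u z| <= v z.
  move=> z1; have cn : `|u_ i z| @[i --> \oo] --> `|u z| by apply: cvg_norm; exact: uu.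
  rewrite -(cvg_lim _ cn) //; apply: limr_le; first by apply/cvg_ex; exists `|u z|.
  by apply: nearW => i; exact: uv.
have iu : wintegrable alpha u by exact: (le_wintegrable mu iv uv').
have fin : (\int[@area R]_(p in @discR2 R) (u (toC p) * weight alpha p)%:E)%E \is a fin_num.
  exact: (integrable_fin_num mD iu).
apply: fine_cvg; rewrite fineK //.
apply: (@dominated_cvg _ _ _ (@area R) _ mD _ _ (fun p => (v (toC p) * weight alpha p)%:E)) => //.
- move=> i; apply/measurable_EFinP; apply: measurable_funM; first exact: mu_.
  by apply: measurable_funTS; exact: measurable_weight.
- move=> p /discR2P hp; apply: cvg_EFin; first by exact: nearW.
  by apply: cvgMl; exact: uu.
- move=> i p /discR2P hp; rewrite /= lee_fin normrM (ger0_norm (weight_ge0 alphaN1 p)).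
  by apply: ler_wpM2r; [exact: weight_ge0|exact: uv].
Qed.

Section Functional.
Variables (n : nat) (v : R[i]) (f : R[i] -> R[i]) (K : R).
Hypotheses (n0 : (0 < n)%N) (v1 : cmod v < 1) (cf : disc_continuous f)
  (fK : forall z, cmod z < 1 -> cmod (f z) <= K).

Let q (z : R[i]) : R[i] := f z * (f z)^*%C.
Let I := cwint q.
Hypothesis moments : forall m, cwint (fun z => z ^+ (n * m) * q z) = v ^+ m * I.

Let K0 : 0 <= K.
Proof. by apply: le_trans (fK (z := 0) _); rewrite ?cmod_ge0 ?cmod0. Qed.

Let cq : disc_continuous q.
Proof. exact: (disc_continuousM cf (disc_continuousJ cf)). Qed.

Let qK z : cmod z < 1 -> cmod (q z) <= K * K.
Proof. by move=> z1; rewrite cmodM cmodJ; apply: ler_pM; rewrite ?cmod_ge0 ?fK. Qed.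

Let iq (h : R[i] -> R[i]) M : disc_continuous h -> (forall z, cmod z < 1 -> cmod (h z) <= M) ->
  cwintegrable (fun z => h z * q z).
Proof.
move=> ch hM; apply: (cwintegrable_bounded alphaN1 (M := M * (K * K))).
  exact: (disc_continuousM ch cq).
by move=> z z1; rewrite cmodM; apply: ler_pM; rewrite ?cmod_ge0 ?hM ?qK.
Qed.

Let iX m : cwintegrable (fun z => z ^+ (n * m) * q z).
Proof. by apply: (@iq _ 1); [exact: disc_continuousX|move=> z z1; exact: cmodX_le1]. Qed.

Let Xn1 (z : R[i]) : cmod z < 1 -> cmod (z ^+ n) < 1.
Proof. by move=> z1; rewrite cmodX exprn_ilt1 ?cmod_ge0 // -lt0n. Qed.

Let cwint_poly (p : {poly R[i]}) :
  cwintegrable (fun z => p.[z ^+ n] * q z) /\ cwint (fun z => p.[z ^+ n] * q z) = p.[v] * I.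
Proof.
have [i1 e1] := cwintegrable_sum alphaN1
  (fun i : 'I_(size p) => cwintegrableZ p`_i (iX i)).
have E z : \sum_(i < size p) p`_i * (z ^+ (n * i) * q z) = p.[z ^+ n] * q z.
  by rewrite horner_coef mulr_suml; apply: eq_bigr => i _; rewrite exprM mulrA.
split; first by apply: eq_cwintegrable i1 => z _; exact: E.
transitivity (cwint (fun z => \sum_(i < size p) p`_i * (z ^+ (n * i) * q z))).
  by apply: eq_cwint => z _; rewrite E.
rewrite e1 horner_coef mulr_suml; apply: eq_bigr => i _.
by rewrite (cwintZ _ (iX i)) moments mulrA.
Qed.

Variables (g : R[i] -> R[i]) (M : R).
Hypotheses (ag : forall z, cmod z < 1 -> exists D, cderiv g z D)
  (gM : forall z, cmod z < 1 -> cmod (g z) <= M).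

Let cg_dil (r : R) : 0 <= r <= 1 -> disc_continuous (fun z => g (r%:C * z ^+ n)).
Proof.
move=> /andP[r0 r1] z z1.
have rz : cmod (r%:C * z ^+ n) < 1.
  rewrite cmodM cmod_real ger0_norm //; apply: le_lt_trans (Xn1 z1).
  by rewrite ler_piMl ?cmod_ge0.
have [D1 d1] := ag rz; have [D2 d2] := cderivX n z.
have d3 := cderiv_comp (cderivM (cderiv_cst r%:C z) d2) d1.
exact: cderiv_continuous d3.
Qed.

Let gM_dil (r : R) z : 0 <= r <= 1 -> cmod z < 1 -> cmod (g (r%:C * z ^+ n)) <= M.
Proof.
move=> /andP[r0 r1] z1; apply: gM; rewrite cmodM cmod_real ger0_norm //.
by apply: le_lt_trans (Xn1 z1); rewrite ler_piMl ?cmod_ge0.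
Qed.

(** The dilate sees g only on |z| <= r, where polynomials approximate it uniformly; for polynomials
    the identity is linear in the moments. *)
Let cwint_dilated (r : R) : 0 <= r < 1 ->
  cwint (fun z => g (r%:C * z ^+ n) * q z) = g (r%:C * v) * I.
Proof.
move=> r01; have [r0 r1] := andP r01.
have r01' : 0 <= r <= 1 by rewrite r0 ltW.
apply/eqP; rewrite -subr_eq0 -cmod_eq0 eq_le cmod_ge0 andbT.
apply/ler_addgt0Pl => e e0; rewrite addr0.
pose W := wint (fun=> 1).
have W0 : 0 <= W by exact: wint_ge0.
(* Collects the cost of an approximation error: the first summand under the integral, the second at
   the point r v. The later B + 1 avoids a division by zero. *)
pose B := 2 * (K * K * W) + cmod I.
have B0 : 0 <= B by rewrite addr_ge0 ?cmod_ge0 // !mulr_ge0.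
have e'0 : 0 < e / (B + 1) by rewrite divr_gt0 // ltr_wpDl.
have [p hp] := polynomial_approximation ag gM r01 e'0.
have [ip ep] := cwint_poly (p \Po (r%:C *: 'X)).
have hE x : (p \Po (r%:C *: 'X)).[x] = p.[r%:C * x] by rewrite horner_comp hornerZ hornerX.
have ig := iq (cg_dil r01') (fun z z1 => gM_dil r01' z1).
have rle z : cmod z < 1 -> cmod (r%:C * z) <= r.
  by move=> z1; rewrite cmodM cmod_real ger0_norm // ler_piMr // ltW.
have d1 : cmod (cwint (fun z => g (r%:C * z ^+ n) * q z) - p.[r%:C * v] * I) <=
    2 * (e / (B + 1) * (K * K) * W).
  rewrite -hE -ep -mulN1r -(cwintZ _ ip) -(cwintD ig (cwintegrableZ (-1) ip)).
  have -> : e / (B + 1) * (K * K) * W = wint (fun=> e / (B + 1) * (K * K) * 1).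
    by rewrite wintZ //; exact: wintegrable_cst.
  apply: (cmod_cwint_le alphaN1).
  - exact: (cwintegrableD ig (cwintegrableZ (-1) ip)).
  - by apply: wintegrableZ; exact: wintegrable_cst.
  - move=> z z1; rewrite hE mulr1.
    have -> : g (r%:C * z ^+ n) * q z + -1 * (p.[r%:C * z ^+ n] * q z) =
      (g (r%:C * z ^+ n) - p.[r%:C * z ^+ n]) * q z by ring.
    rewrite cmodM; apply: ler_pM; rewrite ?cmod_ge0 ?qK //.
    by apply: hp; apply: rle; exact: Xn1.
have d2 : cmod ((g (r%:C * v) - p.[r%:C * v]) * I) <= e / (B + 1) * cmod I.
  by rewrite cmodM; apply: ler_wpM2r; rewrite ?cmod_ge0 // hp ?rle.
set J := cwint _ in d1 *.
have -> : J - g (r%:C * v) * I = (J - p.[r%:C * v] * I) - (g (r%:C * v) - p.[r%:C * v]) * I by ring.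
apply: (le_trans (cmodB _ _)); apply: (le_trans (lerD d1 d2)).
have -> : 2 * (e / (B + 1) * (K * K) * W) + e / (B + 1) * cmod I = e / (B + 1) * B.
  by rewrite /B; ring.
rewrite mulrAC -mulrA ler_piMr ?(ltW e0) //.
by rewrite ler_pdivrMr ?mul1r ?lerDl // ltr_wpDl.
Qed.

(** No boundary behaviour of g is assumed, so the dilates converge only pointwise on the disc;
    boundedness of g and f allows dominated convergence. *)
Lemma cwint_reproducing : cwint (fun z => g (z ^+ n) * q z) = g v * I.
Proof.
pose r i : R := 1 - 2^-1 ^+ i.
have q01 : 0 <= (2^-1 : R) < 1 by rewrite invr_ge0 ler0n invf_lt1 // ltr1n.
have r01 i : 0 <= r i < 1.
  rewrite subr_ge0 ltrBlDr ltrDl exprn_gt0 ?invr_gt0 // andbT.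
  by apply: exprn_ile1; case/andP: q01 => // _ /ltW.
have r01' i : 0 <= r i <= 1 by have /andP[-> /ltW ->] := r01 i.
have one01 : 0 <= (1 : R) <= 1 by rewrite ler01 lexx.
have r1 : r i @[i --> \oo] --> (1 : R).
  apply/cvgrPdist_le => e e0; have [N hN] := @expr_small R _ 1 _ q01 ler01 e0.
  exists N => // i /= /hN; rewrite mul1r /r opprB addrCA subrr addr0.
  by rewrite ger0_norm // exprn_ge0 // invr_ge0.
have cgr (z : R[i]) : cmod z < 1 -> forall e : R, 0 < e ->
    \forall i \near \oo, cmod (g ((r i)%:C * z) - g z) < e.
  move=> z1 e e0; have [D /cderiv_continuous /ccontinuousP /(_ e e0)[d d0 hd]] := ag z1.
  have /cvgrPdist_lt /(_ d d0) := r1; apply: filterS => i hi; apply: hd.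
  have -> : (r i)%:C * z - z = (r i - 1)%:C * z.
    by move: (r i) => ri; rewrite rmorphB rmorph1 mulrBl mul1r.
  rewrite cmodM cmod_real distrC; apply: le_lt_trans hi.
  by rewrite ler_piMr // ltW.
(* Writing the limit as the dilate with r = 1 lets the continuity and boundedness facts for dilates
   cover it as well. *)
have E z : g (z ^+ n) = g (1%:C * z ^+ n) by rewrite mul1r.
have cG i := disc_continuousM (cg_dil (r01' i)) cq.
have cG1 := disc_continuousM (cg_dil one01) cq.
have iv : wintegrable alpha (fun=> M * (K * K)) by exact: wintegrable_cst.
have bd (s : R) z : 0 <= s <= 1 -> cmod z < 1 -> cmod (g (s%:C * z ^+ n) * q z) <= M * (K * K).
  by move=> s01 z1; rewrite cmodM; apply: ler_pM; rewrite ?cmod_ge0 ?gM_dil ?qK.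
have ptw (z : R[i]) : cmod z < 1 -> forall e : R, 0 < e ->
    \forall i \near \oo, cmod (g ((r i)%:C * z ^+ n) * q z - g (1%:C * z ^+ n) * q z) < e.
  move=> z1 e e0; have KK : 0 < K * K + 1 by rewrite ltr_wpDl // mulr_ge0.
  have e'0 : 0 < e / (K * K + 1) by rewrite divr_gt0.
  have := cgr _ (Xn1 z1) _ e'0; apply: filterS => i hi.
  rewrite -mulrBl mul1r cmodM; apply: (@le_lt_trans _ _ (cmod (g ((r i)%:C * z ^+ n) - g (z ^+ n)) * (K * K + 1))).
    by apply: ler_wpM2l; rewrite ?cmod_ge0 //; apply: (le_trans (qK z1)); rewrite lerDl.
  by rewrite -ltr_pdivlMr.
have cvR : wint (fun z => Re (g ((r i)%:C * z ^+ n) * q z)) @[i --> \oo] -->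
    wint (fun z => Re (g (1%:C * z ^+ n) * q z)).
  apply: (wint_dominated_cvg _ _ iv) => [i||i z z1|z z1].
  - exact: (disc_measurable_Re (cG i)).
  - exact: (disc_measurable_Re cG1).
  - exact: le_trans (normr_Re_le _) (bd _ _ (r01' i) z1).
  - apply/cvgrPdist_lt => e e0; have := ptw z z1 e e0; apply: filterS => i.
    by rewrite distrC -ReB; apply: le_lt_trans; exact: normr_Re_le.
have cvI : wint (fun z => Im (g ((r i)%:C * z ^+ n) * q z)) @[i --> \oo] -->
    wint (fun z => Im (g (1%:C * z ^+ n) * q z)).
  apply: (wint_dominated_cvg _ _ iv) => [i||i z z1|z z1].
  - exact: (disc_measurable_Im (cG i)).
  - exact: (disc_measurable_Im cG1).
  - exact: le_trans (normr_Im_le _) (bd _ _ (r01' i) z1).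
  - apply/cvgrPdist_lt => e e0; have := ptw z z1 e e0; apply: filterS => i.
    by rewrite distrC -ImB; apply: le_lt_trans; exact: normr_Im_le.
have EJ : cwint (fun z => g (z ^+ n) * q z) = cwint (fun z => g (1%:C * z ^+ n) * q z).
  by apply: eq_cwint => z _; rewrite mul1r.
have lim_dil (e : R) : 0 < e -> \forall i \near \oo, cmod (g ((r i)%:C * v) * I - g v * I) < e.
  move=> e0; have I1 : 0 < cmod I + 1 by rewrite ltr_wpDl // cmod_ge0.
  have e'0 : 0 < e / (cmod I + 1) by rewrite divr_gt0.
  have := cgr _ v1 _ e'0; apply: filterS => i hi.
  rewrite -mulrBl cmodM; apply: (@le_lt_trans _ _ (cmod (g ((r i)%:C * v) - g v) * (cmod I + 1))).
    by apply: ler_wpM2l; rewrite ?cmod_ge0 // lerDl.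
  by rewrite -ltr_pdivlMr.
have ReE i : wint (fun z => Re (g ((r i)%:C * z ^+ n) * q z)) = Re (g ((r i)%:C * v) * I).
  by rewrite -cwint_dilated.
have ImE i : wint (fun z => Im (g ((r i)%:C * z ^+ n) * q z)) = Im (g ((r i)%:C * v) * I).
  by rewrite -cwint_dilated.
have limR : Re (g ((r i)%:C * v) * I) @[i --> \oo] --> Re (g v * I).
  apply/cvgrPdist_lt => e e0; have := lim_dil e e0; apply: filterS => i.
  by rewrite distrC -ReB; apply: le_lt_trans; exact: normr_Re_le.
have limI : Im (g ((r i)%:C * v) * I) @[i --> \oo] --> Im (g v * I).
  apply/cvgrPdist_lt => e e0; have := lim_dil e e0; apply: filterS => i.
  by rewrite distrC -ImB; apply: le_lt_trans; exact: normr_Im_le.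
rewrite EJ; rewrite (funext ReE) in cvR; rewrite (funext ImE) in cvI.
apply: complex_inj; first exact: (cvg_unique _ cvR limR).
exact: (cvg_unique _ cvI limI).
Qed.

End Functional.

End Reproducing.

(** * The numerical range *)

Section NumericalRange.
Context {R : realType}.
Notation C := (R[i]^o).
Variable alpha : R.
Hypothesis alphaN1 : -1 < alpha.

Notation wint := (wint alpha).
Notation cwint := (cwint alpha).
Notation cwintegrable := (cwintegrable alpha).
Notation wintegrable := (wintegrable alpha).

Lemma bergmanP (f : R[i] -> R[i]) : bergman alpha f <->
  (forall z, cmod z < 1 -> exists D, cderiv f z D) /\ wintegrable (fun z => cmod (f z) ^+ 2).
Proof.
have e : (fun z => cmod (f z) ^+ 2) = (fun z => sqmod (f z)).
  by apply/funext => z; rewrite sqr_cmod.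
by rewrite /bergman e analytic_on_discP.
Qed.

Lemma normsqE (f : R[i] -> R[i]) : normsq alpha f = wint (fun z => cmod (f z) ^+ 2).
Proof.
have -> : (fun z => cmod (f z) ^+ 2) = (fun z => sqmod (f z)).
  by apply/funext => z; rewrite sqr_cmod.
by [].
Qed.

Lemma bergman_continuous f : bergman alpha f -> disc_continuous f.
Proof. by move=> /bergmanP[af _]; exact: analytic_disc_continuous. Qed.

Lemma bergman_lin f h (x y : R[i]) : bergman alpha f -> bergman alpha h ->
  bergman alpha (fun z => x * f z + y * h z).
Proof.
move=> bf bh; have cf := bergman_continuous bf; have ch := bergman_continuous bh.
move: bf bh => /bergmanP[af f2] /bergmanP[ah h2].
apply/bergmanP; split.
  move=> z z1; have [D1 d1] := af z z1; have [D2 d2] := ah z z1.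
  have [E1 e1] : exists E1, cderiv (fun w => x * f w) z E1.
    by eexists; exact: (cderivM (cderiv_cst x z) d1).
  have [E2 e2] : exists E2, cderiv (fun w => y * h w) z E2.
    by eexists; exact: (cderivM (cderiv_cst y z) d2).
  by eexists; exact: (cderivD e1 e2).
have cF := disc_continuousD (disc_continuousM (@disc_continuous_cst R x) cf)
  (disc_continuousM (@disc_continuous_cst R y) ch).
have mF : disc_measurable (fun z => cmod (x * f z + y * h z) ^+ 2).
  have := disc_measurable_Re (disc_continuousM cF (disc_continuousJ cF)).
  apply: eq_measurable_fun => p _; by rewrite mulcJ_cmod.
have iV := wintegrableD (wintegrableZ (2 * cmod x ^+ 2) f2) (wintegrableZ (2 * cmod y ^+ 2) h2).
apply: (le_wintegrable mF iV) => z z1.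
rewrite ger0_norm ?exprn_ge0 ?cmod_ge0 //.
have h1 : cmod (x * f z + y * h z) ^+ 2 <= (cmod x * cmod (f z) + cmod y * cmod (h z)) ^+ 2.
  rewrite lerXn2r ?nnegrE ?cmod_ge0 ?addr_ge0 ?mulr_ge0 ?cmod_ge0 //.
  by rewrite -!cmodM; exact: cmodD.
apply: (le_trans h1); have := sqr_ge0 (cmod x * cmod (f z) - cmod y * cmod (h z)).
by rewrite !expr2; lra.
Qed.

(** The product is dominated by M (|f|^2 + |h|^2), each term rotated, and rotations preserve
    integrability. Two independent rotations are allowed because the products of Fourier components
    mix f(lam^i z) with conj f(lam^j z). *)
Lemma cwintegrable_bergman f h (psi : R[i] -> R[i]) (M : R) (l l' : R[i]) :
  bergman alpha f -> bergman alpha h -> disc_continuous psi ->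
  (forall z, cmod z < 1 -> cmod (psi z) <= M) -> cmod l = 1 -> cmod l' = 1 ->
  cwintegrable (fun z => psi z * (f (l * z) * (h (l' * z))^*%C)).
Proof.
move=> bf bh cpsi psiM l1 l'1.
have crot k (u : R[i] -> R[i]) : cmod k = 1 -> disc_continuous u -> disc_continuous (fun z => u (k * z)).
  move=> k1 cu z z1; have kz : cmod (k * z) < 1 by rewrite cmod_rot.
  have ck : {for z, continuous (fun w : C => k * w : C)}.
    by have := cderiv_continuous (cderivM (cderiv_cst k z) (cderiv_id z)).
  exact: (@continuous_comp _ _ _ (fun w : C => k * w : C) (u : C -> C) z ck (cu _ kz)).
have cf := crot l f l1 (bergman_continuous bf); have ch := crot l' h l'1 (bergman_continuous bh).
move: bf bh => /bergmanP[af f2] /bergmanP[ah h2].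
have [i1 _] := wint_rot l1 f2; have [i2 _] := wint_rot l'1 h2.
have M0 : 0 <= M by apply: le_trans (psiM 0 _); rewrite ?cmod_ge0 ?cmod0.
apply: (le_cwintegrable (disc_continuousM cpsi (disc_continuousM cf (disc_continuousJ ch)))
  (wintegrableD (wintegrableZ M i1) (wintegrableZ M i2))) => z z1.
rewrite !cmodM cmodJ -mulrDr; apply: ler_pM; rewrite ?mulr_ge0 ?cmod_ge0 ?psiM //.
have := sqr_ge0 (cmod (f (l * z)) - cmod (h (l' * z))).
have := mulr_ge0 (cmod_ge0 (f (l * z))) (cmod_ge0 (h (l' * z))).
by rewrite !expr2; lra.
Qed.

Section Operator.
Variables (lam : R[i]) (psi : R[i] -> R[i]) (M : R).
Hypotheses (lam1 : cmod lam = 1) (cpsi : disc_continuous psi)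
  (psiM : forall z, cmod z < 1 -> cmod (psi z) <= M).

Let T := wcomp psi (fun z => lam * z).

Let S f h := cwint (fun z => psi z * (f (lam * z) * (h z)^*%C)).
Let P f h := cwint (fun z => f z * (h z)^*%C).

Let innerT f : inner alpha (T f) f = S f f.
Proof. by rewrite innerE; apply: eq_cwint => z _; rewrite /T /wcomp mulrA. Qed.

Let iS f h : bergman alpha f -> bergman alpha h ->
  cwintegrable (fun z => psi z * (f (lam * z) * (h z)^*%C)).
Proof.
move=> bf bh; have := cwintegrable_bergman bf bh cpsi psiM lam1 (@cmod1 R).
by apply: eq_cwintegrable => z _; rewrite mul1r.
Qed.

Let iP f h : bergman alpha f -> bergman alpha h ->
  cwintegrable (fun z => f z * (h z)^*%C).
Proof.
move=> bf bh; have c1 : forall z : R[i], cmod z < 1 -> cmod (1 : R[i]) <= 1 by rewrite cmod1.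
have := cwintegrable_bergman bf bh (@disc_continuous_cst R 1) c1 (@cmod1 R) (@cmod1 R).
by apply: eq_cwintegrable => z _; rewrite !mul1r.
Qed.

(** The left factors are kept independent of the right ones, so that a single expansion serves the
    norm (f1 = f, h1 = h) and the form of the operator (f1, h1 the images of f, h). *)
Lemma expand_sesquilinear (f h f1 h1 : R[i] -> R[i]) (x y : R[i]) :
  cwintegrable (fun z => f1 z * (f z)^*%C) -> cwintegrable (fun z => f1 z * (h z)^*%C) ->
  cwintegrable (fun z => h1 z * (f z)^*%C) -> cwintegrable (fun z => h1 z * (h z)^*%C) ->
  cwint (fun z => (x * f1 z + y * h1 z) * (x * f z + y * h z)^*%C) =
  x * x^*%C * cwint (fun z => f1 z * (f z)^*%C) + x * y^*%C * cwint (fun z => f1 z * (h z)^*%C)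
  + (y * x^*%C * cwint (fun z => h1 z * (f z)^*%C) + y * y^*%C * cwint (fun z => h1 z * (h z)^*%C)).
Proof.
move=> i1 i2 i3 i4.
have j1 := cwintegrableZ (x * x^*%C) i1; have j2 := cwintegrableZ (x * y^*%C) i2.
have j3 := cwintegrableZ (y * x^*%C) i3; have j4 := cwintegrableZ (y * y^*%C) i4.
have := cwintD (cwintegrableD j1 j2) (cwintegrableD j3 j4).
rewrite (cwintD j1 j2) (cwintD j3 j4) (cwintZ _ i1) (cwintZ _ i2) (cwintZ _ i3) (cwintZ _ i4) => <-.
apply: eq_cwint => z _; rewrite conjcD !conjcM; ring.
Qed.

Lemma cwint_sqr f : cwint (fun z => f z * (f z)^*%C) = (wint (fun z => cmod (f z) ^+ 2))%:C.
Proof. by rewrite -cwint_real //; apply: eq_cwint => z _; rewrite mulcJ_cmod. Qed.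

Lemma mem_numrange f (x : R[i]) : bergman alpha f -> 0 < normsq alpha f ->
  cwint (fun z => psi z * (f (lam * z) * (f z)^*%C)) = x * (normsq alpha f)%:C ->
  numrange alpha T x.
Proof.
move=> bf nu0 e; pose s : R := (Num.sqrt (normsq alpha f))^-1.
have ss : s * s * normsq alpha f = 1.
  rewrite -expr2 exprVn sqr_sqrtr ?ltW // mulVf // gt_eqF //.
(* The zero summand puts the normalized multiple in the form of [bergman_lin]. *)
exists (fun z => s%:C * f z + 0 * f z).
  split; first exact: bergman_lin.
  rewrite normsqE -ss normsqE; move: bf => /bergmanP[_ f2].
  rewrite -(wintZ _ f2); apply: eq_wint => z _.
  by rewrite mul0r addr0 cmodM cmod_real exprMn real_normK ?num_real // expr2.
rewrite innerT /S; transitivity ((s * s)%:C * (x * (normsq alpha f)%:C)); last first.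
  by rewrite mulrCA -rmorphM /= ss rmorph1 mulr1.
rewrite -e -(cwintZ _ (iS bf bf)); apply: eq_cwint => z _.
by rewrite !mul0r !addr0 conjcM conjc_real rmorphM /=; ring.
Qed.

(* The two-dimensional core of the Toeplitz-Hausdorff theorem: a, b, c, d are the
   entries of the form and p the inner product of the two unit vectors. *)
Lemma two_by_two (a b c d p : R[i]) (t : R) : 0 <= t <= 1 ->
  exists (x y : R[i]) (N : R), [/\ 0 < N,
    x * x^*%C + x * y^*%C * p + (y * x^*%C * p^*%C + y * y^*%C) = N%:C &
    x * x^*%C * a + x * y^*%C * c + (y * x^*%C * d + y * y^*%C * b) =
      (t%:C * a + (1 - t)%:C * b) * N%:C].
Proof.
move=> /andP[t0 t1]; have [ab|ab] := eqVneq a b.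
  exists 1, 0, 1; split => //; rewrite ?conjc1 ?conjc0 ?(mul0r, mulr0, addr0, mul1r, mulr1) //.
  by rewrite ab rmorphB rmorph1 mulrBl mul1r addrC subrK.
have ab' : a - b != 0 by rewrite subr_eq0.
(* Subtracting b times the inner product and dividing by a - b normalizes the diagonal entries to 1
   and 0; the target becomes t. *)
pose c' := (c - b * p) / (a - b); pose d' := (d - b * p^*%C) / (a - b).
have [m m1 mr] : exists2 m : R[i], cmod m = 1 & Im (m^*%C * c' + m * d') = 0.
  (* The imaginary part to be annulled is linear in the real coordinates of m, with zero set the
     real line through this w; for w = 0 every m works. *)
  pose w : R[i] := (Re c' - Re d') +i* (Im c' + Im d').
  have [w0|w0] := eqVneq w 0.
    exists 1; first exact: cmod1.
    by rewrite conjc1 !mul1r ImD; move: w0 => /(congr1 (@complex.Im R)).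
  exists (w / (cmod w)%:C).
    by rewrite cmodM cmodV cmod_real ger0_norm ?cmod_ge0 // divff // cmod_eq0.
  have -> : (w / (cmod w)%:C) = (cmod w)^-1%:C * w by rewrite mulrC fmorphV.
  have gen (q : R) (z1 z2 : R[i]) :
      Im ((q%:C * ((Re z1 - Re z2) +i* (Im z1 + Im z2)))^*%C * z1 +
          q%:C * ((Re z1 - Re z2) +i* (Im z1 + Im z2)) * z2) = 0.
    by case: z1 => c1 c2; case: z2 => d1 d2 /=; ring.
  exact: gen.
(* The phase is determined up to sign. The sign making Re(conj(m) p) nonnegative keeps the squared
   norm N positive along the whole path below. *)
have [mu mu1 [mur mup]] : exists2 m : R[i], cmod m = 1 &
    Im (m^*%C * c' + m * d') = 0 /\ 0 <= Re (m^*%C * p).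
  have [h|h] := leP 0 (Re (m^*%C * p)); first by exists m.
  exists (- m); first by rewrite cmodN.
  rewrite (rmorphN (@conjc R)) !mulNr -opprD ImN ReN /= mr oppr0; split => //.
  by rewrite oppr_ge0 ltW.
pose r := Re (mu^*%C * c' + mu * d'); pose ka := Re (mu^*%C * p).
(* Along the vectors with coordinates s and (1 - s) mu, this is the normalized form minus t times
   the squared norm. It equals -t at s = 0 and 1 - t at s = 1, so it has a root between. *)
pose Q : {poly R} := 'X * 'X + r *: ('X * (1 - 'X)) -
  t *: ('X * 'X + (1 - 'X) * (1 - 'X) + (2 * ka) *: ('X * (1 - 'X))).
have QE s : Q.[s] = s * s + r * (s * (1 - s)) -
    t * (s * s + (1 - s) * (1 - s) + 2 * ka * (s * (1 - s))).
  by rewrite /Q !(hornerE, hornerX, hornerZ).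
have Q01 : Q.[0] <= 0 <= Q.[1] by rewrite !QE; apply/andP; split; lra.
have [s /andP[s0 s1] /rootP Qs] := poly_ivt ler01 Q01.
pose N := s * s + (1 - s) * (1 - s) + 2 * ka * (s * (1 - s)).
have N0 : 0 < N.
  have : 0 <= 2 * ka * (s * (1 - s)) by rewrite !mulr_ge0 // subr_ge0.
  have : 0 <= (s - (1 - s)) * (s - (1 - s)) by rewrite -expr2 sqr_ge0.
  by rewrite /N; lra.
exists s%:C, ((1 - s)%:C * mu), N.
have mumu : mu * mu^*%C = 1 by rewrite mulcJ_cmod mu1 expr1n rmorph1.
have kaE : mu^*%C * p + mu * p^*%C = (2 * ka)%:C.
  have gen (z1 z2 : R[i]) : z1^*%C * z2 + z1 * z2^*%C = (2 * Re (z1^*%C * z2))%:C.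
    by case: z1 => m1' m2; case: z2 => p1 p2; apply: complex_inj => /=; ring.
  exact: gen.
have rE : mu^*%C * c' + mu * d' = r%:C by apply: complex_inj.
have NE : N%:C = s%:C * s%:C + (1 - s)%:C * (1 - s)%:C + (2 * ka)%:C * (s%:C * (1 - s)%:C).
  by rewrite /N; rewrite !(rmorphD, rmorphM).
have H1 : s%:C * (s%:C)^*%C + s%:C * ((1 - s)%:C * mu)^*%C * p +
  ((1 - s)%:C * mu * (s%:C)^*%C * p^*%C + (1 - s)%:C * mu * ((1 - s)%:C * mu)^*%C) = N%:C.
  rewrite conjcM !conjc_real NE -kaE; set u := (1 - s)%:C.
  transitivity (s%:C * s%:C + u * u * (mu * mu^*%C) + (mu^*%C * p + mu * p^*%C) * (s%:C * u)).
    by ring.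
  by rewrite mumu mulr1.
split => //.
have cE : c = c' * (a - b) + b * p by rewrite /c' divfK // subrK.
have dE : d = d' * (a - b) + b * p^*%C by rewrite /d' divfK // subrK.
have Qs' : s%:C * s%:C + r%:C * (s%:C * (1 - s)%:C) = t%:C * N%:C.
  apply/eqP; rewrite -subr_eq0 -!rmorphM -rmorphD -rmorphB /=; apply/eqP.
  by rewrite -[RHS](rmorph0 (real_complex R)) -Qs QE.
rewrite {1}cE {1}dE -[in RHS]H1.
rewrite conjcM !conjc_real; set u := (1 - s)%:C.
transitivity (b * (s%:C * s%:C + u * u * (mu * mu^*%C) + (mu^*%C * p + mu * p^*%C) * (s%:C * u)) +
  (a - b) * (s%:C * s%:C + (mu^*%C * c' + mu * d') * (s%:C * u))).
  by ring.
rewrite rE Qs' -H1 conjcM !conjc_real -/u rmorphB rmorph1; ring.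
Qed.

Lemma numrange_convex (A B : R[i]) (t : R) : 0 <= t <= 1 ->
  numrange alpha T A -> numrange alpha T B -> numrange alpha T (t%:C * A + (1 - t)%:C * B).
Proof.
move=> t01 [f [bf nf] <-] [h [bh nh] <-].
have [x [y [N [N0 NE QE]]]] := two_by_two (inner alpha (T f) f) (inner alpha (T h) h)
  (S f h) (S h f) (P f h) t01.
have bF := bergman_lin x y bf bh.
have Pff : P f f = 1 by rewrite /P cwint_sqr -normsqE nf.
have Phh : P h h = 1 by rewrite /P cwint_sqr -normsqE nh.
have Phf : P h f = (P f h)^*%C.
  have [i1 i2] := iP bf bh.
  rewrite /P; apply: complex_inj; rewrite /=.
    by apply: eq_wint => z _; case: (f z) => f1 f2; case: (h z) => h1 h2 /=; ring.
  rewrite -mulN1r -(wintZ _ i2); apply: eq_wint => z _.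
  by case: (f z) => f1 f2; case: (h z) => h1 h2 /=; ring.
have NF : normsq alpha (fun z => x * f z + y * h z) = N.
  apply: (@complexI R); rewrite normsqE -cwint_sqr.
  rewrite (expand_sesquilinear _ _ (iP bf bf) (iP bf bh) (iP bh bf) (iP bh bh)).
  by rewrite -!/(P _ _) Pff Phh Phf !mulr1.
apply: (mem_numrange bF); rewrite NF //.
have ass u v : cwintegrable (fun z => psi z * (u (lam * z) * (v z)^*%C)) ->
    cwintegrable (fun z => psi z * u (lam * z) * (v z)^*%C).
  by apply: eq_cwintegrable => z _; rewrite mulrA.
have := @expand_sesquilinear f h (fun z => psi z * f (lam * z)) (fun z => psi z * h (lam * z)) x y
  (ass _ _ (iS bf bf)) (ass _ _ (iS bf bh)) (ass _ _ (iS bh bf)) (ass _ _ (iS bh bh)).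
have SE u v : cwint (fun z => psi z * u (lam * z) * (v z)^*%C) = S u v.
  by apply: eq_cwint => z _; rewrite mulrA.
rewrite !SE -!innerT QE => <-.
by apply: eq_cwint => z _; ring.
Qed.

End Operator.

Lemma numrange_kernel (n k : nat) (lam w : R[i]) (g : R[i] -> R[i]) (M : R) :
  (0 < n)%N -> cmod lam = 1 -> lam ^+ n = 1 -> cmod w < 1 ->
  (forall z, cmod z < 1 -> exists D, cderiv g z D) ->
  (forall z, cmod z < 1 -> cmod (g z) <= M) ->
  numrange alpha (wcomp (fun z => g (z ^+ n)) (fun z => lam * z)) (lam ^+ k * g (w ^+ n)).
Proof.
move=> n0 lam1 lamn w1 ag gM.
have Xn1 (z : R[i]) : cmod z < 1 -> cmod (z ^+ n) < 1.
  by move=> z1; rewrite cmodX exprn_ilt1 ?cmod_ge0 // -lt0n.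
have cpsi : disc_continuous (fun z => g (z ^+ n)).
  move=> z z1; have [D1 d1] := cderivX n z; have [D2 d2] := ag _ (Xn1 z z1).
  exact: cderiv_continuous (cderiv_comp d1 d2).
have psiM z : cmod z < 1 -> cmod (g (z ^+ n)) <= M by move=> z1; exact/gM/Xn1.
have [f [af [K fK] frot [nu nu0 fnu] fm]] := eigen_kernel k alphaN1 n0 (Xn1 w w1).
have cf := analytic_disc_continuous af.
have bf : bergman alpha f.
  apply/bergmanP; split => //.
  have mF : disc_measurable (fun z => cmod (f z) ^+ 2).
    have := disc_measurable_Re (disc_continuousM cf (disc_continuousJ cf)).
    by apply: eq_measurable_fun => p _; rewrite mulcJ_cmod.
  apply: (wintegrable_bounded alphaN1 (M := K ^+ 2) mF) => z z1.
  rewrite ger0_norm ?exprn_ge0 ?cmod_ge0 // lerXn2r ?nnegrE ?cmod_ge0 ?fK //.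
  by apply: le_trans (fK z z1); exact: cmod_ge0.
have nf : normsq alpha f = nu.
  by apply: (@complexI R); rewrite normsqE -cwint_sqr.
apply: (mem_numrange lam1 cpsi psiM bf); rewrite nf //.
have rep := cwint_reproducing alphaN1 n0 (Xn1 w w1) cf fK fm ag gM.
rewrite -fnu -mulrA -rep.
have iq : cwintegrable (fun z => g (z ^+ n) * (f z * (f z)^*%C)).
  have := cwintegrable_bergman bf bf cpsi psiM (@cmod1 R) (@cmod1 R).
  by apply: eq_cwintegrable => z _; rewrite !mul1r.
by rewrite -(cwintZ _ iq); apply: eq_cwint => z _; rewrite frot //; ring.
Qed.

End NumericalRange.

(** * Convex sets in the plane *)

Section Separation.
Context {R : realType}.
Variable K : set R[i].
Hypothesis convK : forall A B (t : R), 0 <= t <= 1 -> K A -> K B -> K (t%:C * A + (1 - t)%:C * B).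
Hypothesis K0 : ~ K 0.

(** The segment from p to q meets the real axis; the second identity locates the crossing point
    without a division. *)
Let cross p q : K p -> K q -> 0 < Im p -> Im q < 0 ->
  exists2 z, K z & Im z = 0 /\ (Im p - Im q) * Re z = - Im q * Re p + Im p * Re q.
Proof.
move=> Kp Kq p0 q0; pose t := - Im q / (Im p - Im q).
have d0 : 0 < Im p - Im q by lra.
have t01 : 0 <= t <= 1.
  by rewrite divr_ge0 ?(ltW d0) ?oppr_ge0 ?(ltW q0) //= ler_pdivrMr // mul1r; lra.
have dt : (Im p - Im q) * t = - Im q by rewrite mulrC divfK // gt_eqF.
exists (t%:C * p + (1 - t)%:C * q); first exact: convK.
rewrite ImD !ImM ReD !ReM /= !mul0r !subr0 !addr0; split.
  apply: (mulfI (lt0r_neq0 d0)); rewrite mulr0.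
  have -> : (Im p - Im q) * (t * Im p + (1 - t) * Im q) =
    (Im p - Im q) * t * (Im p - Im q) + (Im p - Im q) * Im q by ring.
  by rewrite dt; ring.
have -> : (Im p - Im q) * (t * Re p + (1 - t) * Re q) =
  (Im p - Im q) * t * (Re p - Re q) + (Im p - Im q) * Re q by ring.
by rewrite dt; ring.
Qed.

(** The trace of K on the real axis is convex and misses 0, so it lies on one side; s records
    which. *)
Let real_sign : exists2 s : R, s = 1 \/ s = -1 & forall z, K z -> Im z = 0 -> 0 < s * Re z.
Proof.
have n0 z : K z -> Im z = 0 -> Re z != 0.
  by move=> Kz i0; apply/eqP => r0; apply: K0; rewrite -(_ : z = 0) //; exact: complex_inj.
have [[z Kz [iz rz]]|no] := pselect (exists2 z, K z & Im z = 0 /\ Re z < 0).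
  exists (-1); first by right.
  move=> w Kw iw; rewrite mulN1r oppr_gt0; have := n0 w Kw iw; rewrite neq_lt => /orP[//|rw].
  exfalso; apply: K0; pose t := Re w / (Re w - Re z).
  have d0 : 0 < Re w - Re z by lra.
  have t01 : 0 <= t <= 1.
    by rewrite divr_ge0 ?(ltW d0) ?(ltW rw) //= ler_pdivrMr // mul1r; lra.
  have dt : (Re w - Re z) * t = Re w by rewrite mulrC divfK // gt_eqF.
  rewrite -(_ : t%:C * z + (1 - t)%:C * w = 0); first exact: convK.
  apply: complex_inj; rewrite ?ReD ?ImD ?ReM ?ImM /= !mul0r ?subr0 ?addr0; last first.
    by rewrite iz iw !mulr0 addr0.
  have -> : t * Re z + (1 - t) * Re w = Re w - (Re w - Re z) * t by ring.
  by rewrite dt subrr.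
exists 1; first by left.
move=> w Kw iw; rewrite mul1r; have := n0 w Kw iw; rewrite neq_lt => /orP[rw|//].
by exfalso; apply: no; exists w.
Qed.

(* A convex set need not be closed, so a second functional is needed to break
   ties on the supporting line. *)
Lemma separation : exists a b a' b' : R, forall z, K z ->
  0 <= a * Re z + b * Im z /\ (a * Re z + b * Im z = 0 -> 0 < a' * Re z + b' * Im z).
Proof.
have [s _ hs] := real_sign.
have [[p0 Kp0 ip0]|noP] := pselect (exists2 p, K p & 0 < Im p); last first.
  (* K lies in the closed lower half-plane; ties on the real axis are broken by s Re. *)
  exists 0, (-1), s, 0 => z Kz; rewrite !mul0r !add0r addr0 mulN1r.
  have iz : Im z <= 0 by rewrite leNgt; apply/negP => h; apply: noP; exists z.
  rewrite oppr_ge0; split => // /eqP; rewrite oppr_eq0 => /eqP; exact: hs.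
have [[q0 Kq0 iq0]|noQ] := pselect (exists2 q, K q & Im q < 0); last first.
  exists 0, 1, s, 0 => z Kz; rewrite !mul0r !add0r addr0 mul1r.
  have iz : 0 <= Im z by rewrite leNgt; apply/negP => h; apply: noQ; exists z.
  by split => //; exact: hs.
(* Otherwise the segment from p to q would cross the real axis at 0 or on the wrong side of it. *)
have lt_slope p q : K p -> K q -> 0 < Im p -> Im q < 0 -> s * Re q / Im q < s * Re p / Im p.
  move=> Kp Kq ip iq; have [z Kz [iz e]] := cross Kp Kq ip iq.
  have d0 : 0 < Im p - Im q by lra.
  have : 0 < (Im p - Im q) * (s * Re z) by rewrite mulr_gt0 // hs.
  have -> : (Im p - Im q) * (s * Re z) = s * ((Im p - Im q) * Re z) by ring.
  rewrite e => h; rewrite ltr_pdivlMr // mulrAC ltr_ndivrMr //; lra.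
(* The inverse slopes from below stay strictly under those from above. Their supremum c gives the
   supporting line s Re = c Im. *)
pose E : set R := [set x | exists2 q, K q & Im q < 0 /\ x = s * Re q / Im q].
have supE : has_sup E.
  split; first by exists (s * Re q0 / Im q0), q0.
  by exists (s * Re p0 / Im p0) => _ [q Kq [iq ->]]; apply/ltW/lt_slope.
pose c := sup E.
have cq q : K q -> Im q < 0 -> s * Re q / Im q <= c.
  by move=> Kq iq; apply: sup_upper_bound => //; exists q.
have cp p : K p -> 0 < Im p -> c <= s * Re p / Im p.
  move=> Kp ip; apply: ge_sup; first by exists (s * Re q0 / Im q0), q0.
  by move=> _ [q Kq [iq ->]]; apply/ltW/lt_slope.
have main z : K z -> 0 <= s * Re z + - c * Im z.
  move=> Kz; have [iz|iz|iz] := ltgtP (Im z) 0.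
  - by have := cq z Kz iz; rewrite ler_ndivrMr //; lra.
  - by have := cp z Kz iz; rewrite ler_pdivlMr //; lra.
  - by rewrite iz mulr0 addr0 ltW // hs.
(* The strict inequality of inverse slopes forbids K to touch the supporting line both above and
   below the real axis. Hence Im or -Im breaks the tie, according to the side that is touched. *)
have [[p Kp [ip ep]]|no] := pselect (exists2 p, K p & 0 < Im p /\ s * Re p + - c * Im p = 0).
  exists s, (- c), 0, 1 => z Kz; split; first exact: main.
  rewrite mul0r add0r mul1r => ez; have [iz|//|iz] := ltgtP (Im z) 0.
    have slope u : Im u != 0 -> s * Re u + - c * Im u = 0 -> s * Re u / Im u = c.
      by move=> u0 eu; rewrite (_ : s * Re u = c * Im u) ?mulfK //; lra.
    have := lt_slope p z Kp Kz ip iz.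
    by rewrite (slope z (ltr0_neq0 iz) ez) (slope p (lt0r_neq0 ip) ep) ltxx.
  by have := hs z Kz iz; move: ez; rewrite iz mulr0 addr0 => ->; rewrite ltxx.
exists s, (- c), 0, (-1) => z Kz; split; first exact: main.
rewrite mul0r add0r mulN1r oppr_gt0 => ez; have [//|iz|iz] := ltgtP (Im z) 0.
  by exfalso; apply: no; exists z.
by have := hs z Kz iz; move: ez; rewrite iz mulr0 addr0 => ->; rewrite ltxx.
Qed.

End Separation.

(** * Convex hulls as sets of finite convex combinations *)

Section ConvexHull.
Context {R : realType}.
Implicit Types S : set R[i].

Lemma sub_convex_hull S z : S z -> convex_hull S z.
Proof.
move=> Sz; exists 1%N, (fun=> z), (fun=> 1); split => //; rewrite ?big_ord1 //.
by rewrite rmorph1 mul1r.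
Qed.

Lemma convex_hull_convex S A B (t : R) : 0 <= t <= 1 ->
  convex_hull S A -> convex_hull S B -> convex_hull S (t%:C * A + (1 - t)%:C * B).
Proof.
move=> /andP[t0 t1] [m [w [a [a0 a1 Sw ->]]]] [m' [w' [a' [a'0 a'1 Sw' ->]]]].
exists (m + m')%N, (fun i => match fintype.split i with inl j => w j | inr j => w' j end),
  (fun i => match fintype.split i with inl j => t * a j | inr j => (1 - t) * a' j end).
have sl i : fintype.split (lshift m' i) = inl i :> 'I_m + 'I_m' by exact: (unsplitK (inl i)).
have sr i : fintype.split (rshift m i) = inr i :> 'I_m + 'I_m' by exact: (unsplitK (inr i)).
split.
- by move=> i; case: fintype.split => j; rewrite mulr_ge0 // subr_ge0.
- rewrite big_split_ord /= (eq_bigr (fun j => t * a j)); last by move=> j _; rewrite sl.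
  rewrite [X in _ + X](eq_bigr (fun j => (1 - t) * a' j)); last by move=> j _; rewrite sr.
  by rewrite -!mulr_sumr a1 a'1 !mulr1 addrC subrK.
- by move=> i; case: fintype.split.
- rewrite big_split_ord /= !mulr_sumr; congr (_ + _); apply: eq_bigr => j _.
    by rewrite sl rmorphM mulrA.
  by rewrite sr rmorphM mulrA.
Qed.

(** Induction on the number of points: the first is split off and the remaining weights are rescaled
    by 1 - a_0. When a_0 = 1 they all vanish and no rescaling takes place. *)
Lemma convex_hull_sub S (W : set R[i]) :
  (forall A B (t : R), 0 <= t <= 1 -> W A -> W B -> W (t%:C * A + (1 - t)%:C * B)) ->
  S `<=` W -> convex_hull S `<=` W.
Proof.
move=> cW SW z [m [w [a [a0 a1 Sw ->]]]].
elim: m w a a0 a1 Sw => [|m IH] w a a0 a1 Sw; first by move: a1; rewrite big_ord0 => /eqP; rewrite eq_sym oner_eq0.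
move: a1; rewrite !big_ord_recl /= => a1.
have [a01|a01] := eqVneq (a ord0) 1.
  have z0 (i : 'I_m) : a (lift ord0 i) = 0.
    have s0 : \sum_(i < m) a (lift ord0 i) = 0 by move: a1; rewrite a01; lra.
    by move/psumr_eq0P: s0 => /(_ (fun i _ => a0 _)) /(_ i isT).
  rewrite a01 big1 ?addr0 ?rmorph1 ?mul1r; first exact/SW/Sw.
  by move=> i _; rewrite z0 rmorph0 mul0r.
have s1 : 1 - a ord0 = \sum_(i < m) a (lift ord0 i) by rewrite -a1 addrC addKr.
have a0le1 : a ord0 <= 1.
  by rewrite -subr_ge0 s1; apply: sumr_ge0 => i _; exact: a0.
have d0 : 0 < 1 - a ord0 by rewrite lt_neqAle subr_ge0 a0le1 andbT eq_sym subr_eq0 eq_sym.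
have dC : (1 - a ord0)%:C != 0 :> R[i] by rewrite -cmod_eq0 cmod_real normr_eq0 gt_eqF.
rewrite (_ : \sum_(i < m) _ = (1 - a ord0)%:C *
    \sum_(i < m) (a (lift ord0 i) / (1 - a ord0))%:C * w (lift ord0 i)); last first.
  rewrite mulr_sumr; apply: eq_bigr => i _.
  by rewrite mulrA -rmorphM /= mulrCA divff ?mulr1 // gt_eqF.
apply: cW; [by rewrite a0|exact/SW/Sw|].
apply: (IH (fun i => w (lift ord0 i)) (fun i => a (lift ord0 i) / (1 - a ord0))) => //.
- by move=> i; rewrite divr_ge0 // ltW.
- by rewrite -mulr_suml -s1 divff // gt_eqF.
Qed.

End ConvexHull.

(** * Fourier components *)

Section FourierComponents.
Context {R : realType}.
Variable n : nat.
Hypothesis n0 : (0 < n)%N.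

Notation lam := (@root_unity R n).

Lemma root_unity_cis : lam = cis (2 * pi / n%:R).
Proof. by rewrite cisE. Qed.

Lemma cmod_root_unity : cmod lam = 1.
Proof. by rewrite root_unity_cis cmod_cis. Qed.

Let nR : n%:R != 0 :> R. Proof. by rewrite pnatr_eq0 -lt0n. Qed.

Let cis2pi : cis (2 * pi) = 1 :> R[i].
Proof. by rewrite mulr_natl -cisX cis_pi sqrrN expr1n. Qed.

(** If lam^e = 1 with 0 < e < n, then cos(2x) = 1 for x = pi e / n in (0, pi), although sin x > 0
    there. *)
Lemma root_unity_primitive : n.-primitive_root lam.
Proof.
have lamX e : lam ^+ e = cis (2 * pi / n%:R *+ e) by rewrite root_unity_cis cisX.
apply/andP; split => //; apply/forallP => i; apply/eqP.
rewrite unity_rootE lamX; have [->|ne] := eqVneq i.+1 n.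
  by rewrite -(mulr_natr (2 * pi / _)) divfK // cis2pi eqxx.
apply/negbTE; apply/eqP => h.
have i_n : (i.+1 < n)%N by rewrite ltn_neqAle ne ltn_ord.
pose x : R := pi * (i.+1%:R / n%:R).
have hx : 2 * pi / n%:R *+ i.+1 = x *+ 2.
  by rewrite -(mulr_natr (2 * pi / _)) -(mulr_natr x) /x; ring.
have : cos (x *+ 2) = 1 by move: h; rewrite hx cisE => -[].
have iR : 0 < i.+1%:R / n%:R :> R by rewrite divr_gt0 ?ltr0n.
have iR1 : i.+1%:R / n%:R < 1 :> R by rewrite ltr_pdivrMr ?ltr0n // mul1r ltr_nat.
have x0 : 0 < x by rewrite mulr_gt0 ?pi_gt0.
have xpi : x < pi by rewrite /x gtr_pMr ?pi_gt0.
have sx : 0 < sin x by apply: sin_gt0_pi; rewrite x0 xpi.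
have s2 : 0 < sin x ^+ 2 by rewrite exprn_gt0.
by rewrite cos_mulr2n; have := cos2Dsin2 x; lra.
Qed.

Lemma root_unityXn : lam ^+ n = 1.
Proof. exact: prim_expr_order root_unity_primitive. Qed.

Let nC : n%:R != 0 :> R[i]. Proof. by rewrite pnatr_eq0 -lt0n. Qed.

Definition fourier_component (f : R[i] -> R[i]) k z : R[i] :=
  n%:R^-1 * \sum_(j < n) (lam^*%C ^+ j) ^+ k * f (lam ^+ j * z).

Let lamJ : lam * lam^*%C = 1.
Proof. by rewrite mulcJ_cmod cmod_root_unity expr1n rmorph1. Qed.

Let lamXJ j : lam ^+ j * lam^*%C ^+ j = 1.
Proof. by rewrite -exprMn lamJ expr1n. Qed.

Lemma sum_root_unity (m : R[i]) : m ^+ n = 1 ->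
  \sum_(k < n) m ^+ k = if m == 1 then n%:R else 0.
Proof.
move=> mn; case: eqVneq => [->|m1].
  by under eq_bigr do rewrite expr1n; rewrite sumr_const card_ord.
have := subrX1 m n; rewrite mn subrr => /esym/eqP.
by rewrite mulf_eq0 subr_eq0 (negbTE m1) => /eqP.
Qed.

(** A pointwise identity. In the expanded square the sum over k runs over powers of an n-th root of
    unity and leaves only i congruent to s + j modulo n. The shift s = 0 gives the norm, and s = 1
    the quadratic form of the operator. *)
Lemma fourier_parseval f s z :
  \sum_(k < n) lam ^+ (s * k) * (fourier_component f k z * (fourier_component f k z)^*%C) =
  n%:R^-1 * \sum_(j < n) f (lam ^+ s * (lam ^+ j * z)) * (f (lam ^+ j * z))^*%C.
Proof.
pose x j := f (lam ^+ j * z).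
pose m (i j : nat) := lam ^+ s * lam^*%C ^+ i * lam ^+ j.
have mn i j : m i j ^+ n = 1.
  by rewrite !exprMn -!exprM !(mulnC _ n) !exprM -conjcX root_unityXn conjc1 !expr1n !mulr1.
have m1 (i : 'I_n) (j : nat) : (m i j == 1) = (nat_of_ord i == ((s + j) %% n)%N).
  have -> : (m i j == 1) = (lam ^+ (s + j)%N == lam ^+ i).
    apply/eqP/eqP => h.
      by rewrite -[RHS]mulr1 -h /m exprD -!mulrA [_ ^+ i * _]mulrCA (mulrA (lam ^+ i)) lamXJ mul1r.
    by rewrite /m mulrAC -exprD h lamXJ.
  by rewrite (eq_prim_root_expr root_unity_primitive) eq_sym (modn_small (ltn_ord i)).
have step k : lam ^+ (s * k) * (fourier_component f k z * (fourier_component f k z)^*%C) =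
    \sum_(j < n) \sum_(i < n) n%:R^-1 * n%:R^-1 * (x i * (x j)^*%C) * m i j ^+ k.
  have nJ : (n%:R^-1 : R[i])^*%C = n%:R^-1 by rewrite conjc_inv conjc_nat.
  rewrite /fourier_component conjcM nJ conjc_sum mulrACA big_distrlr exchange_big !mulr_sumr.
  apply: eq_bigr => j _; rewrite !mulr_sumr; apply: eq_bigr => i _.
  rewrite conjcM !conjcX conjcK /m !exprMn exprM -/(x i) -/(x j).
  rewrite [Monoid.MulLaw.sort _ _ _](erefl (_ * _)); ring.
under eq_bigr do rewrite step.
rewrite exchange_big /= mulr_sumr; apply: eq_bigr => j _.
rewrite exchange_big /=.
under eq_bigr do rewrite -mulr_sumr (sum_root_unity (mn _ _)) m1.
pose i0 : 'I_n := Ordinal (ltn_pmod (s + j) n0).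
rewrite (bigD1 i0) //= eqxx big1 ?addr0; last first.
  by move=> i ii; rewrite ifN ?mulr0 //; apply: contraNN ii => /eqP e; apply/eqP/val_inj.
have -> : x ((s + j) %% n)%N = f (lam ^+ s * (lam ^+ j * z)).
  by rewrite /x (prim_expr_mod root_unity_primitive) exprD mulrA.
by rewrite mulrAC divfK.
Qed.

End FourierComponents.

(** * Means of functions with values in a convex set *)

Section ConvexMean.
Context {R : realType}.
Variable alpha : R.
Hypothesis alphaN1 : -1 < alpha.

Notation wint := (wint alpha).
Notation wintegrable := (wintegrable alpha).
Notation cwint := (cwint alpha).
Notation cwintegrable := (cwintegrable alpha).

Let T : measurableType _ := (measurableTypeR R * measurableTypeR R)%type.
Let mD : measurable (@discR2 R : set T) := @measurable_discR2 R.

Definition disc_ae (P : set R[i]) := (@area R).-negligible [set p | discR2 p /\ ~ P (toC p)].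

Lemma disc_ae_sub (P Q : set R[i]) : (forall z, cmod z < 1 -> P z -> Q z) ->
  disc_ae P -> disc_ae Q.
Proof.
move=> PQ; apply: negligibleS => p [hp nq]; split => // Pp; apply: nq.
by apply: PQ Pp; apply/discR2P.
Qed.

Lemma disc_aeI (P Q : set R[i]) : disc_ae P -> disc_ae Q -> disc_ae (P `&` Q).
Proof.
move=> aP aQ; apply: negligibleS (negligibleU aP aQ) => p [hp /not_andP[]] h; [left|right]; by split.
Qed.

Lemma eq_wint_ae u v : wintegrable u -> wintegrable v -> disc_ae [set z | u z = v z] ->
  wint u = wint v.
Proof.
move=> iu iv uv; rewrite /wint /Rintegral; congr fine.
apply: (@ae_eq_integral _ T R (@area R) _ (fun p => (v (toC p) * weight alpha p)%:E)
  (fun p => (u (toC p) * weight alpha p)%:E) mD (measurable_int _ iu) (measurable_int _ iv)).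
apply: negligibleS uv => p /= /not_implyP[hp ne]; split => // e; apply: ne.
by rewrite e.
Qed.

Lemma wint_ae_eq0 u : wintegrable u -> disc_ae [set z | 0 <= u z] -> wint u = 0 ->
  disc_ae [set z | u z = 0].
Proof.
move=> iu u0 wu.
have iau : wintegrable (fun z => `|u z|).
  have := integrable_abse iu; apply: eq_integrable => // p; rewrite inE => hp /=.
  by rewrite normrM (ger0_norm (weight_ge0 alphaN1 _)).
have wa : wint (fun z => `|u z|) = 0.
  rewrite -wu; apply: eq_wint_ae => //.
  by apply: disc_ae_sub u0 => z _ /= h; rewrite ger0_norm.
have := wint_eq0_ae alphaN1 iau (fun z _ => normr_ge0 _) wa.
by apply: negligibleS => p [hp /= ne]; split => //; rewrite normr_eq0; apply/eqP.
Qed.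

Let lin (a b : R) (z : R[i]) : R := a * Re z + b * Im z.

Let wint_lin a b h : cwintegrable h ->
  wintegrable (fun z => lin a b (h z)) /\ (cwint h = 0 -> wint (fun z => lin a b (h z)) = 0).
Proof.
move=> [h1 h2]; split; first exact: (wintegrableD (wintegrableZ a h1) (wintegrableZ b h2)).
move=> [e1 e2]; rewrite (wintD (wintegrableZ a h1) (wintegrableZ b h2)) !wintZ //.
by rewrite e1 e2 !mulr0 addr0.
Qed.

Let lin_sum a b n (F : 'I_n -> R[i]) : lin a b (\sum_(k < n) F k) = \sum_(k < n) lin a b (F k).
Proof.
elim/big_ind2 : _ => //; first by rewrite /lin /= !mulr0 addr0.
by move=> x1 x2 y1 y2 <- <-; rewrite /lin ReD ImD; ring.
Qed.

Let linZ a b (x : R) (z : R[i]) : lin a b (x%:C * z) = x * lin a b z.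
Proof. by rewrite /lin ReM ImM /=; ring. Qed.

(* Both separating functionals have mean zero against the weights q k. The first is
   nonnegative, hence zero almost everywhere where q k is nonzero; there the second
   one is positive, which forces the q k to vanish. *)
Lemma convex_mean n (c : 'I_n -> R[i] -> R[i]) (q : 'I_n -> R[i] -> R) (K : set R[i]) :
  (forall A B (t : R), 0 <= t <= 1 -> K A -> K B -> K (t%:C * A + (1 - t)%:C * B)) ->
  (forall k z, cmod z < 1 -> K (c k z)) -> (forall k z, 0 <= q k z) ->
  (forall k, wintegrable (q k)) -> (forall k, cwintegrable (fun z => (q k z)%:C * c k z)) ->
  \sum_(k < n) wint (q k) = 1 -> K (\sum_(k < n) cwint (fun z => (q k z)%:C * c k z)).
Proof.
move=> cK Kc q0 iq iqc q1; apply: contrapT; set z0 := \sum_(k < n) _ => nK.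
have conv0 A B (t : R) : 0 <= t <= 1 -> K (A + z0) -> K (B + z0) ->
    K (t%:C * A + (1 - t)%:C * B + z0).
  move=> t01 KA KB; have := cK _ _ t t01 KA KB; congr K.
  by rewrite rmorphB rmorph1; ring.
have [|a [b [a' [b' sep]]]] := @separation R [set z | K (z + z0)] conv0; first by rewrite /= add0r.
have icq k : cwintegrable (fun z => (q k z)%:C).
  by split; [exact: iq|exact: wintegrable_cst].
have iF k : cwintegrable (fun z => (q k z)%:C * c k z + - z0 * (q k z)%:C).
  exact: (cwintegrableD (iqc k) (cwintegrableZ (- z0) (icq k))).
(* H is the sum of the q_k (c_k - z0); its integral vanishes because the q_k have total mass 1. *)
pose H z := \sum_(k < n) ((q k z)%:C * c k z + - z0 * (q k z)%:C).
have [iH wH] := cwintegrable_sum alphaN1 iF.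
have {}wH : cwint H = 0.
  rewrite wH; under eq_bigr do rewrite (cwintD (iqc _) (cwintegrableZ (- z0) (icq _))) (cwintZ _ (icq _)) cwint_real //.
  by rewrite big_split /= -mulr_sumr -rmorph_sum /= q1 rmorph1 mulr1 subrr.
have linH x y z : lin x y (H z) = \sum_(k < n) q k z * lin x y (c k z - z0).
  by rewrite lin_sum; apply: eq_bigr => k _; rewrite -linZ; congr lin; ring.
have sepc k z : cmod z < 1 -> 0 <= lin a b (c k z - z0) /\
    (lin a b (c k z - z0) = 0 -> 0 < lin a' b' (c k z - z0)).
  by move=> z1; apply: sep; rewrite /= subrK; exact: Kc.
have zero x y z : (forall k, 0 <= q k z * lin x y (c k z - z0)) -> lin x y (H z) = 0 ->
    forall k, q k z = 0 \/ lin x y (c k z - z0) = 0.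
  move=> h /esym; rewrite linH => /esym/psumr_eq0P e k.
  have /eqP := e (fun k _ => h k) k isT.
  by rewrite mulf_eq0 => /orP[] /eqP; [left|right].
have [iU wU] := wint_lin a b iH; have [iV wV] := wint_lin a' b' iH.
have aeU : disc_ae [set z | lin a b (H z) = 0].
  apply: (wint_ae_eq0 iU _ (wU wH)); apply: (@negligibleS _ _ _ _ set0) (negligible_set0 _) => p [hp []].
  rewrite /= linH; apply: sumr_ge0 => k _; apply: mulr_ge0 => //.
  by have /discR2P/(sepc k)[] := hp.
have termV k z : cmod z < 1 -> lin a b (H z) = 0 -> 0 <= q k z * lin a' b' (c k z - z0).
  move=> z1 U0; have hk j : 0 <= q j z * lin a b (c j z - z0).
    by apply: mulr_ge0 => //; have [] := sepc j z z1.
  have [->|e] := zero a b z hk U0 k; first by rewrite mul0r.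
  by apply: mulr_ge0 => //; have [_ /(_ e)/ltW] := sepc k z z1.
have aeV : disc_ae [set z | lin a' b' (H z) = 0].
  apply: (wint_ae_eq0 iV _ (wV wH)); apply: disc_ae_sub aeU => z z1 /= U0.
  by rewrite linH; apply: sumr_ge0 => k _; exact: termV.
(* A nonzero q_k would force both functionals to vanish at c_k - z0, against the strict half of the
   separation. The total mass would then be 0 instead of 1. *)
have aeq : disc_ae [set z | \sum_(k < n) q k z = 0].
  apply: disc_ae_sub (disc_aeI aeU aeV) => z z1 [/= U0 V0]; apply: big1 => k _.
  have hk j : 0 <= q j z * lin a b (c j z - z0).
    by apply: mulr_ge0 => //; have [] := sepc j z z1.
  have [//|e] := zero a b z hk U0 k.
  have [//|e'] := zero a' b' z (fun j => termV j z z1 U0) V0 k.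
  by have [_ /(_ e)] := sepc k z z1; rewrite -/(lin a' b' _) e' ltxx.
have [iS wS] := wintegrable_sum alphaN1 iq.
have := eq_wint_ae iS (wintegrable_cst alphaN1 0) aeq.
rewrite wS q1 => e1.
have e2 : wint (fun=> 0) = 0.
  transitivity (wint (fun=> 0 * 0)); first by apply: eq_wint => z _; rewrite mul0r.
  by rewrite (wintZ 0 (wintegrable_cst alphaN1 0)) mul0r.
by move/eqP: e1; rewrite e2 oner_eq0.
Qed.

End ConvexMean.

(** * Averaging over the rotations *)

Section Average.
Context {R : realType}.
Variables (alpha : R) (n : nat).
Hypotheses (alphaN1 : -1 < alpha) (n0 : (0 < n)%N).

Notation lam := (@root_unity R n).
Notation wint := (wint alpha).
Notation wintegrable := (wintegrable alpha).
Notation cwint := (cwint alpha).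
Notation cwintegrable := (cwintegrable alpha).

Variable f : R[i] -> R[i].
Hypothesis bf : bergman alpha f.
Variables (psi : R[i] -> R[i]) (M : R).
Hypotheses (cpsi : disc_continuous psi) (psiM : forall z, cmod z < 1 -> cmod (psi z) <= M).
Hypothesis psi_lam : forall z, psi (lam * z) = psi z.

Let lamX j : cmod (lam ^+ j) = 1.
Proof. by rewrite cmodX cmod_root_unity expr1n. Qed.

Lemma cwintegrable_fourier_component k :
  cwintegrable (fun z => psi z * (fourier_component n f k z * (fourier_component n f k z)^*%C)).
Proof.
pose a (i : nat) := n%:R^-1 * (lam^*%C ^+ i) ^+ k.
have iij (i j : 'I_n) : cwintegrable (fun z => a i * (a j)^*%C *
    (psi z * (f (lam ^+ i * z) * (f (lam ^+ j * z))^*%C))).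
  exact: cwintegrableZ (cwintegrable_bergman bf bf cpsi psiM (lamX i) (lamX j)).
have [iS _] := cwintegrable_sum alphaN1 (fun i => (cwintegrable_sum alphaN1 (iij i)).1).
apply: eq_cwintegrable iS => z _.
have -> : fourier_component n f k z = \sum_(i < n) a i * f (lam ^+ i * z).
  by rewrite /fourier_component mulr_sumr; apply: eq_bigr => i _; rewrite mulrA.
rewrite conjc_sum big_distrlr mulr_sumr; apply: eq_bigr => i _.
rewrite mulr_sumr; apply: eq_bigr => j _; rewrite [(a j * _)^*%C]conjcM.
rewrite [Monoid.MulLaw.sort _ _ _](erefl (_ * _)). ring.
Qed.

(** After the pointwise Parseval identity, the invariance of psi turns the n summands into rotated
    copies of one function; their integrals agree, and the factor 1/n averages them. *)
Lemma cwint_fourier_component s :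
  \sum_(k < n) cwint (fun z => lam ^+ (s * k) *
    (psi z * (fourier_component n f k z * (fourier_component n f k z)^*%C))) =
  cwint (fun z => psi z * (f (lam ^+ s * z) * (f z)^*%C)).
Proof.
have psi_lamX j z : psi (lam ^+ j * z) = psi z.
  by elim: j => [|j IH]; rewrite ?mul1r // exprS -mulrA psi_lam.
pose h w := psi w * (f (lam ^+ s * w) * (f w)^*%C).
have ih : cwintegrable h.
  have := cwintegrable_bergman bf bf cpsi psiM (lamX s) (@cmod1 R).
  by apply: eq_cwintegrable => z _; rewrite mul1r.
have iF (k : 'I_n) := cwintegrableZ (lam ^+ (s * k)) (cwintegrable_fourier_component k).
have iG (j : 'I_n) := (cwint_rot (lamX j) ih).1.
have [iS eS] := cwintegrable_sum alphaN1 iG.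
have [_ <-] := cwintegrable_sum alphaN1 iF.
transitivity (cwint (fun z => n%:R^-1 * \sum_(j < n) h (lam ^+ j * z))).
  apply: eq_cwint => z _.
  transitivity (psi z * \sum_(k < n) lam ^+ (s * k) *
     (fourier_component n f k z * (fourier_component n f k z)^*%C)).
    by rewrite mulr_sumr; apply: eq_bigr => k _; rewrite mulrCA.
  rewrite (fourier_parseval n0) mulrCA mulr_sumr; congr (_ * _); apply: eq_bigr => j _.
  by rewrite /h psi_lamX.
rewrite (cwintZ _ iS) eS.
under eq_bigr do rewrite (cwint_rot (lamX _) ih).2.
by rewrite sumr_const card_ord -[X in _ * X]mulr_natl mulrA mulVf ?mul1r // pnatr_eq0 -lt0n.
Qed.

End Average.

(** * The direct inclusion and the equality *)

Section Inclusion.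
Context {R : realType}.
Variables (alpha : R) (n : nat).
Hypotheses (alphaN1 : -1 < alpha) (n0 : (0 < n)%N).
Notation lam := (@root_unity R n).
Variables (psi : R[i] -> R[i]) (M : R).
Hypotheses (cpsi : disc_continuous psi) (psiM : forall z, cmod z < 1 -> cmod (psi z) <= M).
Hypothesis psi_lam : forall z, psi (lam * z) = psi z.

(** The densities |f_k|^2 make up one probability measure on n copies of the disc, with the function
    lam^k psi on the k-th copy, so [convex_mean] applies to the n components jointly. *)
Lemma numrange_sub_convex (K : set R[i]) :
  (forall A B (t : R), 0 <= t <= 1 -> K A -> K B -> K (t%:C * A + (1 - t)%:C * B)) ->
  (forall (k : 'I_n) z, cmod z < 1 -> K (lam ^+ k * psi z)) ->
  numrange alpha (wcomp psi (fun z => lam * z)) `<=` K.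
Proof.
move=> cK Kc _ [f [bf nf] <-].
pose q (k : nat) z := cmod (fourier_component n f k z) ^+ 2.
have one1 (z : R[i]) : cmod z < 1 -> cmod (1 : R[i]) <= 1 by rewrite cmod1.
have i1 := cwintegrable_fourier_component n alphaN1 bf (@disc_continuous_cst R 1) one1.
have iq (k : 'I_n) : wintegrable alpha (q k).
  by apply: eq_wintegrable (i1 k).1 => z _; rewrite mul1r mulcJ_cmod.
have qc (k : 'I_n) z : lam ^+ (1 * k) *
    (psi z * (fourier_component n f k z * (fourier_component n f k z)^*%C)) =
    (q k z)%:C * (lam ^+ k * psi z).
  by rewrite mul1n mulcJ_cmod /q; ring.
have iqc (k : 'I_n) : cwintegrable alpha (fun z => (q k z)%:C * (lam ^+ k * psi z)).
  have := cwintegrableZ (lam ^+ (1 * k)) (cwintegrable_fourier_component n alphaN1 bf cpsi psiM k).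
  by apply: eq_cwintegrable => z _; exact: qc.
(* The averaging identity with psi = 1 and s = 0. *)
have q1 : \sum_(k < n) wint alpha (q k) = 1.
  apply: (@complexI R); rewrite rmorph_sum -nf normsqE -(cwint_sqr alphaN1) /=.
  transitivity (cwint alpha (fun z => 1 * (f (lam ^+ 0 * z) * (f z)^*%C))); last first.
    by apply: eq_cwint => z _; rewrite !mul1r.
  rewrite -(cwint_fourier_component alphaN1 n0 bf (@disc_continuous_cst R 1) one1 (fun=> erefl) 0).
  apply: eq_bigr => k _; rewrite -(cwint_real alphaN1); apply: eq_cwint => z _.
  by rewrite mul0n !mul1r mulcJ_cmod.
have := convex_mean alphaN1 cK Kc (fun k z => exprn_ge0 2 (cmod_ge0 (fourier_component n f k z))) iq iqc q1.
congr K; rewrite innerE.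
transitivity (cwint alpha (fun z => psi z * (f (lam ^+ 1 * z) * (f z)^*%C))); last first.
  by apply: eq_cwint => z _; rewrite /wcomp expr1 mulrA.
rewrite -(cwint_fourier_component alphaN1 n0 bf cpsi psiM psi_lam 1).
by apply: eq_bigr => k _; apply: eq_cwint => z _; rewrite qc.
Qed.

End Inclusion.

Theorem theorem3p13 (R : realType) (alpha : R) (n : nat) (g : R[i] -> R[i]) :
  -1 < alpha -> (0 < n)%N -> Hinfty g ->
  let lam := @root_unity R n in
  let phi := fun z : R[i] => lam * z in
  let psi := fun z : R[i] => g (z ^+ n) in
  numrange alpha (wcomp psi phi) =
  convex_hull (\bigcup_(k in [set k : nat | (k < n)%N]) [set lam ^+ k * w | w in psi @` @disc R]).
Proof.
move=> alphaN1 n0 [/analytic_on_discP ag [M gM]] lam phi psi.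
(* The bound in [Hinfty] involves only M^2, so M may be negative and its absolute value is taken. *)
have gM' z : cmod z < 1 -> cmod (g z) <= `|M|.
  move=> z1; have /gM : z \in @disc R by rewrite mem_disc.
  by rewrite -sqr_cmod -(real_normK (num_real M)) ler_sqr ?nnegrE ?cmod_ge0.
have Xn1 (z : R[i]) : cmod z < 1 -> cmod (z ^+ n) < 1.
  by move=> z1; rewrite cmodX exprn_ilt1 ?cmod_ge0 // -lt0n.
have cpsi : disc_continuous psi.
  move=> z z1; have [D1 d1] := cderivX n z; have [D2 d2] := ag _ (Xn1 z z1).
  exact: cderiv_continuous (cderiv_comp d1 d2).
have psiM z : cmod z < 1 -> cmod (psi z) <= `|M| by move=> z1; exact/gM'/Xn1.
have lam1 : cmod lam = 1 by exact: cmod_root_unity.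
have lamn : lam ^+ n = 1 by exact: root_unityXn.
apply/seteqP; split.
  apply: (numrange_sub_convex alphaN1 n0 cpsi psiM).
  - by move=> z; rewrite /psi exprMn lamn mul1r.
  - by move=> A B t; exact: convex_hull_convex.
  move=> k z z1; apply: sub_convex_hull; exists (k : nat); first exact: ltn_ord.
  exists (psi z) => //; exists z => //; apply/set_mem; by rewrite mem_disc.
apply: convex_hull_sub.
  by move=> A B t; exact: (numrange_convex alphaN1 lam1 cpsi psiM).
move=> _ [k _ [_ [w /mem_set w1 <-] <-]].
have {}w1 : cmod w < 1 by rewrite -mem_disc.
exact: (numrange_kernel alphaN1 k n0 lam1 lamn w1 ag gM').
Qed.
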